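(* Let $X$ be an open set in $\mathbb{R}^n$ and assume that $0\leq q < p \leq \infty$. Suppose that $T: C^p(X,E) \to C^q(Y,F)$ is a weakly compact, separating, nowhere trivial linear operator with support map $h$. Then there exist $\ell\in \mathbb{N}_p$ and functions $\Phi_k: Y\times \mathcal{S}^k(\mathbb{R}^n,E) \to F$, $0 \leq k \leq \ell$, so that $T$ has the representation $$Tf(y) = \sum^{\ell}_{k=0}\Phi_k(y, D^kf(h(y)))$$ for all $f\in C^p(X,E)$ and all $y \in Y$. For a given $y$, $\Phi_k(y,\cdot)$ is a bounded linear operator from $\mathcal{S}^k(\mathbb{R}^n,E)$ into $F$. The set $h(Y)$ is relatively compact in $X$. There exists a dense open set $U$ in $Y$ so that $h$ is $C^q$ on $U$. For each $S \in \mathcal{S}^k(\mathbb{R}^n,E)$, $\Phi_k(y,S)$ belongs to $C^q(U,F)$ as a function of $y \in U$. Moreover, for any $k \leq \ell$, (a) for any $y \in U$ and $m \in \mathbb{N}_q$, the map $D_y^m\Phi_k(y,\cdot): \mathcal{S}^k(\mathbb{R}^n,E) \to \mathcal{S}^m(H,F)$ is a weakly compact operator; (b) for each $m \in \mathbb{N}_q$, the map $y\mapsto (D_y^m\Phi_k(y,\cdot))^{**}$ from $U$ into the space of bounded linear operators $L(\mathcal{S}^k(\mathbb{R}^n,E)^{**}, \mathcal{S}^m(H,F)^{**})$ is continuous with respect to the strong operator topology.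
   Context: $H,E,F$ are real Banach spaces, $G=\mathbb{R}^n$, and $Y\subseteq H$ is open. $\mathbb{N}_p=\{i\in\mathbb{N}\cup\{0\}: i\le p\}$ (all nonnegative integers if $p=\infty$). $\mathcal{S}^k(G,E)$ is the Banach space of bounded symmetric $k$-linear maps $G^k\to E$, with $\mathcal{S}^0(G,E)=E$. $C^p(X,E)$ is the space of all $f:X\to E$ such that for all $k\in\mathbb{N}_p$ the Fréchet derivative $D^kf$ ($D^0f=f$) is a continuous function from $X$ to $\mathcal{S}^k(G,E)$; $C^p(X)=C^p(X,\mathbb{R})$. $C^p(X,E)$ carries the topology generated by the seminorms $\rho_{K,k}(f)=\sup_{x\in K}\sup_{0\le j\le k}\|D^jf(x)\|$, $K\subseteq X$ compact, $k\in\mathbb{N}_p$; similarly for $C^q(Y,F)$. $D_y^m\Phi_k(y,\cdot)$ denotes the map sending $S$ to the $m$-th derivative, at $y$, of the function $y\mapsto\Phi_k(y,S)$. $R^*$ denotes the adjoint of a bounded operator $R$ and $R^{**}=(R^* )^*$. The strong operator topology on $L(G_1,G_2)$ is generated by the seminorms $R\mapsto\|Ru\|$, $u\in G_1$. A linear map between topological vector spaces is weakly compact if it maps some (nonempty) open set onto a relatively weakly compact set. Two functions are disjoint if at every point at least one of them is $0$. A map $T$ is separating if it maps disjoint functions to disjoint functions. $T$ is nowhere trivial if for every $y\in Y$ there is $f\in C^p(X,E)$ with $Tf(y)\ne0$. Support map: let $\mathbb{R}_\infty$ be the one-point compactification of $\mathbb{R}$, $i:X\to\mathbb{R}_\infty^{C^p(X)}$,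 $i(x)(\psi)=\psi(x)$ (a homeomorphic embedding), and let $\mathcal{A}X$ be the closure of $i(X)$. For $f\in C^p(X,E)$ let $\overline{C}(f)$ be the closure in $\mathcal{A}X$ of $i(\{x:f(x)\ne0\})$. For $y\in Y$ let $\mathcal{O}_y$ be the family of open subsets $U$ of $\mathcal{A}X$ for which there is $f\in C^p(X,E)$ with $Tf(y)\ne0$ and $\overline{C}(f)\subseteq U$. Then $h(y)$ is the unique point of $\bigcap\{\overline{U}^{\mathcal{A}X}:U\in\mathcal{O}_y\}$; for $T$ continuous, separating and nowhere trivial, $h(y)\in i(X)$, and $i(X)$ is identified with $X$, so that $h:Y\to X$ (a continuous map). *)

(* Defs.v *)
From HB Require Import structures.
From mathcomp Require Import all_boot all_order all_algebra perm.
From mathcomp Require Import all_classical all_reals all_analysis.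

Set Implicit Arguments.
Unset Strict Implicit.
Unset Printing Implicit Defensive.

Import Order.TTheory GRing.Theory Num.Theory.
Import numFieldNormedType.Exports.

Local Open Scope classical_set_scope.
Local Open Scope ring_scope.

Section sup_norm.
Context {R : realType} {A : Type} {W : normedModType R}.
Implicit Types (D : set A) (f g : A -> W).

Definition bounded_on D f := exists M, forall x, D x -> `|f x| <= M.

Definition sup_norm D f : R := sup [set `|f x| | x in D].

Lemma sup_norm_ub D f x : bounded_on D f -> D x -> `|f x| <= sup_norm D f.
Proof.
move=> [M fM] Dx; apply: ub_le_sup; last by exists x.
by exists M => _ [y Dy <-]; exact: fM.
Qed.

Lemma sup_norm_le D f c : D !=set0 -> (forall x, D x -> `|f x| <= c) ->
  sup_norm D f <= c.
Proof.
move=> [x Dx] fc; apply: ge_sup; first by exists `|f x|, x.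
by move=> _ [y Dy <-]; exact: fc.
Qed.

Lemma sup_normD D f g : D !=set0 -> bounded_on D f -> bounded_on D g ->
  sup_norm D (f + g) <= sup_norm D f + sup_norm D g.
Proof.
move=> D0 bf bg; apply: sup_norm_le => // x Dx.
by rewrite (le_trans (ler_normD _ _))// lerD// sup_norm_ub.
Qed.

Lemma sup_normZ D f (a : R) : D !=set0 -> bounded_on D f ->
  sup_norm D (a *: f) = `|a| * sup_norm D f.
Proof.
move=> D0 bf; have baf b : bounded_on D (b *: f).
  have [M fM] := bf; exists (`|b| * M) => x Dx.
  by rewrite normrZ ler_wpM2l// fM.
have le b h : bounded_on D h -> sup_norm D (b *: h) <= `|b| * sup_norm D h.
  move=> bh; apply: sup_norm_le => // x Dx.
  by rewrite normrZ ler_wpM2l// sup_norm_ub.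
apply/eqP; rewrite eq_le le//=.
have [->|a0] := eqVneq a 0.
  rewrite normr0 mul0r; have [x Dx] := D0.
  exact: le_trans (normr_ge0 _) (sup_norm_ub (baf 0) Dx).
rewrite -ler_pdivlMl ?normr_gt0// -normfV.
have {1}-> : f = a^-1 *: (a *: f) by rewrite scalerA mulVf// scale1r.
exact: le.
Qed.

End sup_norm.

Section symml.
Context {R : realType}.
Variables (k : nat) (V W : normedModType R).
Implicit Types (f : ('I_k -> V) -> W) (x : 'I_k -> V).

Definition multilinear f :=
  forall (i : 'I_k) x, linear (fun u : V => f (dfwith x i u)).

Definition symmetric_fun f := forall (s : 'S_k) x, f (x \o s) = f x.

Definition bounded_multilinear f :=
  exists M, forall x, `|f x| <= M * \prod_i `|x i|.

Definition symml_pred : {pred ('I_k -> V) -> W} :=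
  [pred f | `[< [/\ multilinear f, symmetric_fun f & bounded_multilinear f] >]].

Record symml := Symml {
  symml_fun :> ('I_k -> V) -> W ;
  _ : symml_fun \in symml_pred }.

HB.instance Definition _ := [isSub for symml_fun].
HB.instance Definition _ := [Choice of symml by <:].

Lemma symml_submod_closed : submod_closed symml_pred.
Proof.
split.
  apply/asboolP; split => //.
  - by move=> i x a u v; rewrite /= scaler0 addr0.
  - by exists 0 => x; rewrite normr0 mul0r.
move=> a f g /asboolP[lf sf [M fM]] /asboolP[lg sg [N gN]].
apply/asboolP; split.
- move=> i x b u v; rewrite -!/(_ f _) !fctE lf lg !scalerDr !scalerA addrACA.
  by rewrite (mulrC a b).
- by move=> s x; rewrite !fctE sf sg.
- exists (`|a| * M + N) => x; rewrite mulrDl -mulrA !fctE.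
  by rewrite (le_trans (ler_normD _ _))// lerD// normrZ ler_wpM2l.
Qed.

HB.instance Definition _ := GRing.isSubmodClosed.Build _ _ symml_pred
  (GRing.submod_closed_semi symml_submod_closed).
HB.instance Definition _ := [SubChoice_isSubLmodule of symml by <:].

Definition unit_polyball : set ('I_k -> V) := [set x | forall i, `|x i| <= 1].

Definition symml_norm (T : symml) : R := sup_norm unit_polyball T.

Lemma symmlP (T : symml) :
  [/\ multilinear T, symmetric_fun T & bounded_multilinear T].
Proof. by apply/asboolP; case: T. Qed.

Lemma symml_linearE a (S T : symml) x : (a *: S + T) x = a *: S x + T x.
Proof. by []. Qed.

Lemma unit_polyball_neq0 : unit_polyball !=set0.
Proof. by exists (fun=> 0) => i; rewrite normr0. Qed.

Lemma symml_bounded_on (T : symml) : bounded_on unit_polyball T.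
Proof.
have [_ _ [M TM]] := symmlP T; exists `|M| => x x1.
rewrite (le_trans (TM x))// (le_trans (ler_norm _))// normrM.
rewrite ler_piMr// ger0_norm ?prodr_ge0//.
by apply: prodr_ile1 => i _; rewrite normr_ge0 x1.
Qed.

Lemma multilinearZ f x (c : 'I_k -> R) : multilinear f ->
  f (fun i => c i *: x i) = (\prod_i c i) *: f x.
Proof.
move=> lf.
suff H m : (m <= k)%N -> f (fun i => if (i < m)%N then c i *: x i else x i) =
    (\prod_(i < k | (i < m)%N) c i) *: f x.
  rewrite (eq_bigl (fun i : 'I_k => (i < k)%N)); last by move=> i; rewrite ltn_ord.
  by rewrite -H//; congr f; apply/funext => i; rewrite ltn_ord.
elim: m => [_|m IHm mk].
  by rewrite big_pred0// scale1r.
rewrite (bigD1 (Ordinal mk))//=.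
rewrite (eq_bigl (fun i : 'I_k => (i < m)%N)); last first.
  by move=> i; rewrite ltnS ltn_neqAle andbC -val_eqE.
rewrite -scalerA -IHm; last exact: ltnW.
set y := (fun i : 'I_k => if (i < m)%N then _ else _).
have lin := lf (Ordinal mk) y (c (Ordinal mk)) (x (Ordinal mk)) 0.
have l0 : f (dfwith y (Ordinal mk) 0) = 0.
  have := lf (Ordinal mk) y (-1) 0 0; rewrite scaler0 addr0 => ->.
  by rewrite scaleN1r addNr.
move: lin; rewrite l0 !addr0 => lin.
have -> : y = dfwith y (Ordinal mk) (x (Ordinal mk)).
  apply/funext => j; case: dfwithP => //.
  by rewrite /y/= ltnn.
rewrite -lin; congr f; apply/funext => j.
case: dfwithP => [|i]; first by rewrite /= ltnSn.
by rewrite -val_eqE/= /y ltnS leq_eqVlt eq_sym => /negbTE ->.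
Qed.

Lemma symml_normD (S T : symml) :
  symml_norm (S + T) <= symml_norm S + symml_norm T.
Proof. exact: sup_normD unit_polyball_neq0 (symml_bounded_on S) (symml_bounded_on T). Qed.

Lemma symml_normZ (a : R) (T : symml) : symml_norm (a *: T) = `|a| * symml_norm T.
Proof. exact: sup_normZ unit_polyball_neq0 (symml_bounded_on T). Qed.

Lemma symml_norm_eq0 (T : symml) : symml_norm T = 0 -> T = 0.
Proof.
move=> T0; apply/val_inj/funext => x /=.
have [lT _ _] := symmlP T.
pose c i := (1 + `|x i|)^-1.
have c0 i : 0 < c i by rewrite invr_gt0 ltr_wpDr.
have : T (fun i => c i *: x i) = 0.
  apply/eqP; rewrite -normr_eq0 eq_le normr_ge0 -T0 andbT.
  apply: (sup_norm_ub (symml_bounded_on T)) => i.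
  rewrite normrZ (ger0_norm (ltW (c0 i))) /c mulrC ler_pdivrMr ?ltr_wpDr// mul1r.
  by rewrite lerDr.
rewrite multilinearZ// => /eqP; rewrite scaler_eq0 => /orP[|/eqP//].
by rewrite gt_eqF// prodr_gt0.
Qed.

HB.instance Definition _ :=
  Lmodule_isNormed.Build R symml symml_normD symml_normZ symml_norm_eq0.

End symml.
Arguments symml_pred {R} k V W.

Definition bounded_linear {R : realType} {V W : normedModType R} (f : V -> W) :=
  linear f /\ exists M, forall x, `|f x| <= M * `|x|.

Definition bop_pred {R : realType} (V W : normedModType R) : {pred V -> W} :=
  [pred f | `[< bounded_linear f >]].
Arguments bop_pred {R} V W.

Section bop.
Context {R : realType}.
Variables (V W : normedModType R).

Record bop := Bop {
  bop_fun :> V -> W ;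
  _ : bop_fun \in bop_pred V W }.

HB.instance Definition _ := [isSub for bop_fun].
HB.instance Definition _ := [Choice of bop by <:].

Lemma bop_submod_closed : submod_closed (bop_pred V W).
Proof.
split.
  apply/asboolP; split => //.
  - by move=> a u v; rewrite /= scaler0 addr0.
  - by exists 0 => x; rewrite normr0 mul0r.
move=> a f g /asboolP[lf [M fM]] /asboolP[lg [N gN]].
apply/asboolP; split.
- move=> b u v; rewrite !fctE lf lg !scalerDr !scalerA addrACA.
  by rewrite (mulrC a b).
- exists (`|a| * M + N) => x; rewrite mulrDl -mulrA !fctE.
  by rewrite (le_trans (ler_normD _ _))// lerD// normrZ ler_wpM2l.
Qed.

HB.instance Definition _ := GRing.isSubmodClosed.Build _ _ (bop_pred V W)
  (GRing.submod_closed_semi bop_submod_closed).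
HB.instance Definition _ := [SubChoice_isSubLmodule of bop by <:].

Definition unit_ball : set V := [set x | `|x| <= 1].

Definition bop_norm (A : bop) : R := sup_norm unit_ball A.

Lemma bopP (A : bop) : bounded_linear A.
Proof. by apply/asboolP; case: A. Qed.

Lemma unit_ball_neq0 : unit_ball !=set0.
Proof. by exists 0; rewrite /unit_ball/= normr0. Qed.

Lemma bop_bounded_on (A : bop) : bounded_on unit_ball A.
Proof.
have [_ [M AM]] := bopP A; exists `|M| => x x1.
rewrite (le_trans (AM x))// (le_trans (ler_norm _))// normrM normr_id.
by rewrite ler_piMr.
Qed.

Lemma bop_normD (A B : bop) : bop_norm (A + B) <= bop_norm A + bop_norm B.
Proof. exact: sup_normD unit_ball_neq0 (bop_bounded_on A) (bop_bounded_on B). Qed.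

Lemma bop_normZ (a : R) (A : bop) : bop_norm (a *: A) = `|a| * bop_norm A.
Proof. exact: sup_normZ unit_ball_neq0 (bop_bounded_on A). Qed.

Lemma bop_linearZ (A : bop) (a : R) x : A (a *: x) = a *: A x.
Proof.
have [lA _] := bopP A.
have A0 : A 0 = 0.
  by have := lA (-1) 0 0; rewrite scaler0 addr0 => ->; rewrite scaleN1r addNr.
by have := lA a x 0; rewrite A0 !addr0.
Qed.

Lemma bop_norm_le (A : bop) x : `|A x| <= bop_norm A * `|x|.
Proof.
have [->|x0] := eqVneq x 0.
  by rewrite -[0 in X in X <= _](scale0r 0) bop_linearZ scale0r !normr0 mulr0.
rewrite -ler_pdivrMr ?normr_gt0// mulrC.
have -> : `|x|^-1 * `|A x| = `|A (`|x|^-1 *: x)|.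
  by rewrite bop_linearZ normrZ normfV normr_id.
apply: (sup_norm_ub (bop_bounded_on A)); rewrite /unit_ball/=.
by rewrite normrZ normfV normr_id mulVf// normr_eq0.
Qed.

Lemma bop_norm_ge0 (A : bop) : 0 <= bop_norm A.
Proof.
have [x Bx] := unit_ball_neq0.
exact: le_trans (normr_ge0 _) (sup_norm_ub (bop_bounded_on A) Bx).
Qed.

Lemma bop_norm_eq0 (A : bop) : bop_norm A = 0 -> A = 0.
Proof.
move=> A0; apply/val_inj/funext => x /=; apply/eqP.
by rewrite -normr_eq0 eq_le normr_ge0 andbT (le_trans (bop_norm_le A x))// A0 mul0r.
Qed.

HB.instance Definition _ :=
  Lmodule_isNormed.Build R bop bop_normD bop_normZ bop_norm_eq0.

(* Bundles [f]; only meaningful when [f] is a bounded linear operator. *)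
Definition to_bop (f : V -> W) : bop := xget 0 [set A : bop | A = f :> (V -> W)].

End bop.


Definition dual {R : realType} (V : normedModType R) := bop V (R^o : normedModType R).

HB.instance Definition _ {R : realType} (V : normedModType R) :=
  NormedModule.on (dual V).

Section adjoint.
Context {R : realType}.
Variables (V W : normedModType R).

Lemma adjoint_fun_subproof (A : bop V W) (phi : dual W) :
  phi \o A \in bop_pred V R^o.
Proof.
apply/asboolP; split.
  have [lA _] := bopP A; have [lp _] := bopP phi.
  by move=> a u v /=; rewrite lA lp.
exists (bop_norm phi * bop_norm A) => x /=.
rewrite (le_trans (bop_norm_le _ _))// -mulrA ler_wpM2l ?bop_norm_le//.
exact: bop_norm_ge0.
Qed.

Definition adjoint_fun (A : bop V W) (phi : dual W) : dual V :=
  Bop (adjoint_fun_subproof A phi).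

Lemma adjoint_subproof (A : bop V W) :
  adjoint_fun A \in bop_pred (dual W) (dual V).
Proof.
apply/asboolP; split.
  by move=> a phi psi; apply/val_inj/funext.
exists (bop_norm A) => phi; apply: sup_norm_le; first exact: unit_ball_neq0.
move=> x x1; rewrite mulrC (le_trans (bop_norm_le phi (A x)))//.
rewrite ler_wpM2l ?bop_norm_ge0// (le_trans (bop_norm_le A x))//.
by rewrite ler_piMr ?bop_norm_ge0.
Qed.

Definition adjoint (A : bop V W) : bop (dual W) (dual V) :=
  Bop (adjoint_subproof A).

End adjoint.

Definition bidual {R : realType} (V : normedModType R) := dual (dual V).

HB.instance Definition _ {R : realType} (V : normedModType R) :=
  NormedModule.on (bidual V).

Definition biadjoint {R : realType} (V W : normedModType R) (A : bop V W) :
  bop (bidual V) (bidual W) := adjoint (adjoint A).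

(* The topology on [V] generated by the seminorms [rho i], [i] in [D]. *)
Definition seminorm_topology {R : realType} {I V : Type} (D : set I)
  (rho : I -> V -> R) : Type := V.

Section seminorm_topology.
Context {R : realType} {I : pointedType} {V : lmodType R}.
Variables (D : set I) (rho : I -> V -> R).

HB.instance Definition _ := Choice.copy (seminorm_topology D rho) V.

Definition seminorm_ball_index : Type := (V * I * R)%type.

HB.instance Definition _ := Choice.on seminorm_ball_index.
HB.instance Definition _ :=
  isPointed.Build seminorm_ball_index (0 : V, point : I, 0 : R).

Definition seminorm_ball (b : seminorm_ball_index) :
    set (seminorm_topology D rho) :=
  [set v : V | rho b.1.2 (v - b.1.1) < b.2].

HB.instance Definition _ := isSubBaseTopological.Build (seminorm_topology D rho)
  [set b : seminorm_ball_index | D b.1.2 /\ 0 < b.2] seminorm_ball.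

End seminorm_topology.

(* The strong operator topology. *)
Definition sot {R : realType} (V W : normedModType R) : Type :=
  seminorm_topology [set: V] (fun u (A : bop V W) => `|A u|).

HB.instance Definition _ {R : realType} (V W : normedModType R) :=
  Topological.on (sot V W).

Section weak_compactness.
Context {R : realType}.
Implicit Types V W : preTopologicalLmodType R.

(* [weak_space W] is [W] with the topology sigma(W, W'), for [W'] the space of
   continuous linear forms on [W]. *)
Definition weak_eval W (w : W) :
    {ptws {phi : {linear W -> R^o} | continuous phi} -> R^o} :=
  fun phi => sval phi w.

Definition weak_space W : Type := initial_topology (@weak_eval W).

HB.instance Definition _ W := Topological.on (weak_space W).

Definition relatively_weakly_compact W (A : set W) :=
  precompact (A : set (weak_space W)).

Definition weakly_compact V W (T : V -> W) := exists O : set V,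
  [/\ open O, O !=set0 & relatively_weakly_compact (T @` O)].

End weak_compactness.

Section frechet.
Context {R : realType} {V W : normedModType R}.

(* [symml 0 V W] is a copy of [W]: its elements are the functions with a single
   value. *)
Lemma symml0_subproof (w : W) : cst w \in symml_pred 0%N V W.
Proof.
apply/asboolP; split => //; first by case.
by exists `|w| => x; rewrite big_ord0 mulr1.
Qed.

Definition symml0 (w : W) : symml 0%N V W := Symml (symml0_subproof w).

(* [S] in S^(k+1)(V, W) corresponds to the derivative of [g] at [x], in
   L(V, S^k(V, W)), under S |-> (v |-> S(v, -)). *)
Definition symml_derivative k (g : V -> symml k V W) x (S : symml k.+1 V W) :=
  differentiable g x /\
  forall v, S v = 'd g x (v ord0) (fun i => v (lift ord0 i)).

(* Where [frechetD f j] has no derivative, [frechetD f j.+1] is 0; [Cp_on] below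
   requires the derivatives to exist. *)
Fixpoint frechetD (f : V -> W) k : V -> symml k V W :=
  if k is j.+1 then
    fun x => xget 0 [set S : symml j.+1 V W |
                      symml_derivative (frechetD f j) x S]
  else fun x => symml0 (f x).

End frechet.

(* Extended naturals: [None] is infinity. *)
Definition Np (p : option nat) : pred nat :=
  fun i => if p is Some m then (i <= m)%N else true.

Definition lt_enat (q : nat) (p : option nat) : bool :=
  if p is Some m then (q < m)%N else true.

Section Cp.
Context {R : realType} {V W : normedModType R}.
Implicit Types (p : option nat) (X : set V) (f g : V -> W).

Definition Cp_on p X f :=
  (forall k, Np p k.+1 -> forall x, X x ->
     symml_derivative (frechetD f k) x (frechetD f k.+1 x)) /\
  (forall k, Np p k -> {within X, continuous (frechetD f k)}).

Lemma near_eq_is_diff (U : normedModType R) (f g df : V -> U) x :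
  {near x, f =1 g} -> is_diff x f df -> is_diff x g df.
Proof.
move=> fg [dfx <-].
have gx : g \o shift x = cst (g x) + 'd f x +o_ 0 id.
  apply/eqaddoP => e e0.
  have /eqaddoP/(_ e e0) := diff_locally dfx.
  have : \forall z \near (0 : V), f (z + x) = g (z + x).
    have fgx : \forall z \near x, f z = g z by exact: fg.
    by move: fgx; rewrite (near_shift 0) subr0.
  apply: filterS2 => z fgz; rewrite !fctE /= (nbhs_singleton fg).
  by rewrite fgz.
have dg : 'd g x = 'd f x :> (V -> U) by apply: diff_unique gx; exact: diff_continuous.
split => //; apply/diff_locallyP; rewrite dg; split => //.
exact: diff_continuous.
Qed.

Lemma symml_derivative_unique k (g : V -> symml k V W) x S S' :
  symml_derivative g x S -> symml_derivative g x S' -> S = S'.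
Proof.
by move=> [_ SE] [_ S'E]; apply/val_inj/funext => v; rewrite /= SE S'E.
Qed.

Lemma frechetDS f k x S : symml_derivative (frechetD f k) x S ->
  frechetD f k.+1 x = S.
Proof.
move=> fS; apply: symml_derivative_unique (fS).
exact: (@xgetI _ 0 _ _ fS).
Qed.

Lemma is_diff_linear (U : normedModType R) (F G dF dG : V -> U) a x :
  is_diff x F dF -> is_diff x G dG ->
  is_diff x (fun z => a *: F z + G z) (fun v => a *: dF v + dG v).
Proof. by move=> HF HG; exact: (is_diffD (is_diffZ a HF) HG). Qed.

Lemma symml_derivative_linear k (F G : V -> symml k V W) a x S S' :
  symml_derivative F x S -> symml_derivative G x S' ->
  symml_derivative (fun z => a *: F z + G z) x (a *: S + S').
Proof.
move=> [dF SE] [dG S'E].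
have [d e] := is_diff_linear a (differentiableP dF) (differentiableP dG).
by split; [exact: d|move=> v; rewrite e symml_linearE SE S'E].
Qed.

Lemma frechetD_linear p X f g a : open X -> Cp_on p X f -> Cp_on p X g ->
  forall k, Np p k -> forall x, X x ->
  frechetD (a *: f + g) k x = a *: frechetD f k x + frechetD g k x.
Proof.
move=> oX [fp _] [gp _]; elim=> [_ x Xx|k IH kp x Xx].
  exact/val_inj/funext.
apply: frechetDS.
have [d e] := symml_derivative_linear a (fp k kp x Xx) (gp k kp x Xx).
have kp' : Np p k by case: p kp {fp gp IH} => //= m; exact: ltnW.
have [] := near_eq_is_diff (g := frechetD (a *: f + g) k) _ (differentiableP d).
  near=> z; rewrite IH//; near: z; exact: open_nbhs_nbhs.
by move=> d' e'; split; [exact: d'|move=> v; rewrite e' e].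
Unshelve. all: by end_near. Qed.

Lemma Cp_on_linear p X f g a : open X -> Cp_on p X f -> Cp_on p X g ->
  Cp_on p X (a *: f + g).
Proof.
move=> oX fX gX; have lin := frechetD_linear a oX fX gX.
have [fp fc] := fX; have [gp gc] := gX; split => k kp.
  move=> x Xx; have kp' : Np p k.
    by case: p kp {fX gX lin fp fc gp gc} => //= m; exact: ltnW.
  have [d e] := symml_derivative_linear a (fp k kp x Xx) (gp k kp x Xx).
  have [] := near_eq_is_diff (g := frechetD (a *: f + g) k) _ (differentiableP d).
    near=> z; rewrite lin//; near: z; exact: open_nbhs_nbhs.
  by move=> d' e'; split; [exact: d'|move=> v; rewrite e' -e lin].
apply: (@subspace_eq_continuous _ _ _
    (fun x => a *: frechetD f k x + frechetD g k x)).
  by move=> x /set_mem Xx; exact/esym/lin.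
move=> x; apply: cvgD; last exact: gc.
apply: cvgZr; exact: fc.
Unshelve. all: by end_near. Qed.

Lemma frechetD0 k : frechetD (0 : V -> W) k = cst 0.
Proof.
elim: k => [|k IH]; first by apply/funext => x; exact/val_inj.
apply/funext => x; apply: frechetDS; rewrite IH; split=> [|v].
  exact: differentiable_cst.
by rewrite diff_cst.
Qed.

Lemma Cp_on0 p X : Cp_on p X (0 : V -> W).
Proof.
split => k kp.
  move=> x _; rewrite !frechetD0; split=> [|v]; first exact: differentiable_cst.
  by rewrite diff_cst.
by rewrite frechetD0 => x; exact: cvg_cst.
Qed.

End Cp.

Definition Cp_pred {R : realType} {V : normedModType R} (p : option nat)
    (X : set V) (W : normedModType R) : {pred V -> W} :=
  [pred f | `[< Cp_on p X f /\ (forall x, ~ X x -> f x = 0) >]].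
Arguments Cp_pred {R V} p X W.

(* C^p(X, W), where functions on [X] are represented by their extension by 0;
   [oX] makes the linear structure available. *)
Record Cp {R : realType} {V : normedModType R} (p : option nat) (X : set V)
  (oX : open X) (W : normedModType R) := MkCp {
  Cp_fun :> V -> W ;
  _ : Cp_fun \in Cp_pred p X W }.

Section Cp_space.
Context {R : realType} {V : normedModType R}.
Variables (p : option nat) (X : set V) (oX : open X) (W : normedModType R).

Local Notation Cp := (Cp p oX W).

HB.instance Definition _ := [isSub of Cp for @Cp_fun _ _ _ _ _ _].
HB.instance Definition _ := [Choice of Cp by <:].

Lemma Cp_submod_closed : submod_closed (Cp_pred p X W).
Proof.
split; first by apply/asboolP; split => //; exact: Cp_on0.
move=> a f g /asboolP[fX f0] /asboolP[gX g0]; apply/asboolP; split.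
  exact: Cp_on_linear.
by move=> x nXx; rewrite !fctE f0// g0// scaler0 addr0.
Qed.

Let submod := GRing.submod_closed_semi Cp_submod_closed.
HB.instance Definition _ :=
  GRing.SubChoice_isSubLmodule.Build R (V -> W) (Cp_pred p X W) Cp submod.

Definition Cp_seminorm (Kk : set V * nat) (f : Cp) : R :=
  sup [set \big[Num.max/0]_(j < Kk.2.+1) `|frechetD f j x| | x in Kk.1].

HB.instance Definition _ := Topological.copy Cp
  (seminorm_topology
    [set Kk : set V * nat | [/\ compact Kk.1, Kk.1 `<=` X & Np p Kk.2]]
    Cp_seminorm).

End Cp_space.

Section separating.
Context {R : realType} {V V' : normedModType R} {W W' : normedModType R}.
Context {p q : option nat} {X : set V} {Y : set V'} {oX : open X} {oY : open Y}.
Implicit Types (T : Cp p oX W -> Cp q oY W').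

Definition separating T := forall f g : Cp p oX W,
  (forall x, X x -> f x = 0 \/ g x = 0) ->
  forall y, Y y -> T f y = 0 \/ T g y = 0.

Definition nowhere_trivial T := forall y, Y y -> exists f, T f y != 0.

(* [opc_closure] is the closure, in the power of the one-point compactification
   of the reals indexed by C^p(X), of the image of [X] by evaluation. *)
Definition opc_product :=
  {ptws Cp p oX R^o -> one_point_compactification R^o}.

Definition opc_embed (x : V) : opc_product := fun psi => Some (psi x).

Definition opc_closure : set opc_product := closure (opc_embed @` X).

Definition opc_support (f : Cp p oX W) : set opc_product :=
  opc_closure `&` closure (opc_embed @` [set x | X x /\ f x != 0]).

Definition support_family T y : set (set opc_product) :=
  [set U | (exists2 O, open O & U = opc_closure `&` O) /\
           exists2 f, T f y != 0 & opc_support f `<=` U].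

Definition support_set T y : set opc_product :=
  \bigcap_(U in support_family T y) (opc_closure `&` closure U).

(* The default value 0 is taken when [support_set T y] is not of the form
   [{i(x)}] with [x] in [X]. *)
Definition support_map T (y : V') : V :=
  xget 0 [set x | X x /\ support_set T y = [set opc_embed x]].

End separating.

Definition relatively_compact_in {T : topologicalType} (X A : set T) :=
  A `<=` X /\ compact (X `&` closure A).

(* Main.v *)
Require Import Defs.
From HB Require Import structures.
From mathcomp Require Import all_boot all_order all_algebra perm.
From mathcomp Require Import all_classical all_reals all_analysis.
From mathcomp Require Import ring lra.
From mathcomp Require finmap.

Set Implicit Arguments.
Unset Strict Implicit.
Unset Printing Implicit Defensive.

Import Order.TTheory GRing.Theory Num.Theory.
Import numFieldNormedType.Exports.

Local Open Scope classical_set_scope.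
Local Open Scope ring_scope.

(** Weak compactness makes T an operator of finite order: T maps all f whose
    derivatives of order at most k are small on some compact set K into a
    translate of a weakly compact set ([weakly_compact_jet_ball]).  For fixed y
    the map T_y : f |-> T f y is therefore bounded on those f ([point_bound]).
    By compactness, K contains a point a such that every neighbourhood of a
    supports some f with T_y f != 0 ([support_point_exists]).  A function that
    vanishes near a is disjoint from one of these, so T_y kills it because T is
    separating.  Multiplying by bumps of radius e, whose derivatives of order i
    are O(e^-i) against Taylor remainders o(e^(k-i)), shows that T_y kills every
    function whose derivatives up to order k vanish at a ([flat_eq0]).  The point
    a is the value of the support map h at y ([support_map_eq]).

    Hence T f y can be computed on the Taylor polynomial of f at h(y), and
    expanding it in monomials of x gives
      Phi_j(y, S) = sum_b g_b(h(y)) T(m_b S_b)(y)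
    with finitely many polynomials g_b, monomials m_b and values S_b of S
    ([representingE]); y enters only through h and through functions that T has
    put in C^q(Y, F).

    The regularity of a coordinate h_i is obtained from the moments of T_y.  On
    an open set take the largest r for which some T_y((x_i - h_i(y))^r g) does not
    vanish.  For a functional phi on F the functions M_m(y) = phi(T(x_i^m g)(y))
    are C^q, and T_y((x_i - h_i(y))^(r+1) x_i^m g) = 0 is a linear system for the
    coefficients of (t - h_i(y))^(r+1) whose matrix is the Hankel matrix of the
    M_m.  It is invertible where phi(T_y((x_i - h_i(y))^r g)) != 0
    ([hankel_det_neq0]), and Cramer's rule expresses h_i through the M_m
    ([hankel_root], [coordinate_Cp_on]).

    On the set where h is C^q, the m-th derivative of Phi_j at y is a sum of
    operators M_b o P_b, where P_b S = T(m_b S_b) and M_b f is the m-th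
    derivative of (g_b o h) f at y.  The P_b take a ball into a translate of a
    weakly compact set and the M_b are continuous, whence (a)
    ([combination_weakly_compact]).  For an element xi of the bidual, weak
    compactness gives points w_b of C^q(Y, F) with P_b^** xi = w_b
    ([bidual_point]).  They do not depend on y, so the second adjoint sends xi to
    the m-th derivative at y of sum_b (g_b o h) w_b ([combination_biadjoint]),
    which is continuous in y for the norm: this is (b).

    Derivatives are handled as jets: the derivative of order k at a point is
    evaluated on lists of k vectors, so that all orders live in one function on
    lists and the product and chain rules become recursions on the list. *)

(** * Norming functionals and weakly bounded sets *)

Section hahn_banach.
Context {R : realType} {V : normedModType R}.
Implicit Types (G : set (V * R)) (x z : V).

(** Graphs, as relations in V * R, of linear functionals on subspaces that are
    bounded by the norm: unions of chains are then plain unions of sets. *)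
Definition dominated_graph G :=
  [/\ forall a p q, G p -> G q -> G (a *: p.1 + q.1, a * p.2 + q.2) &
      forall p, G p -> p.2 <= `|p.1|].

Lemma dominated_graph_bigcup (F : set (set (V * R))) :
  (forall G, F G -> dominated_graph G) -> total_on F subset ->
  dominated_graph (\bigcup_(G in F) G).
Proof.
move=> Fd tF; split=> [a p q [G FG Gp] [G' FG' Gq]|p [G FG /(proj2 (Fd _ FG))]//].
have [GG'|G'G] := tF _ _ FG FG'.
  by exists G' => //; apply: (proj1 (Fd _ FG')) => //; exact: GG'.
by exists G => //; apply: (proj1 (Fd _ FG)) => //; exact: G'G.
Qed.

(** The value c at x0 has to lie between the lower bounds [p.2 - |p.1 - x0|] and
    the upper bounds [|q.1 + x0| - q.2]; the triangle inequality separates them. *)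
Lemma dominated_graph_extend G x0 : G !=set0 -> dominated_graph G -> exists c,
  dominated_graph [set p | exists t q, G q /\ p = (q.1 + t *: x0, q.2 + t * c)].
Proof.
move=> [q0 Gq0] [Glin Gdom].
pose A : set R := [set p.2 - `|p.1 - x0| | p in G].
have key p q : G p -> G q -> p.2 - `|p.1 - x0| <= `|q.1 + x0| - q.2.
  move=> Gp Gq; have := Gdom _ (Glin 1 _ _ Gp Gq).
  rewrite scale1r mul1r /= => h.
  have := ler_normD (p.1 - x0) (q.1 + x0).
  by rewrite addrACA addNr addr0; lra.
have supA : has_sup A.
  split; first by exists (q0.2 - `|q0.1 - x0|), q0.
  by exists (`|q0.1 + x0| - q0.2) => _ [p Gp <-]; exact: key.
exists (sup A); set c := sup A.
have c1 p : G p -> p.2 - `|p.1 - x0| <= c.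
  by move=> Gp; apply: sup_upper_bound => //; exists p.
have c2 q : G q -> c <= `|q.1 + x0| - q.2.
  by move=> Gq; apply: ge_sup; [exact: supA.1|move=> _ [p Gp <-]; exact: key].
have G0 : G (0, 0).
  have := Glin (-1) _ _ Gq0 Gq0.
  by rewrite scaleN1r mulN1r !addNr.
have GZ a p : G p -> G (a *: p.1, a * p.2).
  by move=> Gp; have := Glin a _ _ Gp G0; rewrite /= !addr0.
split.
  move=> a _ _ [t [q [Gq ->]]] [s [p [Gp ->]]] /=.
  exists (a * t + s), (a *: q.1 + p.1, a * q.2 + p.2); split; first exact: Glin.
  by congr pair => /=; [rewrite scalerDr scalerDl scalerA addrACA|ring].
move=> _ [t [q [Gq ->]]] /=.
have [t0|t0|->] := ltgtP t 0; last by rewrite scale0r mul0r !addr0; exact: Gdom.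
- have := c1 _ (GZ (- t)^-1 _ Gq); rewrite /= => h.
  have nt : 0 < - t by rewrite oppr_gt0.
  have -> : q.1 + t *: x0 = (- t) *: ((- t)^-1 *: q.1 - x0).
    by rewrite scalerBr scalerA divff ?gt_eqF// scale1r scaleNr opprK.
  rewrite normrZ gtr0_norm//.
  have : (- t) * ((- t)^-1 * q.2 - `|(- t)^-1 *: q.1 - x0|) <= (- t) * c.
    by rewrite ler_pM2l.
  by rewrite mulrBr mulrA divff ?gt_eqF// mul1r; lra.
- have := c2 _ (GZ t^-1 _ Gq); rewrite /= => h.
  have -> : q.1 + t *: x0 = t *: (t^-1 *: q.1 + x0).
    by rewrite scalerDr scalerA divff ?gt_eqF// scale1r.
  rewrite normrZ gtr0_norm//.
  have : t * c <= t * (`|t^-1 *: q.1 + x0| - t^-1 * q.2) by rewrite ler_pM2l.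
  by rewrite mulrBr mulrA divff ?gt_eqF// mul1r; lra.
Qed.

(** Hahn-Banach theorem for the functional a z |-> a |z|, by Zorn's lemma on graphs. *)
Lemma norming_functional z : exists phi : dual V,
  (forall x, `|phi x| <= `|x|) /\ phi z = `|z|.
Proof.
pose B : set (V * R) := [set p | exists a : R, p = (a *: z, a * `|z|)].
have Bd : dominated_graph B.
  split=> [a _ _ [b ->] [c ->]|_ [a ->]] /=.
    by exists (a * b + c); rewrite scalerDl scalerA mulrDl mulrA.
  by rewrite normrZ ler_wpM2r// ler_norm.
have Bz : B (z, `|z|) by exists 1; rewrite scale1r mul1r.
pose P G := G = set0 \/ (dominated_graph G /\ B `<=` G).
(* The empty graph is admitted because the union of the empty chain is empty. *)
have [|G [PG Gmax]] := @Zorn_bigcup _ P.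
  move=> F FP tF; have [F0|/existsNP[G0]] :=
    pselect (forall G, F G -> G = set0).
    by left; rewrite bigcup0.
  move=> /not_implyP[FG0 G0n0].
  have [//|[_ BG0]] := FP _ FG0.
  have -> : \bigcup_(G in F) G = \bigcup_(G in F `\ set0) G.
    apply/seteqP; split => p [G FG Gp]; exists G => //; last by case: FG.
    by split=> // Ge; rewrite Ge in Gp.
  right; split; last by move=> p /BG0 ?; exists G0.
  apply: dominated_graph_bigcup.
    by move=> G [FG Gn0]; have [//|[]] := FP _ FG.
  by move=> G G' [FG _] [FG' _]; exact: tF.
have [Gd BG] : dominated_graph G /\ B `<=` G.
  case: PG => [G0|//]; exfalso; apply: (Gmax B); last by right; split.
  by rewrite G0; split=> // /(_ _ Bz).
have [Glin Gdom] := Gd.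
have G0 : G (0, 0).
  by have := Glin (-1) _ _ (BG _ Bz) (BG _ Bz); rewrite scaleN1r mulN1r !addNr.
have dom x : exists r, G (x, r).
  have [c Hd] := dominated_graph_extend x (ex_intro _ _ G0) Gd.
  set G' := mkset _ in Hd.
  have GG' : G `<=` G'.
    by move=> [u r] Gu; exists 0, (u, r); rewrite scale0r mul0r !addr0.
  have G'x : G' (x, c) by exists 1, (0, 0); rewrite /= scale1r mul1r !add0r.
  have [G'G|nG'G] := pselect (G' `<=` G); first by exists c; exact: G'G.
  exfalso; apply: (Gmax G'); first by split.
  by right; split => //; exact: subset_trans GG'.
have uniq x r s : G (x, r) -> G (x, s) -> r <= s.
  move=> Gr Gs; have := Gdom _ (Glin (-1) _ _ Gs Gr).
  by rewrite /= scaleN1r addNr normr0; lra.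
pose phi (x : V) : R := sval (cid (dom x)).
have phiG x : G (x, phi x) by exact: svalP (cid (dom x)).
have phiE x r : G (x, r) -> phi x = r.
  by move=> Gx; apply/eqP; rewrite eq_le !(@uniq x).
have phi_lin (a : R) u v : phi (a *: u + v) = a * phi u + phi v.
  by apply: phiE; exact: (Glin a _ _ (phiG u) (phiG v)).
have phi_bd x : `|phi x| <= `|x|.
  rewrite ler_norml (Gdom _ (phiG x)) andbT.
  have := Gdom _ (Glin (-1) _ _ (phiG x) G0).
  by rewrite /= scaleN1r !addr0 normrN; lra.
have sub : (phi : V -> R^o) \in bop_pred V R^o.
  by apply/asboolP; split=> //; exists 1 => x; rewrite mul1r.
by exists (Bop sub); split => //=; exact/phiE/BG.
Qed.

End hahn_banach.

Section weakly_bounded.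
Context {R : realType}.

Lemma bounded_linear_bop (V W : normedModType R) (f : V -> W) :
  bounded_linear f -> exists A : bop V W, A = f :> (V -> W).
Proof. by move=> /asboolP bf; exists (Bop (bf : f \in bop_pred V W)). Qed.

Lemma bop_linearB (V W : normedModType R) (A B : bop V W) x :
  (A - B) x = A x - B x.
Proof.
have -> : A - B = -1 *: B + A by rewrite scaleN1r addrC.
by rewrite -[LHS]/(-1 *: B x + A x) scaleN1r addrC.
Qed.

Lemma le_eps (a b c : R) : 0 <= c ->
  (forall e, 0 < e -> a <= b + e * c) -> a <= b.
Proof.
move=> c0 H; apply/ler_addgt0Pr => e e0.
apply: le_trans (H (e / (1 + c)) _) _; first by rewrite divr_gt0// ltr_pwDl.
by rewrite lerD2l mulrAC ler_pdivrMr ?ltr_pwDl// ler_pM2l// lerDr.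
Qed.

Lemma dual_complete (V : normedModType R) (F : set_system (dual V)) :
  ProperFilter F -> cauchy F -> cvg F.
Proof.
move=> FF /cauchyP Fc.
have evB (phi psi : dual V) x : `|phi x - psi x| <= `|phi - psi| * `|x|.
  by rewrite -(bop_linearB phi psi x) bop_norm_le.
have lP x : exists l : R, forall e, 0 < e -> forall phi : dual V,
    F (ball phi e) -> `|l - phi x| <= e * `|x|.
  have /R_complete/cvg_ex[l xl] : cauchy ((fun phi : dual V => phi x : R) @ F).
    apply/cauchy_exP => e e0.
    have [phi Fphi] := Fc (e / (1 + `|x|)) (divr_gt0 e0 (ltr_pwDl ltr01 (normr_ge0 x))).
    exists (phi x); suff : F [set psi : dual V | `|phi x - psi x| < e] by [].
    apply: filterS Fphi => psi; rewrite -ball_normE /= => h.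
    apply: le_lt_trans (evB _ _ _) _.
    have [->|x0] := eqVneq `|x| 0; first by rewrite mulr0.
    have xx : 0 < `|x| by rewrite lt_def x0 /=.
    apply: lt_trans (_ : _ < e / (1 + `|x|) * `|x|) _; first by rewrite ltr_pM2r.
    by rewrite mulrAC ltr_pdivrMr ?ltr_pwDl// ltr_pM2l// ltrDr.
  exists l => e e0 phi Fphi; apply/ler_addgt0Pr => d d0.
  have Fl : F [set psi : dual V | `|l - psi x| < d] by move/cvgrPdist_lt : xl => /(_ _ d0).
  have [psi [h1 h2]] := @filter_ex _ F FF _ (filterI Fphi Fl).
  rewrite /= in h2; move: h1; rewrite -ball_normE /= => h1.
  rewrite (_ : l - phi x = (l - psi x) - (phi x - psi x)); last by rewrite opprB addrA subrK.
  rewrite (le_trans (ler_normB _ _))// addrC lerD//; last exact: ltW.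
  by rewrite (le_trans (evB _ _ _))// ler_wpM2r// ltW.
have [l lE] := choice lP.
have ll : bounded_linear (l : V -> R^o).
  split.
    move=> a u v; apply/eqP; rewrite -subr_eq0 -normr_le0.
    apply: (@le_eps _ _ (`|a *: u + v| + `|a| * `|u| + `|v|)).
      by rewrite !addr_ge0// mulr_ge0.
    move=> e e0; rewrite add0r; have [phi Fphi] := Fc _ e0.
    have [lphi _] := bopP phi.
    rewrite (_ : _ - _ = (l (a *: u + v) - phi (a *: u + v))
       - a * (l u - phi u) - (l v - phi v)); last first.
      by rewrite lphi /GRing.scale /=; ring.
    rewrite (le_trans (ler_normB _ _))// !(mulrDr e) lerD//; last exact: lE.
    rewrite (le_trans (ler_normB _ _))// lerD//; first exact: lE.
    by rewrite normrM mulrCA ler_wpM2l// lE.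
  have [phi Fphi] := Fc _ ltr01.
  exists (1 + bop_norm phi) => x.
  rewrite -[l x](subrK (phi x)) mulrDl (le_trans (ler_normD _ _))// lerD//; first exact: lE.
  exact: bop_norm_le.
have [L LE] := bounded_linear_bop ll.
apply/cvg_ex; exists (L : dual V); apply/cvgrPdist_le => e e0.
have e20 : 0 < e / 2 by rewrite divr_gt0.
have [phi Fphi] := Fc _ e20.
near=> psi.
rewrite (_ : _ - psi = ((L : dual V) - phi) - (psi - phi)); last first.
  by rewrite opprB addrA subrK.
rewrite [leRHS](splitr e) (le_trans (ler_normB _ _))// lerD//.
  apply: sup_norm_le; first exact: unit_ball_neq0.
  move=> x x1; rewrite -[X in `|X|]/(L x - phi x) LE.
  by rewrite (le_trans (lE x _ e20 _ Fphi))// ler_piMr// ltW.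
rewrite distrC ltW//; near: psi.
by apply: filterS Fphi => psi; rewrite -ball_normE.
Unshelve. all: by end_near. Qed.

HB.instance Definition _ (V : normedModType R) :=
  Uniform_isComplete.Build (dual V) (@dual_complete V).

(** Uniform boundedness principle for the evaluations at the points of A, which
    are functionals on the complete space [dual W]; norming functionals bring the
    bound back to A. *)
Lemma weakly_bounded (W : normedModType R) (A : set W) :
  (forall phi : dual W, exists M, forall x, A x -> `|phi x| <= M) ->
  exists M, forall x, A x -> `|x| <= M.
Proof.
move=> Abd.
pose F : set (dual W -> R^o) := [set f | exists2 x, A x & f = fun phi : dual W => phi x].
have [||M MP] := @Banach_Steinhauss R (dual W) R^o F _ _ 1.
- move=> _ [x Ax ->]; split.
    move=> r; exists (`|r| * `|x|) => phi phir.
    rewrite (le_trans (bop_norm_le _ _))// ler_wpM2r//.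
    exact: le_trans phir (ler_norm _).
  by move=> a phi psi.
- by move=> phi; have [M MP] := Abd phi; exists M => _ [x Ax ->]; exact: MP.
exists M => x Ax; have [phi [phi1 phix]] := norming_functional x.
rewrite -phix (le_trans (ler_norm _))//.
apply: (MP (fun phi => phi x)); first by exists x.
apply: sup_norm_le; first exact: unit_ball_neq0.
by move=> z z1; rewrite (le_trans (phi1 z)).
Qed.

End weakly_bounded.

(** * The algebra of the Leibniz rule *)

Section leibniz_algebra.
Context {R : realType} {V : normedModType R}.

Definition pnorm (s : seq V) : R := \prod_(v <- s) `|v|.

Lemma pnorm_nil : pnorm [::] = 1.
Proof. by rewrite /pnorm big_nil. Qed.

Lemma pnorm_cons v s : pnorm (v :: s) = `|v| * pnorm s.
Proof. by rewrite /pnorm big_cons. Qed.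

Lemma pnorm_ge0 s : 0 <= pnorm s.
Proof. by apply: prodr_ge0 => v _; exact: normr_ge0. Qed.

Section one_space.
Context {W : normedModType R}.
Implicit Types (A : seq V -> R) (B : seq V -> W).

Definition perm_invariant n B :=
  forall s t, (size s <= n)%N -> perm_eq s t -> B s = B t.

Definition head_linear B := forall a u v s,
  B (a *: u + v :: s) = a *: B (u :: s) + B (v :: s).

(** The inequality on sizes is strict, so that fixing the first vector of the list
    lowers the order k by exactly one. *)
Definition bdd k M B := forall s, (size s < k)%N -> `|B s| <= M * pnorm s.

(** The derivatives of a product from those of its factors: each vector of the
    list differentiates one of the two factors. *)
Fixpoint leib A B (s : seq V) : W :=
  if s is v :: s' then
    leib (fun t => A (v :: t)) B s' + leib A (fun t => B (v :: t)) s'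
  else A [::] *: B [::].

Lemma bdd_cons k M B v : bdd k.+1 M B -> bdd k (M * `|v|) (fun t => B (v :: t)).
Proof. by move=> bB s sk; rewrite -mulrA -pnorm_cons; exact: bB. Qed.

Lemma bdd_le k j M N B : (j <= k)%N -> M <= N -> bdd k M B -> bdd j N B.
Proof.
move=> jk MN bB s sj; apply: le_trans (bB s (leq_trans sj jk)) _.
by rewrite ler_wpM2r// pnorm_ge0.
Qed.

Lemma bddD k M N B B' : bdd k M B -> bdd k N B' ->
  bdd k (M + N) (fun s => B s + B' s).
Proof.
move=> bB bB' s sk; rewrite (le_trans (ler_normD _ _))// mulrDl.
by rewrite lerD ?bB ?bB'.
Qed.

Lemma bdd_ext k M B B' : B =1 B' -> bdd k M B -> bdd k M B'.
Proof. by move=> BB' bB s; rewrite -BB'; exact: bB. Qed.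

Lemma perm_invariant_cons n B v : perm_invariant n.+1 B -> perm_invariant n (fun t => B (v :: t)).
Proof. by move=> sB s t sn st; apply: sB => //; rewrite perm_cons. Qed.

Lemma perm_invariantW n m B : (m <= n)%N -> perm_invariant n B -> perm_invariant m B.
Proof. by move=> mn sB s t sm; apply: sB; exact: leq_trans mn. Qed.

(** Permutations are generated by those fixing the first entry and by the
    exchange of the first two entries. *)
Lemma perm_invariant_crit n B :
  (forall v, perm_invariant n (fun t => B (v :: t))) ->
  (forall v w s, (size s).+1 = n -> B (v :: w :: s) = B (w :: v :: s)) ->
  forall s t, size s = n.+1 -> perm_eq s t -> B s = B t.
Proof.
move=> H1 H2 [//|v s] t [sn] st.
have vt : v \in t by rewrite -(perm_mem st) mem_head.
case: t vt st => // w t; rewrite in_cons; have [<- _|vw /= vt st] := eqVneq v w.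
  by rewrite perm_cons => st; apply: H1 => //; rewrite sn.
have tv := perm_to_rem vt.
have st' : size t = n by have /perm_size/= := st; rewrite sn => -[].
have srem : (size (rem v t)).+1 = n by rewrite -st' (perm_size tv).
rewrite (H1 w t (v :: rem v t)) ?st'// -H2//.
apply: H1; first by rewrite sn.
rewrite -(perm_cons v) (perm_trans st)//.
apply: (@perm_trans _ (w :: v :: rem v t)); first by rewrite perm_cons.
exact/permPl/(perm_catCA [:: w] [:: v]).
Qed.

Lemma leib_ext A A' B B' s :
  (forall t, (size t <= size s)%N -> A t = A' t) ->
  (forall t, (size t <= size s)%N -> B t = B' t) -> leib A B s = leib A' B' s.
Proof.
elim: s A A' B B' => [|v s IH] A A' B B' AA' BB' /=; first by rewrite AA'// BB'.
by congr (_ + _); apply: IH => t ts; rewrite ?AA' ?BB'//; exact: ltnW.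
Qed.

Lemma leibDl A A' B s :
  leib (fun t => A t + A' t) B s = leib A B s + leib A' B s.
Proof.
elim: s A A' B => [|v s IH] A A' B /=; first by rewrite scalerDl.
by rewrite !IH addrACA.
Qed.

Lemma leibDr A B B' s :
  leib A (fun t => B t + B' t) s = leib A B s + leib A B' s.
Proof.
elim: s A B B' => [|v s IH] A B B' /=; first by rewrite scalerDr.
by rewrite !IH addrACA.
Qed.

Lemma leibZl a A B s : leib (fun t => a * A t) B s = a *: leib A B s.
Proof.
elim: s A B => [|v s IH] A B /=; first by rewrite scalerA.
by rewrite !IH scalerDr.
Qed.

Lemma leibZr a A B s : leib A (fun t => a *: B t) s = a *: leib A B s.
Proof.
elim: s A B => [|v s IH] A B /=; first by rewrite !scalerA mulrC.
by rewrite !IH scalerDr.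
Qed.

Lemma leibBl A A' B s :
  leib (fun t => A t - A' t) B s = leib A B s - leib A' B s.
Proof.
rewrite leibDl; congr (_ + _); rewrite -scaleN1r -leibZl.
by apply: leib_ext => // t _; rewrite mulN1r.
Qed.

Lemma leibBr A B B' s :
  leib A (fun t => B t - B' t) s = leib A B s - leib A B' s.
Proof.
rewrite leibDr; congr (_ + _); rewrite -scaleN1r -leibZr.
by apply: leib_ext => // t _; rewrite scaleN1r.
Qed.

(** The weight r ^ order is multiplicative over the 2 ^ (size s) terms of the
    expansion; with r = 1/e this is the bound for cutoffs of radius e. *)
Lemma leib_norm_graded k a b r A B s : 0 <= a -> 0 <= b -> 0 <= r ->
  (forall t, (size t < k)%N -> `|A t| <= a * r ^+ size t * pnorm t) ->
  (forall t, (size t < k)%N -> `|B t| <= b * r ^+ size t * pnorm t) ->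
  (size s < k)%N -> `|leib A B s| <= (2 * r) ^+ size s * (a * b) * pnorm s.
Proof.
move=> + + r0; elim: s k a b A B => [|v s IH] k a b A B a0 b0 bA bB.
  move=> k0; rewrite /= pnorm_nil expr0 mul1r mulr1 normrZ.
  have := bA [::] k0; have := bB [::] k0; rewrite pnorm_nil expr0 !mulr1 => hb ha.
  by rewrite ler_pM.
case: k bA bB => // k bA bB /= sk; rewrite ltnS in sk.
rewrite (le_trans (ler_normD _ _))//.
have -> : (2 * r) ^+ (size s).+1 * (a * b) * pnorm (v :: s) =
  (2 * r) ^+ size s * (a * r * `|v| * b) * pnorm s +
  (2 * r) ^+ size s * (a * (b * r * `|v|)) * pnorm s.
  by rewrite pnorm_cons exprS; ring.
have cons_bound (W' : normedModType R) (D : seq V -> W') d :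
    (forall t, (size t < k.+1)%N -> `|D t| <= d * r ^+ size t * pnorm t) ->
    forall t, (size t < k)%N -> `|D (v :: t)| <= d * r * `|v| * r ^+ size t * pnorm t.
  move=> bD t tk; have -> : d * r * `|v| * r ^+ size t * pnorm t =
      d * r ^+ size (v :: t) * pnorm (v :: t) by rewrite pnorm_cons /= exprS; ring.
  exact: bD.
rewrite lerD//; apply: (IH k) => //; rewrite ?mulr_ge0//.
- exact: (cons_bound R^o).
- by move=> t tk; apply: bB; rewrite ltnW.
- by move=> t tk; apply: bA; rewrite ltnW.
- exact: cons_bound.
Qed.

End one_space.

Context {W : normedModType R}.
Implicit Types (A : seq V -> R^o) (B : seq V -> W).

Lemma leib_bdd k a b A B : 0 <= a -> 0 <= b -> bdd k a A -> bdd k b B ->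
  bdd k (2 ^+ k * (a * b)) (leib A B).
Proof.
move=> a0 b0 bA bB s sk.
apply: le_trans (@leib_norm_graded W k a b 1 A B s a0 b0 ler01 _ _ sk) _.
- by move=> t tk; rewrite expr1n mulr1; exact: bA.
- by move=> t tk; rewrite expr1n mulr1; exact: bB.
rewrite mulr1.
rewrite ler_wpM2r ?pnorm_ge0// ler_wpM2r ?mulr_ge0//.
by rewrite ler_weXn2l ?ler1n// ltnW.
Qed.

(** First-order remainder of a product: the three error terms of d(AB) = dA B + A dB
    come from dA, from dB and from the variation of B multiplied by dA. *)
Lemma leib_diff k A A' Au B B' Bu a a1 b' e1 e2 e3 :
  0 <= a -> 0 <= a1 -> 0 <= b' -> 0 <= e1 -> 0 <= e2 -> 0 <= e3 ->
  bdd k e1 (fun s => A' s - A s - Au s) -> bdd k b' B' -> bdd k a A ->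
  bdd k e2 (fun s => B' s - B s - Bu s) -> bdd k a1 Au ->
  bdd k e3 (fun s => B' s - B s) ->
  bdd k (2 ^+ k * (e1 * b' + a * e2 + a1 * e3))
    (fun s => leib A' B' s - leib A B s - (leib Au B s + leib A Bu s)).
Proof.
move=> a0 a10 b0 e10 e20 e30 h1 h2 h3 h4 h5 h6.
apply: (@bdd_ext _ _ _ (fun s =>
    leib (fun s => A' s - A s - Au s) B' s + leib A (fun s => B' s - B s - Bu s) s
    + leib Au (fun s => B' s - B s) s)).
  move=> s; rewrite !(leibBl (fun t => A' t - A t)) !leibBl.
  rewrite !(leibBr _ (fun t => B' t - B t)) !leibBr.
  move: (leib A' B' s) (leib A B' s) (leib Au B' s) (leib A B s) (leib A Bu s) (leib Au B s).
  move=> x1 x2 x3 x4 x5 x6; rewrite -!addrA; congr (_ + _).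
  rewrite (addrCA (- x3)) addKr (addrCA (- x5)) (addrCA (- x4)) addKr.
  by rewrite opprD (addrC (- x6)).
rewrite !mulrDr.
by apply: bddD; [apply: bddD|]; exact: leib_bdd.
Qed.

Lemma leib_cont k A A' B B' a b' e1 e2 :
  0 <= a -> 0 <= b' -> 0 <= e1 -> 0 <= e2 ->
  bdd k e1 (fun s => A' s - A s) -> bdd k b' B' -> bdd k a A ->
  bdd k e2 (fun s => B' s - B s) ->
  bdd k (2 ^+ k * (e1 * b' + a * e2)) (fun s => leib A' B' s - leib A B s).
Proof.
move=> a0 b0 e10 e20 h1 h2 h3 h4.
apply: (@bdd_ext _ _ _ (fun s =>
    leib (fun s => A' s - A s) B' s + leib A (fun s => B' s - B s) s)).
  by move=> s; rewrite leibBl leibBr addrA subrK.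
by rewrite mulrDr; apply: bddD; exact: leib_bdd.
Qed.

Lemma leib_perm_invariant n A B : perm_invariant n A -> perm_invariant n B -> perm_invariant n (leib A B).
Proof.
elim: n A B => [|n IH] A B sA sB s t sn st.
  by case: s sn st => // _ /perm_size/esym/size0nil ->.
move: sn; rewrite leq_eqVlt => /predU1P[sn|]; last first.
  by rewrite ltnS => sn; apply: (IH A B) => //; exact: (perm_invariantW (leqnSn n)).
apply: (@perm_invariant_crit W n (leib A B)) => //= => [v r q rn rq|v w r rn].
  by congr (_ + _); apply: IH => //;
    first [exact: perm_invariant_cons|exact: (perm_invariantW (leqnSn n))].
have sz (q : seq V) : (size q <= size r)%N -> ((size q).+2 <= n.+1)%N.
  by rewrite -rn => h; rewrite !ltnS.
rewrite [RHS]addrACA.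
congr (_ + _ + (_ + _)); apply: leib_ext => // q /sz qs.
  by apply: sA => //; exact/permPl/(perm_catCA [:: v] [:: w]).
by apply: sB => //; exact/permPl/(perm_catCA [:: v] [:: w]).
Qed.

Lemma leib_head_linear A B : head_linear A -> head_linear B -> head_linear (leib A B).
Proof.
move=> lA lB a u v s /=; rewrite scalerDr addrACA.
rewrite (@leib_ext _ _ (fun t => a * A (u :: t) + A (v :: t)) B B)//.
rewrite (@leib_ext _ A A (fun t => B (_ :: t)) (fun t => a *: B (u :: t) + B (v :: t)))//.
by rewrite leibDl leibDr leibZl leibZr.
Qed.

Lemma leibC (A A' : seq V -> R^o) s : leib A A' s = leib A' A s.
Proof.
elim: s A A' => [|v s IH] A A' /=; first exact: mulrC.
by rewrite addrC; congr (_ + _); exact: IH.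
Qed.

Lemma leibA (A A' : seq V -> R^o) B s :
  leib (leib A A') B s = leib A (leib A' B) s.
Proof.
elim: s A A' B => [|v s IH] A A' B /=; first by rewrite -scalerA.
rewrite (leibDl (leib (fun t => A (v :: t)) A')) (leibDr A) !IH.
by rewrite addrA.
Qed.

End leibniz_algebra.

(** * Jets of products and compositions *)

Section jets.
Context {R : realType} {V : normedModType R}.

Definition symjet (W : normedModType R) (B : seq V -> W) :=
  [/\ forall n, perm_invariant n B, head_linear B & forall k, exists M, bdd k M B].

(** Besides the algebraic conditions, J (x + u) s - J x s has derivative
    u |-> J x (u :: s), with an error that is uniform on lists of bounded size. *)
Definition isjet (W : normedModType R) m (X : set V) (J : V -> seq V -> W) :=
  forall x, X x -> [/\ symjet (J x),
    forall e, 0 < e -> \forall u \near (0 : V),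
      bdd m (e * `|u|) (fun s => J (x + u) s - J x s - J x (u :: s)) &
    forall e, 0 < e -> \forall u \near (0 : V),
      bdd m.+1 e (fun s => J (x + u) s - J x s)].

Lemma symjet_bdd (W : normedModType R) (B : seq V -> W) k :
  symjet B -> exists2 M, 0 <= M & bdd k M B.
Proof.
case=> _ _ /(_ k)[M MB]; exists `|M| => //.
by apply: bdd_le MB => //; exact: ler_norm.
Qed.

Lemma isjet_bdd_near (W : normedModType R) m X (J : V -> seq V -> W) x M :
  isjet m X J -> X x -> bdd m.+1 M (J x) ->
  \forall u \near (0 : V), bdd m.+1 (M + 1) (J (x + u)).
Proof.
move=> jJ Xx bM; have [_ _ /(_ _ ltr01)] := jJ _ Xx.
apply: filterS => u h; apply: (@bdd_ext _ _ _ _ _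
  (fun s => J x s + (J (x + u) s - J x s))); last exact: bddD.
by move=> s; rewrite addrC subrK.
Qed.

Lemma isjetW (W : normedModType R) m m' X (J : V -> seq V -> W) :
  (m <= m')%N -> isjet m' X J -> isjet m X J.
Proof.
move=> mm jJ x Xx; have [sJ dJ cJ] := jJ x Xx; split => // e e0.
  by apply: filterS (dJ _ e0) => u; exact: bdd_le.
by apply: filterS (cJ _ e0) => u; exact: bdd_le.
Qed.

Context {W : normedModType R}.

Lemma symjet_leib (A : seq V -> R^o) (B : seq V -> W) :
  symjet A -> symjet B -> symjet (leib A B).
Proof.
move=> sA sB; have [dA lA bA] := sA; have [dB lB bB] := sB; split.
- by move=> n; exact: leib_perm_invariant.
- exact: leib_head_linear.
- move=> k; have [a a0 ba] := symjet_bdd k sA; have [b b0 bb] := symjet_bdd k sB.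
  by exists (2 ^+ k * (a * b)); exact: leib_bdd.
Qed.

Lemma isjet_leib m X (A : V -> seq V -> R^o) (B : V -> seq V -> W) :
  isjet m X A -> isjet m X B -> isjet m X (fun x => leib (A x) (B x)).
Proof.
move=> jA jB x Xx; have [sA dA cA] := jA x Xx; have [sB dB cB] := jB x Xx.
have [a a0 ba] := symjet_bdd m.+1 sA; have [b b0 bb] := symjet_bdd m.+1 sB.
have b'0 : 0 <= b + 1 by rewrite addr_ge0.
pose C := 2 ^+ m.+1 * (b + 1 + a + a).
have C0 : 0 <= C by rewrite mulr_ge0// ?exprn_ge0// !addr_ge0.
split; first exact: symjet_leib.
- move=> e e0; have [d d0 dE] : exists2 d, 0 < d & d = e / (C + 1).
    by exists (e / (C + 1)) => //; rewrite divr_gt0// ltr_wpDl.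
  near=> u.
  have : bdd m (2 ^+ m * (d * `|u| * (b + 1) + a * (d * `|u|)
    + a * `|u| * d)) (fun s => leib (A (x + u)) (B (x + u)) s
    - leib (A x) (B x) s - leib (A x) (B x) (u :: s)).
    apply: leib_diff; rewrite ?mulr_ge0 ?(ltW d0)//.
    + by near: u; exact: dA.
    + by apply: (@bdd_le _ _ _ m.+1 _ (b + 1)) => //; near: u; exact: isjet_bdd_near jB Xx bb.
    + exact: bdd_le ba.
    + by near: u; exact: dB.
    + exact: bdd_cons.
    + by apply: (@bdd_le _ _ _ m.+1 _ d) => //; near: u; exact: cB.
  apply: bdd_le => //.
  have -> : 2 ^+ m * (d * `|u| * (b + 1) + a * (d * `|u|)
    + a * `|u| * d) = e * `|u| * (2 ^+ m * (b + 1 + a + a) / (C + 1)) by rewrite dE; ring.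
  rewrite ler_piMr ?mulr_ge0 ?(ltW e0)//.
  rewrite ler_pdivrMr ?ltr_wpDl// mul1r (le_trans (_ : _ <= C))// ?lerDl//.
  by rewrite ler_wpM2r ?addr_ge0// ler_weXn2l// ler1n.
- move=> e e0; have [d d0 dE] : exists2 d, 0 < d & d = e / (C + 1).
    by exists (e / (C + 1)) => //; rewrite divr_gt0// ltr_wpDl.
  near=> u.
  have : bdd m.+1 (2 ^+ m.+1 * (d * (b + 1) + a * d))
     (fun s => leib (A (x + u)) (B (x + u)) s - leib (A x) (B x) s).
    apply: leib_cont; rewrite ?(ltW d0)//.
    + by near: u; exact: cA.
    + by near: u; exact: isjet_bdd_near jB Xx bb.
    + by near: u; exact: cB.
  apply: bdd_le => //.
  have -> : 2 ^+ m.+1 * (d * (b + 1) + a * d) =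
    e * (2 ^+ m.+1 * (b + 1 + a) / (C + 1)) by rewrite dE; ring.
  rewrite ler_piMr ?(ltW e0)// ltW// ltr_pdivrMr ?ltr_wpDl// mul1r.
  rewrite (le_lt_trans (_ : _ <= C))// ?ltrDl// ler_wpM2l ?exprn_ge0//.
  by rewrite lerDl.
Unshelve. all: by end_near. Qed.

End jets.

Section chain_rule.
Context {R : realType} {V : normedModType R}.
Implicit Types (b : nat -> R) (A : seq V -> R^o).

Fixpoint chain_rec n b A (s : seq V) : R^o :=
  match n, s with
  | n'.+1, v :: s' =>
      leib (chain_rec n' (b \o succn) A) (fun t => A (v :: t) : R^o) s'
  | _, _ => b 0%N
  end.

(** The derivatives of phi o g in terms of [b k = phi^(k)(g(x))] and of the jet
    [A] of g at x; the recursion is D_v(phi o g) = (phi' o g) D_v g. *)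
Definition chain b A s := chain_rec (size s) b A s.

Lemma chain_rec_fuel n m b A s : (size s <= n)%N -> (size s <= m)%N ->
  chain_rec n b A s = chain_rec m b A s.
Proof.
elim: n m b s => [|n IH] [|m] b [|v s]//= sn sm.
by apply: leib_ext => // t ts; apply: IH; exact: leq_trans ts _.
Qed.

Lemma chain_cons b A v s :
  chain b A (v :: s) = leib (chain (b \o succn) A) (fun t => A (v :: t) : R^o) s.
Proof. by rewrite /chain /=; apply: leib_ext => // t ts; exact: chain_rec_fuel. Qed.

Lemma chain_perm_invariant n b A : (forall n, perm_invariant n A) -> perm_invariant n (chain b A).
Proof.
move=> sA; elim: n b => [|n IH] b s t sn st.
  by case: s sn st => // _ /perm_size/esym/size0nil ->.
move: sn; rewrite leq_eqVlt => /predU1P[sn|]; last first.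
  by rewrite ltnS => sn; apply: (IH b).
apply: (@perm_invariant_crit _ _ _ n (chain b A)) => //= [v r q rn rq|v w r rn].
  rewrite !chain_cons.
  by apply: (@leib_perm_invariant _ _ _ n) => //; apply: perm_invariant_cons.
have E z : (fun t => chain (b \o succn) A (z :: t)) =
    leib (chain (b \o succn \o succn) A) (fun t => A (z :: t) : R^o).
  by apply/funext => q; exact: chain_cons.
rewrite !chain_cons /= !E.
congr (_ + _); rewrite ?leibA; apply: leib_ext => // q _.
  exact: leibC.
by apply: sA (leqnn _) _; exact/permPl/(perm_catCA [:: v] [:: w]).
Qed.

(** Linearity in the new first vector is linearity in the second one of the
    original list, by symmetry. *)
Lemma symjet_cons (W : normedModType R) (B : seq V -> W) v :
  symjet B -> symjet (fun t => B (v :: t)).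
Proof.
move=> sB; have [dB lB bB] := sB; split.
- by move=> n; exact: perm_invariant_cons.
- move=> a u w s; have swp z : B (v :: z :: s) = B (z :: v :: s).
    by apply: dB (leqnn _) _; exact/permPl/(perm_catCA [:: v] [:: z]).
  by rewrite !swp lB.
- move=> k; have [M MB] := bB k.+1; exists (M * `|v|); exact: bdd_cons.
Qed.

Lemma symjet_chain b A : symjet A -> symjet (chain b A).
Proof.
move=> sA; have [dA lA bA] := sA; split.
- by move=> n; exact: chain_perm_invariant.
- move=> a u v s; rewrite !chain_cons.
  rewrite (@leib_ext _ _ _ (chain (b \o succn) A) (chain (b \o succn) A) _
    (fun t => a *: (A (u :: t) : R^o) + A (v :: t)))//.
  by rewrite leibDr leibZr.
- move=> k; suff [M M0 bM] : exists2 M, 0 <= M & bdd k M (chain b A) by exists M.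
  elim: k b => [|k IH] b; first by exists 0.
  have [a a0 ba] := symjet_bdd k.+1 sA.
  have [M M0 bM] := IH (b \o succn).
  exists (`|b 0%N| + 2 ^+ k * (M * a)).
    by rewrite addr_ge0// !mulr_ge0// exprn_ge0.
  case=> [|v s] sk; first by rewrite /chain /= pnorm_nil mulr1 lerDl !mulr_ge0// exprn_ge0.
  rewrite chain_cons pnorm_cons.
  apply: le_trans (leib_bdd M0 _ bM (bdd_cons v ba) _) _ => //.
    by rewrite mulr_ge0.
  rewrite mulrDl -[leLHS]add0r lerD ?mulr_ge0 ?pnorm_ge0//.
  by rewrite le_eqVlt; apply/orP; left; apply/eqP; ring.
Qed.

(** A whole sequence of derivatives is carried along, so that the chain rule can be
    iterated on f 0, then on f 1, and so on. *)
Definition smooth_at (f : nat -> R -> R) t := forall k e, 0 < e ->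
  \forall h \near (0 : R), `|f k (t + h) - f k t - f k.+1 t * h| <= e * `|h|.

Lemma smooth_at_cont (f : nat -> R -> R) t k e : smooth_at f t -> 0 < e ->
  \forall h \near (0 : R), `|f k (t + h) - f k t| <= e.
Proof.
move=> sf e0.
have c0 : 0 < e / (1 + `|f k.+1 t|) by rewrite divr_gt0// ltr_pwDl.
have n0 : \forall h \near (0 : R), `|h| < e / (1 + `|f k.+1 t|) by exact: nbhs0_lt.
near=> h.
rewrite -[f k (t + h) - f k t](subrK (f k.+1 t * h)).
rewrite (le_trans (ler_normD _ _))// (@le_trans _ _ (1 * `|h| + `|f k.+1 t| * `|h|))//.
  by rewrite lerD ?normrM//; near: h; exact: sf.
rewrite -mulrDl mulrC -ler_pdivlMr ?ltr_pwDl// ltW//.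
Unshelve. all: by end_near. Qed.

Lemma smooth_at_comp_cont (f : nat -> R -> R) t (g : V -> R) k e :
  smooth_at f t ->
  (forall d, 0 < d -> \forall u \near (0 : V), `|g u - t| <= d) ->
  0 < e -> \forall u \near (0 : V), `|f k (g u) - f k t| <= e.
Proof.
move=> sf gt e0; have /nbhs_norm0P[d /= d0 hd] := smooth_at_cont k sf e0.
have d20 : 0 < d / 2 by rewrite divr_gt0.
apply: filterS (gt _ d20) => u h.
rewrite -(subrKC t (g u)); apply: hd => /=.
by rewrite (le_lt_trans h)// ltr_pdivrMr// mulr2n mulrDr mulr1 ltrDl.
Qed.

Lemma smooth_at_comp_diff (f : nat -> R -> R) t (g l : V -> R) a k e :
  smooth_at f t -> 0 <= a -> (forall u, `|l u| <= a * `|u|) ->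
  (forall d, 0 < d -> \forall u \near (0 : V), `|g u - t| <= d) ->
  (forall d, 0 < d -> \forall u \near (0 : V), `|g u - t - l u| <= d * `|u|) ->
  0 < e ->
  \forall u \near (0 : V), `|f k (g u) - f k t - f k.+1 t * l u| <= e * `|u|.
Proof.
move=> sf a0 la gt gl e0.
pose C := a + 1 + `|f k.+1 t| + 1.
have C0 : 0 < C by rewrite ltr_wpDl// !addr_ge0.
have [c c0 cE] : exists2 c, 0 < c & c = e / C by exists (e / C) => //; rewrite divr_gt0.
have /nbhs_norm0P[d /= d0 hd] := sf k _ c0.
have d20 : 0 < d / 2 by rewrite divr_gt0.
near=> u.
have h1 : `|g u - t| <= d / 2 by near: u; exact: gt.
have h2 : `|g u - t - l u| <= c * `|u| by near: u; exact: gl.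
have h3 : `|g u - t - l u| <= 1 * `|u| by near: u; exact: gl.
have h4 : `|g u - t| <= (a + 1) * `|u|.
  rewrite -[g u - t](subrK (l u)) addrC mulrDl (le_trans (ler_normD _ _))//.
  by rewrite lerD.
have h1' : `|g u - t| < d.
  by rewrite (le_lt_trans h1)// ltr_pdivrMr// mulr2n mulrDr mulr1 ltrDl.
have := hd (g u - t) h1'; rewrite /= subrKC => h5.
have -> : f k (g u) - f k t - f k.+1 t * l u =
  (f k (g u) - f k t - f k.+1 t * (g u - t)) + f k.+1 t * (g u - t - l u) by ring.
rewrite (le_trans (ler_normD _ _))// normrM.
rewrite (@le_trans _ _ (c * ((a + 1) * `|u|) + `|f k.+1 t| * (c * `|u|)))//.
  by rewrite lerD ?ler_wpM2l// (le_trans h5)// ler_wpM2l// ltW.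
have -> : c * ((a + 1) * `|u|) + `|f k.+1 t| * (c * `|u|) =
  e * `|u| * ((a + 1 + `|f k.+1 t|) / C) by rewrite cE; ring.
rewrite ler_piMr ?mulr_ge0 ?(ltW e0)//.
by rewrite ler_pdivrMr// mul1r lerDl.
Unshelve. all: by end_near. Qed.

(** Induction on the order: the first derivative of phi o g is the product of
    phi' o g, whose jet of lower order is given by the induction hypothesis, with
    the derivative of g. *)
Lemma isjet_chain m X (f : nat -> R -> R) (A : V -> seq V -> R^o) :
  (forall x, X x -> smooth_at f (A x [::])) -> isjet m X A ->
  isjet m X (fun x => chain (fun k => f k (A x [::])) (A x)).
Proof.
move=> sf jA.
have cA0 x : X x -> forall e, 0 < e ->
    \forall u \near (0 : V), `|A (x + u) [::] - A x [::]| <= e.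
  move=> Xx e e0; have [_ _ cA] := jA x Xx.
  by apply: filterS (cA _ e0) => u /(_ [::] isT); rewrite pnorm_nil mulr1.
elim: m f jA sf => [|m IH] f jA sf x Xx; have [sA dA cA] := jA x Xx.
  split; first exact: symjet_chain.
    by move=> e e0; near=> u => s.
  move=> e e0.
  apply: filterS (@smooth_at_comp_cont f _ _ 0%N e (sf x Xx) (cA0 x Xx) e0) => u h [|//] _.
  by rewrite /chain /= pnorm_nil mulr1.
have sf' x' : X x' -> smooth_at (fun k => f k.+1) (A x' [::]).
  by move=> Xx' k e e0; exact: (sf x' Xx' k.+1 e e0).
have jA' : isjet m X A := isjetW (leqnSn m) jA.
have [sC dC cC] := IH _ jA' sf' x Xx.
set C := fun x => chain (fun k => f k.+1 (A x [::])) (A x) in sC dC cC.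
have [c c0 bc] := symjet_bdd m.+1 sC; have [a a0 ba] := symjet_bdd m.+2 sA.
pose K := 2 ^+ m.+1 * (a + 1 + c + c).
have K0 : 0 <= K by rewrite mulr_ge0// ?exprn_ge0// !addr_ge0.
have K10 : 0 < K + 1 by rewrite ltr_wpDl.
split; first exact: symjet_chain.
- move=> e e0; have [d d0 dE] : exists2 d, 0 < d & d = e / (K + 1).
    by exists (e / (K + 1)) => //; rewrite divr_gt0.
  near=> u => -[_|v s]; last rewrite ltnS => sm.
    rewrite pnorm_nil mulr1 chain_cons /=.
    near: u; apply: (@smooth_at_comp_diff f _ _ (fun u => A x [:: u]) a 0%N e (sf x Xx) a0).
    + move=> u; have := ba [:: u] isT.
      by rewrite pnorm_cons pnorm_nil mulr1.
    + exact: cA0.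
    + move=> r r0; apply: filterS (dA _ r0) => u /(_ [::] isT).
      by rewrite pnorm_nil mulr1.
    + by [].
  have -> : chain (fun k => f k (A x [::])) (A x) (u :: v :: s) =
      leib (fun t => C x (u :: t)) (fun t => A x (v :: t) : R^o) s
      + leib (C x) (fun t => A x (u :: v :: t) : R^o) s.
    have [sD _ _] := symjet_chain (fun k => f k (A x [::])) sA.
    rewrite (sD _ _ (v :: u :: s) (leqnn _)); last first.
      exact/permPl/(perm_catCA [:: u] [:: v]).
    rewrite chain_cons /=; congr (_ + _); apply: leib_ext => // t _.
    have [dsA _ _] := sA; apply: dsA (leqnn _) _.
    exact/permPl/(perm_catCA [:: v] [:: u]).
  rewrite !chain_cons pnorm_cons -/(C x) -/(C (x + u)).
  have : bdd m (2 ^+ m * (d * `|u| * ((a + 1) * `|v|) + c * (d * `|u| * `|v|)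
    + c * `|u| * (d * `|v|))) (fun s =>
    leib (C (x + u)) (fun t => A (x + u) (v :: t) : R^o) s
    - leib (C x) (fun t => A x (v :: t) : R^o) s
    - (leib (fun t => C x (u :: t)) (fun t => A x (v :: t) : R^o) s
      + leib (C x) (fun t => A x (u :: v :: t) : R^o) s)).
    apply: leib_diff; rewrite ?mulr_ge0 ?addr_ge0 ?(ltW d0)//.
    + by near: u; exact: dC.
    + apply: bdd_cons; apply: (@bdd_le _ _ _ m.+2 _ (a + 1)) => //.
      by near: u; exact: isjet_bdd_near jA Xx ba.
    + exact: bdd_le bc.
    + have : bdd m.+1 (d * `|u|) (fun s => A (x + u) s - A x s - A x (u :: s)).
        by near: u; exact: dA.
      by move=> /(@bdd_cons _ _ _ _ _ _ v).
    + exact: bdd_cons.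
    + have : bdd m.+1 d (fun s => A (x + u) s - A x s).
        by apply: (@bdd_le _ _ _ m.+2 _ d) => //; near: u; exact: cA.
      by move=> /(@bdd_cons _ _ _ _ _ _ v).
  move=> /(_ s sm) h; apply: (le_trans h).
  have -> : 2 ^+ m * (d * `|u| * ((a + 1) * `|v|) + c * (d * `|u| * `|v|)
    + c * `|u| * (d * `|v|)) * pnorm s =
    e * `|u| * (`|v| * pnorm s) * (2 ^+ m * (a + 1 + c + c) / (K + 1)).
    by rewrite dE; ring.
  rewrite ler_piMr ?mulr_ge0 ?(ltW e0) ?pnorm_ge0//.
  rewrite ler_pdivrMr// mul1r (@le_trans _ _ K)// ?lerDl//.
  by rewrite ler_wpM2r ?addr_ge0// ler_weXn2l// ler1n.
- move=> e e0; have [d d0 dE] : exists2 d, 0 < d & d = e / (K + 1).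
    by exists (e / (K + 1)) => //; rewrite divr_gt0.
  near=> u => -[_|v s]; last rewrite ltnS => sm.
    rewrite pnorm_nil mulr1 /chain /=; near: u.
    exact: (@smooth_at_comp_cont f _ _ 0%N e (sf x Xx) (cA0 x Xx)).
  rewrite !chain_cons pnorm_cons -/(C x) -/(C (x + u)).
  have : bdd m.+1 (2 ^+ m.+1 * (d * ((a + 1) * `|v|) + c * (d * `|v|)))
    (fun s => leib (C (x + u)) (fun t => A (x + u) (v :: t) : R^o) s
    - leib (C x) (fun t => A x (v :: t) : R^o) s).
    apply: leib_cont; rewrite ?mulr_ge0 ?addr_ge0 ?(ltW d0)//.
    + by near: u; exact: cC.
    + apply: bdd_cons; near: u; exact: isjet_bdd_near jA Xx ba.
    + have : bdd m.+2 d (fun s => A (x + u) s - A x s) by near: u; exact: cA.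
      by move=> /(@bdd_cons _ _ _ _ _ _ v).
  move=> /(_ s sm) h; apply: (le_trans h).
  have -> : 2 ^+ m.+1 * (d * ((a + 1) * `|v|) + c * (d * `|v|)) * pnorm s =
    e * (`|v| * pnorm s) * (2 ^+ m.+1 * (a + 1 + c) / (K + 1)).
    by rewrite dE; ring.
  rewrite ler_piMr ?mulr_ge0 ?(ltW e0) ?pnorm_ge0//.
  rewrite ler_pdivrMr// mul1r (@le_trans _ _ K)// ?lerDl//.
  by rewrite ler_wpM2l ?exprn_ge0// lerDl.
Unshelve. all: by end_near. Qed.

End chain_rule.

(** * Jets and Fréchet derivatives *)

Section symml_eval.
Context {R : realType} {V W : normedModType R}.

Lemma near0E (x : V) (P : set V) :
  (\forall z \near x, P z) = (\forall u \near (0 : V), P (x + u)).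
Proof.
rewrite (near_shift 0); congr (nbhs _ _); apply/funext => u /=.
by rewrite subr0 addrC.
Qed.

Lemma prod_nth_pnorm (s : seq V) : \prod_(i < size s) `|nth 0 s i| = pnorm s.
Proof. by rewrite /pnorm (big_nth 0) big_mkord. Qed.

Lemma pnorm_enum k (v : 'I_k -> V) :
  pnorm [seq v i | i <- enum 'I_k] = \prod_i `|v i|.
Proof. by rewrite /pnorm big_map big_enum. Qed.

Lemma map_enum_ordS T k (v : 'I_k.+1 -> T) :
  [seq v i | i <- enum 'I_k.+1] = v ord0 :: [seq v (lift ord0 i) | i <- enum 'I_k].
Proof. by rewrite enum_ordSl /= -map_comp. Qed.

Lemma map_nth_enum (s : seq V) : [seq nth 0 s (nat_of_ord i) | i <- enum 'I_(size s)] = s.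
Proof.
rewrite (map_comp (nth 0 s) (@nat_of_ord _)) val_enum_ord.
by rewrite map_nth_iota0// take_size.
Qed.

Lemma symml_norm_ub k (T : symml k V W) v : `|T v| <= `|T| * \prod_i `|v i|.
Proof.
have [lT _ _] := symmlP T.
have [/existsP[i /eqP vi0]|/existsPn v0] := boolP [exists i, v i == 0].
  have -> : T v = 0.
    have -> : v = (fun j => (if j == i then 0 else 1) *: v j).
      by apply/funext => j; case: eqVneq => [->|_]; rewrite ?scale1r// scale0r.
    by rewrite multilinearZ// (bigD1 i)//= eqxx mul0r scale0r.
  by rewrite normr0 mulr_ge0// prodr_ge0.
have -> : v = (fun j => `|v j| *: (`|v j|^-1 *: v j)).
  by apply/funext => j; rewrite scalerA divff ?scale1r// normr_eq0.
rewrite multilinearZ// normrZ mulrC.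
rewrite [X in _ <= _ * X](eq_bigr (fun j => `|v j|)); last first.
  by move=> j _; rewrite scalerA divff ?scale1r// normr_eq0.
rewrite ger0_norm ?prodr_ge0// ler_wpM2r ?prodr_ge0//.
apply: (sup_norm_ub (symml_bounded_on T)) => j.
by rewrite normrZ normfV normr_id mulVf// normr_eq0.
Qed.

Lemma symml_norm_le k (T : symml k V W) c : 0 <= c ->
  (forall v, `|T v| <= c * \prod_i `|v i|) -> `|T| <= c.
Proof.
move=> c0 Tc; apply: sup_norm_le; first exact: unit_polyball_neq0.
move=> v v1; rewrite (le_trans (Tc v))// ler_piMr//.
by apply: prodr_ile1 => i _; rewrite normr_ge0 v1.
Qed.

Lemma symml_linearB k (S T : symml k V W) v : (S - T) v = S v - T v.
Proof.
have -> : S - T = -1 *: T + S by rewrite scaleN1r addrC.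
by rewrite symml_linearE scaleN1r addrC.
Qed.

Lemma symjet_symml_seq (F : forall k, symml k V W) :
  symjet (fun s => F (size s) (fun i => nth 0 s i)).
Proof.
split.
- move=> _ s t _ st; have /tuple_permP[p sE] : perm_eq s (in_tuple t) by [].
  have sst : size s = size t by exact: perm_size.
  have [_ symF _] := symmlP (F (size t)).
  rewrite -(symF p); move: (sE); rewrite sst => {}sE.
  congr (F (size t) _); apply/funext => i; rewrite sE /=.
  rewrite (nth_map i) ?size_enum_ord ?ltn_ord// nth_ord_enum (tnth_nth 0)//.
- move=> a u v s /=; have [lF _ _] := symmlP (F (size s).+1).
  pose x (i : 'I_(size s).+1) := nth 0 (0 :: s) i.
  have E w : (fun i : 'I_(size s).+1 => nth 0 (w :: s) i) = dfwith x ord0 w.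
    apply/funext => i; case: dfwithP => [//|j].
    by case: j => -[].
  by rewrite !E lF.
- elim=> [|k [M IH]]; first by exists 0.
  exists (`|M| + `|F k|) => s; rewrite ltnS leq_eqVlt => /predU1P[sk|sk].
    rewrite mulrDl -[leLHS]add0r lerD ?mulr_ge0 ?pnorm_ge0//.
    by rewrite -prod_nth_pnorm (le_trans (symml_norm_ub _ _))// sk.
  rewrite (le_trans (IH s sk))// ler_wpM2r ?pnorm_ge0//.
  by rewrite (le_trans (ler_norm M))// lerDl.
Qed.

Lemma symjet_symml k (B : seq V -> W) : symjet B ->
  exists S : symml k V W, forall v, S v = B [seq v i | i <- enum 'I_k].
Proof.
move=> sB; have [dB lB bB] := sB.
suff fP : (fun v : 'I_k -> V => B [seq v i | i <- enum 'I_k]) \in symml_pred k V W.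
  by exists (Symml fP).
apply/asboolP; split.
- move=> i x; have E u : B [seq dfwith x i u j | j <- enum 'I_k] =
      B (u :: [seq x j | j <- rem i (enum 'I_k)]).
    apply: dB (leqnn _) _.
    have pe : perm_eq (enum 'I_k) (i :: rem i (enum 'I_k)).
      by apply: perm_to_rem; rewrite mem_enum.
    rewrite (perm_trans (perm_map _ pe))//= dfwithin.
    rewrite (_ : map _ _ = map x (rem i (enum 'I_k)))//.
    apply/eq_in_map => j; rewrite mem_rem_uniq ?enum_uniq// => /andP[ji _].
    by rewrite dfwithout// eq_sym.
  by move=> a u v; rewrite !E lB.
- move=> s x; apply: dB (leqnn _) _.
  rewrite (map_comp x s); apply: perm_map; apply: uniq_perm.
  + by rewrite map_inj_uniq ?enum_uniq//; exact: perm_inj.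
  + exact: enum_uniq.
  + move=> j; rewrite mem_enum; apply/mapP; exists ((s^-1)%g j).
      by rewrite mem_enum.
    by rewrite permKV.
- have [M MB] := bB k.+1; exists M => x; rewrite -pnorm_enum.
  by apply: MB; rewrite size_map size_enum_ord.
Qed.

End symml_eval.

Section differential.
Context {R : realType} {V W : normedModType R}.

Lemma is_diff_near (g : V -> W) (L : V -> W) x M : linear L ->
  (forall u, `|L u| <= M * `|u|) ->
  (forall e, 0 < e -> \forall u \near (0 : V), `|g (x + u) - g x - L u| <= e * `|u|) ->
  differentiable g x /\ 'd g x = L :> (V -> W).
Proof.
move=> linL LM gL.
pose L' : {linear V -> W} := HB.pack L (GRing.isLinear.Build _ _ _ _ _ linL).
have cL : continuous L'.
  apply: bounded_linear_continuous; apply/linear_boundedP.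
  exists M; split; first exact: num_real.
  by move=> r Mr u; rewrite (le_trans (LM u))// ler_wpM2r// ltW.
have gx : g \o shift x = cst (g x) + L' +o_ 0 id.
  apply/eqaddoP => e e0; apply: filterS (gL _ e0) => u.
  by rewrite !fctE /= opprD addrA (addrC u).
have dg : 'd g x = L' :> (V -> W) by exact: diff_unique gx.
split; last by rewrite dg.
apply/diff_locallyP; rewrite dg; split => //.
Qed.

Lemma diff_near (g : V -> W) x : differentiable g x -> forall e, 0 < e ->
  \forall u \near (0 : V), `|g (x + u) - g x - 'd g x u| <= e * `|u|.
Proof.
move=> dg e e0; have /eqaddoP/(_ e e0) := diff_locally dg.
by apply: filterS => u; rewrite !fctE /= opprD addrA (addrC u).
Qed.

End differential.

Section jet_of_function.
Context {R : realType} {V W : normedModType R}.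
Implicit Types (f : V -> W).

(** Where f is not differentiable often enough this is a value of the default 0
    of frechetD: the lemmas below bound the length of s accordingly. *)
Definition djet f (x : V) (s : seq V) : W :=
  frechetD f (size s) x (fun i => nth 0 s i).

Lemma djet_nil f x : djet f x [::] = f x.
Proof. by []. Qed.

Lemma symjet_djet f x : symjet (djet f x).
Proof. exact: (symjet_symml_seq (fun k => frechetD f k x)). Qed.

Lemma Cp_on_isjet m X f : open X -> Cp_on (Some m) X f -> isjet m X (djet f).
Proof.
move=> oX [fd fc] x Xx; split; first exact: symjet_djet.
- move=> e e0.
  have : \forall u \near (0 : V), forall k : 'I_m,
      `|frechetD f k (x + u) - frechetD f k x - 'd (frechetD f k) x u| <= e * `|u|.
    apply: filter_forall => k.
    by apply: diff_near => //; exact: (fd k (ltn_ord k) x Xx).1.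
  apply: filterS => u h s sm; rewrite -prod_nth_pnorm.
  apply: le_trans (le_trans (symml_norm_ub
    (frechetD f (size s) (x + u) - frechetD f (size s) x - 'd (frechetD f (size s)) x u)
    (fun i => nth 0 s i)) _); last first.
    by rewrite ler_wpM2r ?prodr_ge0//; exact: (h (Ordinal sm)).
  rewrite !symml_linearB /djet /= (fd _ sm x Xx).2.
  by [].
- move=> e e0.
  have : \forall u \near (0 : V), forall k : 'I_m.+1,
      `|frechetD f k (x + u) - frechetD f k x| <= e.
    apply: filter_forall => k.
    have km : Np (Some m) k by rewrite /= -ltnS.
    have := fc k km; rewrite continuous_open_subspace// => /(_ x (mem_set Xx)).
    move=> /cvgr_dist_le => /(_ _ e0) h.
    have {h} : \forall z \near x, `|frechetD f k x - frechetD f k z| <= e by exact: h.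
    by rewrite near0E; apply: filterS => u; rewrite distrC.
  apply: filterS => u h s sm; rewrite -prod_nth_pnorm.
  apply: le_trans (le_trans (symml_norm_ub
    (frechetD f (size s) (x + u) - frechetD f (size s) x)
    (fun i => nth 0 s i)) _); last first.
    by rewrite ler_wpM2r ?prodr_ge0//; exact: (h (Ordinal sm)).
  by rewrite symml_linearB.
Qed.

(** The derivative of a multilinear map depending on x has to be identified in
    operator norm; the uniformity over lists in the definition of jets is what
    makes this possible. *)
Lemma isjet_frechetD m X f (J : V -> seq V -> W) : open X -> isjet m X J ->
  (forall x, X x -> f x = J x [::]) ->
  forall k, (k <= m)%N -> forall x, X x ->
  (forall v, frechetD f k x v = J x [seq v i | i <- enum 'I_k]) /\
  ((k < m)%N -> symml_derivative (frechetD f k) x (frechetD f k.+1 x)).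
Proof.
move=> oX jJ fJ.
suff H k : (k <= m)%N ->
    (forall x, X x -> forall v, frechetD f k x v = J x [seq v i | i <- enum 'I_k]) ->
    (k < m)%N -> forall x, X x ->
      symml_derivative (frechetD f k) x (frechetD f k.+1 x) /\
      forall v, frechetD f k.+1 x v = J x [seq v i | i <- enum 'I_k.+1].
  have H2 : forall k, (k <= m)%N ->
     (forall x, X x -> forall v, frechetD f k x v = J x [seq v i | i <- enum 'I_k]).
    elim=> [_ x Xx v|k IH km x Xx v]; last by apply (H k (ltnW km) (IH (ltnW km)) km x Xx).
    by rewrite /= fJ//; have := size_enum_ord 0; case: (enum 'I_0).
  move=> k km x Xx; split; first exact: H2.
  by move=> km'; have [] := H k km (H2 k km) km' x Xx.
move=> km fk k1m x Xx; have [sJ dJ cJ] := jJ x Xx.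
have [S SE] := symjet_symml k.+1 sJ.
have LP u : exists T : symml k V W, forall v, T v = J x (u :: [seq v i | i <- enum 'I_k]).
  by apply: (@symjet_symml _ _ _ k (fun t => J x (u :: t))); exact: symjet_cons.
have [L LE] := choice LP.
have [_ lJ _] := sJ.
have linL : linear L.
  by move=> a u w; apply/val_inj/funext => v; rewrite -[LHS]/(L (a *: u + w) v) -[RHS]/(a *: L u v + L w v) !LE lJ.
have [M M0 bM] := symjet_bdd k.+2 sJ.
have LM u : `|L u| <= M * `|u|.
  apply: symml_norm_le; first by rewrite mulr_ge0.
  move=> v; rewrite LE -mulrA -pnorm_enum -pnorm_cons; apply: bM.
  by rewrite /= size_map size_enum_ord.
have [dg dE] : differentiable (frechetD f k) x /\ 'd (frechetD f k) x = L :> (V -> _).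
  apply: (is_diff_near linL LM) => e e0.
  have Xu : \forall u \near (0 : V), X (x + u).
    by rewrite -near0E; exact: open_nbhs_nbhs.
  near=> u; apply: symml_norm_le; first by rewrite mulr_ge0// ltW.
  move=> v; rewrite !symml_linearB fk; last by near: u.
  rewrite fk// LE -pnorm_enum.
  have : bdd m (e * `|u|) (fun s => J (x + u) s - J x s - J x (u :: s)) by near: u; exact: dJ.
  by apply; rewrite size_map size_enum_ord.
have fS : symml_derivative (frechetD f k) x S.
  split => // v; rewrite dE LE SE map_enum_ordS.
  by congr (J x (_ :: _)).
by rewrite (frechetDS fS).
Unshelve. all: by end_near. Qed.

Lemma isjet_djet m X f (J : V -> seq V -> W) : open X -> isjet m X J ->
  (forall x, X x -> f x = J x [::]) ->
  forall x s, X x -> (size s <= m)%N -> djet f x s = J x s.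
Proof.
move=> oX jJ fJ x s Xx sm.
by rewrite /djet (isjet_frechetD oX jJ fJ sm Xx).1 map_nth_enum.
Qed.

Lemma isjet_Cp_on m X f (J : V -> seq V -> W) : open X -> isjet m X J ->
  (forall x, X x -> f x = J x [::]) -> Cp_on (Some m) X f.
Proof.
move=> oX jJ fJ; split.
  by move=> k km x Xx; apply (isjet_frechetD oX jJ fJ (ltnW km) Xx).2.
move=> k km; rewrite continuous_open_subspace// => x /set_mem Xx.
have [sJ dJ cJ] := jJ x Xx.
apply/cvgrPdist_le => e e0.
suff : \forall z \near x, `|frechetD f k x - frechetD f k z| <= e by [].
rewrite near0E; have Xu : \forall u \near (0 : V), X (x + u).
  by rewrite -near0E; exact: open_nbhs_nbhs.
near=> u; rewrite distrC; apply: symml_norm_le; first exact: ltW.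
move=> v; rewrite symml_linearB.
rewrite (isjet_frechetD oX jJ fJ km _).1; last by near: u.
rewrite (isjet_frechetD oX jJ fJ km Xx).1 -pnorm_enum.
have : bdd m.+1 e (fun s => J (x + u) s - J x s) by near: u; exact: cJ.
by apply; rewrite size_map size_enum_ord.
Unshelve. all: by end_near. Qed.

(** Reduces every statement on C^p to finite p, where jets apply. *)
Lemma Cp_onP p X f : Cp_on p X f <-> forall m, Np p m -> Cp_on (Some m) X f.
Proof.
have le (k m : nat) : Np p m -> (k <= m)%N -> Np p k.
  by case: p => //= r mr km; exact: leq_trans mr.
split=> [[fd fc] m pm|H].
  by split=> k km; [apply: fd|apply: fc]; exact: le km.
split=> [k kp x Xx|k kp].
  by have [fd _] := H _ kp; apply: fd => //=.
by have [_ fc] := H _ kp; apply: fc => /=.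
Qed.

End jet_of_function.

(** * Closure properties of the classes C^p *)

Section closure_properties.
Context {R : realType} {V : normedModType R}.

Section one_target.
Context {W : normedModType R}.
Implicit Types (f g : V -> W) (X : set V).

Lemma djet_eq m X f g x s : open X -> Cp_on (Some m) X f ->
  (forall x, X x -> g x = f x) -> X x -> (size s <= m)%N ->
  djet g x s = djet f x s.
Proof.
by move=> oX fX gf Xx sm; exact: isjet_djet oX (Cp_on_isjet oX fX) gf x s Xx sm.
Qed.

Lemma Cp_on_eq p X f g : open X -> Cp_on p X f ->
  (forall x, X x -> g x = f x) -> Cp_on p X g.
Proof.
move=> oX /Cp_onP fX gf; apply/Cp_onP => m pm.
exact: isjet_Cp_on oX (Cp_on_isjet oX (fX m pm)) gf.
Qed.

Lemma Cp_on_sub p X U f : open X -> open U -> U `<=` X -> Cp_on p X f ->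
  Cp_on p U f.
Proof.
move=> oX oU UX [fd fc]; split=> k kp; first by move=> x /UX; exact: fd.
exact: continuous_subspaceW (fc k kp).
Qed.

Lemma Cp_on_local p X f : open X ->
  (forall x, X x -> exists U, [/\ open U, U x & Cp_on p U f]) -> Cp_on p X f.
Proof.
move=> oX H; split=> k kp.
  by move=> x /H[U [oU Ux [fd _]]]; exact: fd.
rewrite continuous_open_subspace// => x /set_mem /H[U [oU Ux [_ /(_ k kp)]]].
by rewrite continuous_open_subspace//; apply; exact: mem_set.
Qed.

Lemma isjet_cst m X (w : W) : isjet m X (fun _ s => if s is [::] then w else 0).
Proof.
move=> x _; split.
- split.
  + by move=> n [|v s] [|u t]// _ /perm_size.
  + by move=> a u v s; rewrite scaler0 addr0.
  + move=> k; exists `|w| => -[|v s] _; first by rewrite pnorm_nil mulr1.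
    by rewrite normr0 mulr_ge0 ?pnorm_ge0.
- move=> e e0; near=> u => s _; case: s => [|v s]; rewrite subrr ?subr0 normr0.
    by rewrite pnorm_nil mulr1 mulr_ge0 ?(ltW e0).
  by rewrite !mulr_ge0 ?(ltW e0) ?pnorm_ge0.
- move=> e e0; near=> u => s _; rewrite subrr normr0.
  by rewrite !mulr_ge0 ?(ltW e0) ?pnorm_ge0.
Unshelve. all: by end_near. Qed.

Lemma Cp_on_cst p X (w : W) : open X -> Cp_on p X (fun=> w).
Proof.
by move=> oX; apply/Cp_onP => m _; apply: isjet_Cp_on oX (isjet_cst m w) _.
Qed.

Lemma djet_cst (w : W) x s : djet (fun=> w) (x : V) s = if s is [::] then w else 0.
Proof.
exact: (isjet_djet openT (isjet_cst (size s) w)).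
Qed.

Lemma isjet_linear m X (L : V -> W) : bounded_linear L ->
  isjet m X (fun x s => match s with [::] => L x | [:: v] => L v | _ => 0 end).
Proof.
move=> [linL [M LM]] x _; have LD u v : L (u + v) = L u + L v.
  by have := linL 1 u v; rewrite !scale1r.
have L0 : L 0 = 0.
  by have := linL (-1) 0 0; rewrite scaler0 addr0 scaleN1r addNr.
have M1 : 0 < `|M| + 1 by rewrite ltr_wpDl.
split.
- split.
  + move=> n [|v [|v' s]] [|u [|u' t]]// _; try by move/perm_size.
    by rewrite perm_sym => /perm_small_eq => /(_ isT) [->].
  + by move=> a u v [|w s]; [exact: linL|rewrite scaler0 addr0].
  + move=> k; exists (`|L x| + `|M|) => -[|v [|v' s]] _.
    * by rewrite pnorm_nil mulr1 lerDl.
    * rewrite pnorm_cons pnorm_nil mulr1 (le_trans (LM v))// ler_wpM2r//.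
      by rewrite (le_trans (ler_norm M))// lerDr.
    * by rewrite normr0 mulr_ge0 ?pnorm_ge0// addr_ge0.
- move=> e e0; near=> u => s _; have n0 : 0 <= e * `|u| * pnorm s.
    by rewrite !mulr_ge0 ?(ltW e0) ?pnorm_ge0.
  case: s n0 => [|v [|v' s]]//= n0; last by rewrite !subr0 normr0.
    by rewrite LD addrAC addrK subrr normr0.
  by rewrite subrr subr0 normr0.
- move=> e e0; have c0 : 0 < e / (`|M| + 1) by rewrite divr_gt0.
  have n0 : \forall u \near (0 : V), `|u| < e / (`|M| + 1) by exact: nbhs0_lt.
  apply: filterS n0 => u un s _; have n0 : 0 <= e * pnorm s.
    by rewrite !mulr_ge0 ?(ltW e0) ?pnorm_ge0.
  case: s n0 => [|v [|v' s]]//= n0; last by rewrite !subr0 normr0.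
    rewrite LD addrAC subrr add0r pnorm_nil mulr1 (le_trans (LM u))//.
    rewrite (@le_trans _ _ ((`|M| + 1) * `|u|))//.
      by rewrite ler_wpM2r// (le_trans (ler_norm M))// lerDl.
    by rewrite mulrC -ler_pdivlMr// ltW.
  by rewrite subrr normr0.
Unshelve. all: by end_near. Qed.

Lemma Cp_on_bounded_linear p X (L : V -> W) : open X -> bounded_linear L ->
  Cp_on p X L.
Proof.
by move=> oX bL; apply/Cp_onP => m _; apply: isjet_Cp_on oX (isjet_linear m bL) _.
Qed.

Lemma djet_bounded_linear (L : V -> W) x s : bounded_linear L ->
  djet L x s = match s with [::] => L x | [:: v] => L v | _ => 0 end.
Proof.
move=> bL; exact: (isjet_djet openT (isjet_linear (size s) bL)).
Qed.

Lemma djet_linear m X f g a x s : open X -> Cp_on (Some m) X f ->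
  Cp_on (Some m) X g -> X x -> (size s <= m)%N ->
  djet (a *: f + g) x s = a *: djet f x s + djet g x s.
Proof.
by move=> oX fX gX Xx sm; rewrite /djet (frechetD_linear a oX fX gX).
Qed.

Lemma Cp_onD p X f g : open X -> Cp_on p X f -> Cp_on p X g ->
  Cp_on p X (fun x => f x + g x).
Proof.
move=> oX fX gX; apply: Cp_on_eq (Cp_on_linear 1 oX fX gX) _ => // x _.
by rewrite !fctE scale1r.
Qed.

Lemma Cp_on_sum I (r : seq I) (P : pred I) (F : I -> V -> W) p X : open X ->
  (forall i, P i -> Cp_on p X (F i)) ->
  Cp_on p X (fun x => \sum_(i <- r | P i) F i x).
Proof.
move=> oX FX; elim: r => [|i r IH].
  by apply: Cp_on_eq (Cp_on_cst p 0 oX) _ => // x _; rewrite big_nil.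
have [Pi|nPi] := boolP (P i); last first.
  by apply: Cp_on_eq IH _ => // x _; rewrite big_cons (negbTE nPi).
by apply: Cp_on_eq (Cp_onD oX (FX i Pi) IH) _ => // x _; rewrite big_cons Pi.
Qed.

Lemma isjet_scale m (J : V -> seq V -> W) c a : isjet m setT J ->
  isjet m setT (fun x s => c ^+ size s *: J (c *: (x - a)) s).
Proof.
move=> jJ x _; have [sJ dJ cJ] := jJ (c *: (x - a)) I.
have near_scale (P : set V) : (\forall u \near (0 : V), P u) ->
    \forall u \near (0 : V), P (c *: u).
  move=> /nbhs_norm0P[d /= d0 hd]; apply/nbhs_norm0P.
  exists (d / (`|c| + 1)); first by rewrite /= divr_gt0// ltr_wpDl.
  move=> u /=; rewrite ltr_pdivlMr ?ltr_wpDl// => h; apply: hd => /=.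
  rewrite normrZ (le_lt_trans _ h)// mulrC ler_wpM2l// lerDl//.
have xuE u : c *: (x + u - a) = c *: (x - a) + c *: u by rewrite addrAC scalerDr.
have [dsJ lJ bJ] := sJ.
pose C := \sum_(i < m.+1) `|c| ^+ i.+1 + \sum_(i < m.+1) `|c| ^+ i.
have C0 : 0 <= C by rewrite addr_ge0// sumr_ge0// => i _; rewrite exprn_ge0.
have C1 j : (j < m.+1)%N -> `|c| ^+ j.+1 <= C.
  move=> jm; rewrite /C (bigD1 (Ordinal jm))//= -addrA lerDl addr_ge0// sumr_ge0// => i _;
  by rewrite exprn_ge0.
have C2 j : (j < m.+1)%N -> `|c| ^+ j <= C.
  move=> jm; rewrite /C addrC (bigD1 (Ordinal jm))//= -addrA lerDl addr_ge0// sumr_ge0// => i _;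
  by rewrite exprn_ge0.
split.
- split.
  + by move=> n s t sn st; rewrite (perm_size st) (dsJ n _ _ sn st).
  + by move=> b u v s /=; rewrite lJ scalerDr !scalerA mulrC.
  + move=> k; have [M MJ] := bJ k.
    elim: k M MJ => [|k IH] M MJ; first by exists 0.
    have [N NJ] := IH M (bdd_le (leqnSn k) (lexx M) MJ).
    exists (`|N| + `|c| ^+ k * `|M|) => s; rewrite ltnS leq_eqVlt => /predU1P[sk|sk].
      rewrite mulrDl -[leLHS]add0r lerD ?mulr_ge0 ?pnorm_ge0//.
      rewrite normrZ normrX sk -mulrA ler_wpM2l ?exprn_ge0//.
      rewrite (le_trans (MJ s _)) ?sk// ler_wpM2r ?pnorm_ge0//; exact: ler_norm.
    rewrite (le_trans (NJ s sk))// ler_wpM2r ?pnorm_ge0//.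
    by rewrite (le_trans (ler_norm N))// lerDl mulr_ge0// exprn_ge0.
- move=> e e0; have [d d0 dE] : exists2 d, 0 < d & d = e / (C + 1).
    by exists (e / (C + 1)) => //; rewrite divr_gt0// ltr_wpDl.
  have := near_scale _ (dJ d d0); apply: filterS => u h s sm /=; rewrite xuE.
  have -> : c ^+ size s *: J (c *: (x - a) + c *: u) s - c ^+ size s *: J (c *: (x - a)) s
    - c ^+ (size s).+1 *: J (c *: (x - a)) (u :: s) = c ^+ size s *:
    (J (c *: (x - a) + c *: u) s - J (c *: (x - a)) s - J (c *: (x - a)) (c *: u :: s)).
    have := lJ c u 0 s; have := lJ (-1) 0 0 s.
    rewrite scaler0 addr0 scaleN1r addNr => ->; rewrite !addr0 => ->.
    by rewrite !scalerBr scalerA exprSr.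
  rewrite normrZ normrX; have := h s sm; rewrite /= => hs.
  apply: le_trans (_ : `|c| ^+ size s * (d * `|c *: u| * pnorm s) <= _).
    by rewrite ler_wpM2l// exprn_ge0.
  rewrite normrZ dE; have -> : `|c| ^+ size s * (e / (C + 1) * (`|c| * `|u|) * pnorm s)
    = e * `|u| * pnorm s * (`|c| ^+ (size s).+1 / (C + 1)) by rewrite exprS; ring.
  rewrite ler_piMr ?mulr_ge0 ?(ltW e0) ?pnorm_ge0// ler_pdivrMr ?ltr_wpDl// mul1r.
  by rewrite (le_trans (C1 _ _)) ?lerDl// ltnW.
- move=> e e0; have [d d0 dE] : exists2 d, 0 < d & d = e / (C + 1).
    by exists (e / (C + 1)) => //; rewrite divr_gt0// ltr_wpDl.
  have := near_scale _ (cJ d d0); apply: filterS => u h s sm /=; rewrite xuE.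
  rewrite -scalerBr normrZ normrX; have := h s sm; rewrite /= => hs.
  apply: le_trans (_ : `|c| ^+ size s * (d * pnorm s) <= _).
    by rewrite ler_wpM2l// exprn_ge0.
  rewrite dE; have -> : `|c| ^+ size s * (e / (C + 1) * pnorm s)
    = e * pnorm s * (`|c| ^+ size s / (C + 1)) by ring.
  rewrite ler_piMr ?mulr_ge0 ?(ltW e0) ?pnorm_ge0// ler_pdivrMr ?ltr_wpDl// mul1r.
  by rewrite (le_trans (C2 _ _)) ?lerDl.
Qed.

Lemma Cp_on_scale p f c a : Cp_on p setT f ->
  Cp_on p setT (fun x => f (c *: (x - a))).
Proof.
move=> /Cp_onP fX; apply/Cp_onP => m pm.
apply: isjet_Cp_on (isjet_scale c a (Cp_on_isjet openT (fX m pm))) _; first exact: openT.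
by move=> x _; rewrite expr0 scale1r.
Qed.

Lemma djet_scale f c a x s : Cp_on (Some (size s)) setT f ->
  djet (fun x => f (c *: (x - a))) x s = c ^+ size s *: djet f (c *: (x - a)) s.
Proof.
move=> fX; apply: (isjet_djet openT (isjet_scale c a (Cp_on_isjet openT fX))) => //.
by move=> y _; rewrite expr0 scale1r.
Qed.

End one_target.

Lemma Cp_on_mul (W : normedModType R) p X (g : V -> R^o) (f : V -> W) : open X ->
  Cp_on p X g -> Cp_on p X f -> Cp_on p X (fun x => g x *: f x).
Proof.
move=> oX /Cp_onP gX /Cp_onP fX; apply/Cp_onP => m pm.
exact: isjet_Cp_on oX (isjet_leib (Cp_on_isjet oX (gX m pm)) (Cp_on_isjet oX (fX m pm))) _.
Qed.

Lemma djet_mul (W : normedModType R) m X (g : V -> R^o) (f : V -> W) x s : open X ->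
  Cp_on (Some m) X g -> Cp_on (Some m) X f -> X x -> (size s <= m)%N ->
  djet (fun x => g x *: f x) x s = leib (djet g x) (djet f x) s.
Proof.
move=> oX gX fX Xx sm.
exact: (isjet_djet oX (isjet_leib (Cp_on_isjet oX gX) (Cp_on_isjet oX fX))).
Qed.

Lemma Cp_on_prod I (r : seq I) (F : I -> V -> R^o) p X : open X ->
  (forall i, Cp_on p X (F i)) ->
  Cp_on p X ((fun x => \prod_(i <- r) (F i x : R)) : V -> R^o).
Proof.
move=> oX FX; elim: r => [|i r IH].
  by apply: Cp_on_eq (Cp_on_cst p (1 : R^o) oX) _ => // x _; rewrite big_nil.
by apply: Cp_on_eq (Cp_on_mul oX (FX i) IH) _ => // x _; rewrite big_cons.
Qed.

Lemma Cp_on_chain p X (f : nat -> R -> R) (g : V -> R^o) : open X ->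
  (forall x, X x -> smooth_at f (g x)) -> Cp_on p X g ->
  Cp_on p X ((fun x => f 0%N (g x)) : V -> R^o).
Proof.
move=> oX sf /Cp_onP gX; apply/Cp_onP => m pm.
exact: isjet_Cp_on oX (isjet_chain sf (Cp_on_isjet oX (gX m pm))) _.
Qed.

Lemma isjet_post (W W' : normedModType R) m X (A : bop W W') (J : V -> seq V -> W) :
  isjet m X J -> isjet m X (fun x s => A (J x s)).
Proof.
move=> jJ x Xx; have [[dJ lJ bJ] fJ cJ] := jJ x Xx.
have [lA _] := bopP A; have AB u v : A (u - v) = A u - A v.
  by rewrite addrC -scaleN1r lA scaleN1r addrC.
pose C := bop_norm A + 1; have C0 : 0 < C by rewrite ltr_wpDl// bop_norm_ge0.
have AC w : `|A w| <= C * `|w|.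
  by rewrite (le_trans (bop_norm_le A w))// ler_wpM2r// lerDl.
split.
- split.
  + by move=> n s t sn st; rewrite (dJ n s t sn st).
  + by move=> a u v s; rewrite lJ lA.
  + move=> k; have [M MJ] := bJ k; exists (C * M) => s sk.
    by rewrite (le_trans (AC _))// -mulrA ler_wpM2l ?(ltW C0)// MJ.
- move=> e e0; have d0 : 0 < e / C by rewrite divr_gt0.
  apply: filterS (fJ _ d0) => u h s sm; rewrite -!AB (le_trans (AC _))//.
  rewrite mulrC -ler_pdivlMr// (le_trans (h s sm))//.
  by rewrite le_eqVlt; apply/orP; left; apply/eqP; ring.
- move=> e e0; have d0 : 0 < e / C by rewrite divr_gt0.
  apply: filterS (cJ _ d0) => u h s sm; rewrite -!AB (le_trans (AC _))//.
  by rewrite mulrC -ler_pdivlMr// (le_trans (h s sm))// mulrAC.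
Qed.

Lemma Cp_on_post (W W' : normedModType R) p X (A : bop W W') (f : V -> W) : open X ->
  Cp_on p X f -> Cp_on p X (fun x => A (f x)).
Proof.
move=> oX /Cp_onP fX; apply/Cp_onP => m pm.
exact: isjet_Cp_on oX (isjet_post A (Cp_on_isjet oX (fX m pm))) _.
Qed.

End closure_properties.

Section more_jets.
Context {R : realType} {V W : normedModType R}.

Lemma djet_size j (f : V -> W) x s : size s = j ->
  djet f x s = frechetD f j x (fun i => nth 0 s i).
Proof. by move=> <-. Qed.

Lemma djet_sum I (r : seq I) (c : I -> R) (f : I -> V -> W) m (X : set V) x s :
  open X -> (forall i, Cp_on (Some m) X (f i)) -> X x -> (size s <= m)%N ->
  djet (fun z => \sum_(i <- r) c i *: f i z) x s = \sum_(i <- r) c i *: djet (f i) x s.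
Proof.
move=> oX fX Xx sm; have cC i : Cp_on (Some m) X (fun z => c i *: f i z).
  exact: (@Cp_on_mul _ _ _ _ _ (fun=> c i) (f i) oX (Cp_on_cst _ _ oX) (fX i)).
elim: r => [|i r IH].
  rewrite big_nil (@djet_eq _ _ _ m X (fun=> 0)) ?djet_cst//; last 2 first.
  - exact: Cp_on_cst.
  - by move=> z _; rewrite big_nil.
  by case: (s).
rewrite big_cons -IH -(djet_linear (c i) oX (fX i) _ Xx sm); last first.
  by apply: Cp_on_sum oX _ => j _; exact: cC.
apply: (@djet_eq _ _ _ m X) => //; last by move=> z _; rewrite big_cons.
by apply: (Cp_on_linear _ oX (fX i)); apply: Cp_on_sum oX _ => j _; exact: cC.
Qed.

Lemma djet_scale_vector m (X : set V) (g : V -> R^o) (w : W) x s : open X ->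
  Cp_on (Some m) X g -> X x -> (size s <= m)%N ->
  djet (fun z => g z *: w) x s = djet g x s *: w.
Proof.
move=> oX gX Xx sm.
have [A AE] : exists A : bop R^o W, A = (fun t => t *: w) :> (R^o -> W).
  apply: bounded_linear_bop; split.
    by move=> a u v; rewrite scalerDl scalerA.
  by exists `|w| => t; rewrite normrZ mulrC.
have hA : forall z, X z -> g z *: w = A (djet g z [::]) by rewrite AE.
by rewrite (isjet_djet oX (isjet_post A (Cp_on_isjet oX gX)) hA Xx sm) AE.
Qed.

End more_jets.

(** * Cutoff functions *)

Section smooth_functions_of_one_variable.
Context {R : realType}.
Implicit Types (f : nat -> R -> R) (t : R) (p : {poly R}).

Lemma smooth_at_is_derive f t :
  (forall k, is_derive t 1 (f k) (f k.+1 t)) -> smooth_at f t.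
Proof.
move=> df k e e0; have [dk dkE] := df k.
have diffk : differentiable (f k) t by apply/derivable1_diffP.
apply: filterS (diff_near diffk e0) => h.
have -> : 'd (f k) t h = f k.+1 t * h.
  have -> : h = h *: (1 : R) by rewrite /GRing.scale /= mulr1.
  by rewrite linearZ /= -deriveE// dkE /GRing.scale /= mulr1 mulrC.
by [].
Qed.

Definition inv_derivs k t : R := (-1) ^+ k * k`!%:R * t^-1 ^+ k.+1.

Lemma smooth_at_inv t : t != 0 -> smooth_at inv_derivs t.
Proof.
move=> t0; apply: smooth_at_is_derive => k.
have dV : is_derive t 1 (fun t => t^-1 : R) (- t^-2).
  have := @is_deriveV R id t 1 1 t0 (is_derive_id t 1).
  by rewrite /GRing.scale /= mulr1.
have -> : inv_derivs k =
    ((-1) ^+ k * k`!%:R) \*: ((fun t => t^-1 : R) ^+ k.+1).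
  by apply/funext => s; rewrite /inv_derivs /= fctE.
have dX := is_deriveZ ((-1) ^+ k * k`!%:R) (is_deriveX k.+1 dV).
have -> // : inv_derivs k.+1 t =
    ((-1) ^+ k * k`!%:R) *: ((k.+1%:R * t^-1 ^+ k.+1.-1) *: - t ^- 2).
by rewrite /inv_derivs /GRing.scale /= factS natrM -exprVn !exprS; ring.
Qed.

Fixpoint flat_poly k : {poly R} :=
  if k is k'.+1 then 'X^2 * (flat_poly k' - (flat_poly k')^`()) else 1.

(** The derivatives of exp(-1/t) for t > 0, extended by 0: on t > 0 they are
    [P(1/t) exp(-1/t)] for polynomials P. *)
Definition flat_derivs k t : R :=
  if 0 < t then (flat_poly k).[t^-1] * expR (- t^-1) else 0.

Lemma exprn_expR_bounded n : exists C : R, forall z : R, 0 <= z -> z ^+ n * expR (- z) <= C.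
Proof.
exists (n%:R ^+ n + 1) => z z0; rewrite expRN ler_pdivrMr ?expR_gt0//.
case: n => [|n].
  rewrite !expr0 (@le_trans _ _ (1 * expR z))//.
    by rewrite mul1r -expR0 ler_expR.
  by rewrite ler_wpM2r ?expR_ge0// lerDl.
have n0 : 0 < n.+1%:R :> R by rewrite ltr0n.
rewrite (@le_trans _ _ (n.+1%:R ^+ n.+1 * expR z))//; last first.
  by rewrite ler_wpM2r ?expR_ge0// lerDl.
rewrite -[in expR z](mulfVK (lt0r_neq0 n0) z) [X in expR X]mulrC expRM_natl -exprMn.
apply: lerXn2r; rewrite ?nnegrE// ?mulr_ge0 ?expR_ge0//.
rewrite -ler_pdivrMl// mulrC (le_trans _ (expR_ge1Dx _))//.
by rewrite lerDr.
Qed.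

Lemma horner_expR_bounded p : exists C, forall z, 0 <= z ->
  `|p.[z] * expR (- z)| <= C.
Proof.
pose b i := sval (cid (exprn_expR_bounded i)).
have bP i z : 0 <= z -> z ^+ i * expR (- z) <= b i by exact: (svalP (cid (exprn_expR_bounded i))).
exists (\sum_(i < size p) `|p`_i| * b i) => z z0.
rewrite horner_coef mulr_suml (le_trans (ler_norm_sum _ _ _))//.
apply: ler_sum => i _; rewrite -mulrA normrM ler_wpM2l//.
by rewrite ger0_norm ?bP// mulr_ge0 ?expR_ge0// exprn_ge0.
Qed.

(** At 0 every derivative P(1/t) exp(-1/t) is O(t^2), because z^2 P(z) exp(-z) is
    bounded for z >= 0. *)
Lemma smooth_at_flat t : smooth_at flat_derivs t.
Proof.
have [t0|t0|->] := ltgtP t 0.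
- move=> k e e0.
  have : \forall h \near (0 : R), `|h| < - t by apply: nbhs0_lt; rewrite oppr_gt0.
  apply: filterS => h ht; rewrite /flat_derivs !ifF; last 3 first.
  + by apply/negbTE; rewrite -leNgt ltW.
  + by apply/negbTE; rewrite -leNgt ltW.
  + apply/negbTE; rewrite -leNgt -lerBrDl sub0r (le_trans (ler_norm h))// ltW//.
  by rewrite mul0r !subr0 normr0 mulr_ge0// ltW.
- apply: smooth_at_is_derive => k; have t0' : t != 0 by rewrite gt_eqF.
  have dV : is_derive t 1 (fun t => t^-1 : R) (- t^-2).
    have := @is_deriveV R id t 1 1 t0' (is_derive_id t 1).
    by rewrite /GRing.scale /= mulr1.
  have dP := is_derive1_comp (is_derive_poly (flat_poly k) t^-1) dV.
  have dE := @is_derive1_comp R expR (- (fun t => t^-1)) t _ _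
    (is_derive_expR (- t^-1)) (is_deriveN dV).
  have dPE := is_deriveM dP dE.
  have -> // : flat_derivs k.+1 t = (horner (flat_poly k) \o (fun t => t^-1)) t *:
      (expR (- t^-1) * - - t ^- 2) + (expR \o (fun t => - t^-1)) t *:
      ((flat_poly k)^`().[t^-1] * - t ^- 2).
    rewrite /flat_derivs t0 /= !hornerE /GRing.scale /=.
    by rewrite -exprVn; ring.
  apply: near_eq_is_derive dPE; near=> s.
  rewrite /flat_derivs ifT//; near: s; exact: lt_nbhsr.
- move=> k e e0; rewrite /flat_derivs ltxx.
  have [C CP] := horner_expR_bounded ('X^2 * flat_poly k).
  have C0 : 0 <= C by exact: le_trans (normr_ge0 _) (CP 0 (lexx 0)).
  have C1 : 0 < C + 1 by rewrite ltr_wpDl.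
  have : \forall h \near (0 : R), `|h| < e / (C + 1) by apply: nbhs0_lt; rewrite divr_gt0.
  apply: filterS => h hlt; rewrite add0r mul0r !subr0.
  case: ifP => h0; last by rewrite normr0 mulr_ge0// ltW.
  have hV : 0 <= h^-1 by rewrite invr_ge0 ltW.
  have := CP _ hV; rewrite !hornerE.
  have -> : (flat_poly k).[h^-1] * expR (- h^-1) =
    h ^+ 2 * (h^-1 * h^-1 * (flat_poly k).[h^-1] * expR (- h^-1)).
    by field; rewrite gt_eqF.
  set P := h^-1 * h^-1 * _ * _ => h1.
  have -> : `|h ^+ 2 * P| = `|h| * `|P| * `|h| by rewrite normrM normrX; ring.
  rewrite ler_wpM2r//.
  rewrite (le_trans (ler_wpM2l (normr_ge0 h) h1))//.
  rewrite (@le_trans _ _ (`|h| * (C + 1)))//; first by rewrite ler_wpM2l// lerDl.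
  by rewrite -ler_pdivlMr// ltW.
Unshelve. all: by end_near. Qed.

Lemma flat_derivs_ge0 t : 0 <= flat_derivs 0 t.
Proof.
by rewrite /flat_derivs; case: ifP => //= _; rewrite hornerC mul1r expR_ge0.
Qed.

Lemma flat_derivs_gt0 t : 0 < t -> 0 < flat_derivs 0 t.
Proof. by rewrite /flat_derivs => -> /=; rewrite hornerC mul1r expR_gt0. Qed.

Lemma flat_derivs_eq0 t : t <= 0 -> flat_derivs 0 t = 0.
Proof. by rewrite /flat_derivs ltNge => ->. Qed.

End smooth_functions_of_one_variable.

Section functions_on_open_sets.
Context {R : realType} {V W : normedModType R}.

Lemma Cp_on_continuous p (X : set V) (f : V -> W) x :
  open X -> Cp_on p X f -> X x -> {for x, continuous f}.
Proof.
move=> oX /Cp_onP/(_ 0%N) fX Xx; have {}fX : Cp_on (Some 0%N) X f by apply: fX; case: p.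
have [_ _ cJ] := Cp_on_isjet oX fX Xx.
apply/cvgrPdist_le => e e0.
suff : \forall z \near x, `|f x - f z| <= e by [].
rewrite near0E; apply: filterS (cJ e e0) => u /(_ [::] isT).
by rewrite pnorm_nil mulr1 distrC.
Qed.

Lemma djet_bounded_compact m (X K : set V) (f : V -> W) :
  open X -> compact K -> K `<=` X -> Cp_on (Some m) X f ->
  exists2 C, 0 <= C & forall x, K x -> bdd m.+1 C (djet f x).
Proof.
move=> oX /compact_near_coveringP cK KX fX.
have jf := Cp_on_isjet oX fX.
have [|C [_ CP]] := cK R (+oo)%R (fun C x => bdd m.+1 C (djet f x)) _.
  move=> x Kx; have Xx := KX x Kx.
  have [M M0 bM] := symjet_bdd m.+1 (symjet_djet f x).
  have h1 := isjet_bdd_near jf Xx bM; rewrite -(near0E x (fun z => bdd _ _ (djet f z))) in h1.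
  have h2 : \forall C \near +oo%R, M + 1 <= C by apply: nbhs_pinfty_ge; exact: num_real.
  exists ([set z | bdd m.+1 (M + 1) (djet f z)], [set C | M + 1 <= C]) => //.
  by move=> [z C] /= [bz MC]; exact: bdd_le bz.
exists (`|C| + 1) => [|x Kx]; first by rewrite addr_ge0.
by apply: CP => //; rewrite (le_lt_trans (ler_norm C))// ltrDl.
Qed.

End functions_on_open_sets.

Section cutoff_functions.
Context {R : realType} {n : nat}.
Local Notation V := 'rV[R]_n.

Lemma rV_entry_norm (x : V) i : `|x 0 i| <= `|x|.
Proof.
rewrite [`|x|]mx_normE -[leLHS]nngE num_le.
exact: (@le_bigmax _ _ _ _ (fun i : 'I_1 * 'I_n => `|x i.1 i.2|%:nng) (0, i)).
Qed.

Lemma coord_bounded_linear i : bounded_linear (fun x : V => x 0 i : R^o).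
Proof.
split; first by move=> a u v; rewrite !mxE.
by exists 1 => x; rewrite mul1r rV_entry_norm.
Qed.

Lemma Cp_on_coord p X i : open X -> Cp_on p X (fun x : V => x 0 i : R^o).
Proof. by move=> oX; apply: Cp_on_bounded_linear => //; exact: coord_bounded_linear. Qed.

Definition sqnorm (x : V) : R^o := \sum_i (x 0 i : R) * x 0 i.

Lemma Cp_on_sqnorm p : Cp_on p setT sqnorm.
Proof.
apply: Cp_on_sum => [|i _]; first exact: openT.
by apply: Cp_on_mul openT _ _; exact: Cp_on_coord openT.
Qed.

Lemma sqnorm_ge4 x : 2 <= `|x| -> 4 <= sqnorm x.
Proof.
move=> x2; have xn0 : mx_norm x != 0 by rewrite gt_eqF// (lt_le_trans _ x2).
have [[j i]] := mx_norm_neq0 xn0; rewrite (ord1 j) /= => xi.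
rewrite /sqnorm (bigD1 i)//= -[leLHS]addr0 lerD//; last first.
  by rewrite sumr_ge0// => l _; rewrite -expr2 sqr_ge0.
rewrite -expr2 -[_ ^+ 2]ger0_norm ?sqr_ge0// normrX -xi.
have -> : 4 = 2 ^+ 2 :> R by rewrite -natrX.
by apply: lerXn2r; [rewrite nnegrE|rewrite nnegrE; exact: (normr_ge0 x)|].
Qed.

(** With e the flat function, the quotient
    e(4 - |x|^2) / (e(4 - |x|^2) + e(|x|^2 - 1)) for the Euclidean norm: the
    denominator never vanishes. *)
Lemma bump_exists : exists chi : V -> R^o, [/\ forall p, Cp_on p setT chi,
  \forall x \near (0 : V), chi x = 1 & forall x, 2 <= `|x| -> chi x = 0].
Proof.
have smooth_affine p (a b : R) : Cp_on p setT (fun x : V => a - b * sqnorm x : R^o).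
  apply: Cp_on_eq (Cp_onD openT (Cp_on_cst p (a : R^o) openT)
    (Cp_on_mul openT (Cp_on_cst p (- b : R^o) openT) (Cp_on_sqnorm p))) _.
    exact: openT.
  by move=> x _; rewrite /GRing.scale /= mulNr.
have flatC p (a b : R) : Cp_on p setT (fun x : V => flat_derivs 0 (a - b * sqnorm x) : R^o).
  apply: (@Cp_on_chain _ _ p setT flat_derivs _ openT _ (smooth_affine p a b)).
  by move=> x _; exact: smooth_at_flat.
pose N x : R^o := flat_derivs 0 (4 - 1 * sqnorm x).
pose D x : R^o := N x + flat_derivs 0 (- 1 - (- 1) * sqnorm x).
have D0 x : D x != 0.
  rewrite gt_eqF//; have [u4|u4] := ltP (sqnorm x) 4.
    by rewrite ltr_wpDr ?flat_derivs_ge0 ?flat_derivs_gt0// mul1r subr_gt0.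
  by rewrite ltr_wpDl ?flat_derivs_ge0 ?flat_derivs_gt0//; lra.
exists (fun x => inv_derivs 0 (D x) * N x); split.
- move=> p; apply: (@Cp_on_mul _ _ _ p setT _ N openT); last exact: flatC.
  apply: (@Cp_on_chain _ _ p setT inv_derivs D openT).
    by move=> x _; exact: smooth_at_inv.
  by apply: Cp_onD => //; [exact: openT|exact: flatC..].
- have c0 := Cp_on_continuous openT (Cp_on_sqnorm None) (I : [set: V] 0).
  have u0 : sqnorm 0 = 0 by rewrite /sqnorm big1// => i _; rewrite mxE mul0r.
  move: c0 => /cvgr_dist_le/(_ 1 ltr01) c0.
  have {c0} : \forall x \near (0 : V), `|sqnorm 0 - sqnorm x| <= 1 by exact: c0.
  apply: filterS => x; rewrite u0 sub0r normrN ler_norml => /andP[_ x1].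
  have E : D x = N x.
    by rewrite /D [X in _ + X]flat_derivs_eq0 ?addr0//; lra.
  have N0 : N x != 0 by rewrite -E.
  rewrite -[LHS]/(inv_derivs 0 (D x) * N x) E.
  by rewrite /inv_derivs expr0 mul1r fact0 mul1r expr1 mulVf.
- move=> x /sqnorm_ge4 x4; rewrite /N flat_derivs_eq0 ?mulr0// mul1r; lra.
Qed.

Lemma rV_ball_compact r : compact [set x : V | `|x| <= r].
Proof.
have -> : [set x : V | `|x| <= r] = [set x : V | 0 <= r] `&`
    [set x : V | forall i, `[- r, r]%classic (x 0 i)].
  apply/seteqP; split => [x /= xr|x /= [r0 xr]].
    split; first exact: le_trans xr.
    by move=> i; rewrite in_itv /= -ler_norml (le_trans (rV_entry_norm _ _)).
  rewrite -[`|x|]/(mx_norm x).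
  have [->//|xn] := eqVneq (mx_norm x) 0.
  have [[j i]] := mx_norm_neq0 xn; rewrite (ord1 j) => ->.
  by have := xr i; rewrite in_itv /= -ler_norml.
have [r0|r0] := leP 0 r; last first.
  rewrite (_ : _ `&` _ = set0); first exact: compact0.
  by rewrite -subset0 => x [].
rewrite (_ : [set x : V | true] = setT); last by apply/seteqP.
rewrite setTI; apply: (@rV_compact R n (fun=> `[- r, r]%classic)) => i.
exact: segment_compact.
Qed.

(** Rescaling a single bump, so that the constant does not depend on e. *)
Lemma cutoff m : exists2 C : R, 0 <= C & forall (a : V) e, 0 < e ->
  exists phi : V -> R^o, [/\ forall p, Cp_on p setT phi,
    \forall x \near a, phi x = 1, forall x, 2 * e <= `|x - a| -> phi x = 0 &
    forall x s, (size s <= m)%N -> `|djet phi x s| <= C * e^-1 ^+ size s * pnorm s].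
Proof.
have [chi [chiC chi1 chi0]] := bump_exists.
have [C C0 bC] := djet_bounded_compact openT (@rV_ball_compact 2) (@subsetT _ _)
  (chiC (Some m)).
have {}bC x : bdd m.+1 C (djet chi x).
  have [x2|x2] := leP `|x| 2; first exact: bC.
  have oU : open [set x : V | 2 < `|x|].
    by apply: open_comp (@open_gt _ 2) => y _; exact: norm_continuous.
  move=> s sm; rewrite (@djet_eq _ _ _ m _ (fun=> 0) _ _ _ oU (Cp_on_cst _ 0 oU))//.
    by rewrite djet_cst; case: s sm => [|v s] _; rewrite normr0 mulr_ge0// pnorm_ge0.
  by move=> y /ltW; exact: chi0.
exists C => // a e e0; exists (fun x => chi (e^-1 *: (x - a))); split.
- by move=> p; exact: Cp_on_scale.
- move/nbhs_norm0P : chi1 => [d /= d0 hd].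
  rewrite near0E; have n0 : \forall u \near (0 : V), `|u| < d * e.
    by apply: nbhs0_lt; rewrite mulr_gt0.
  apply: filterS n0 => u ud; rewrite addrC addKr; apply: hd => /=.
  by rewrite normrZ gtr0_norm ?invr_gt0// mulrC ltr_pdivrMr.
- move=> x xa; apply: chi0.
  by rewrite normrZ gtr0_norm ?invr_gt0// mulrC ler_pdivlMr.
- move=> x s sm; rewrite djet_scale; last exact: chiC.
  rewrite normrZ normrX gtr0_norm ?invr_gt0// [leRHS]mulrAC [leRHS]mulrC ler_wpM2l//.
    by rewrite exprn_ge0// invr_ge0 ltW.
  exact: bC.
Qed.

End cutoff_functions.

(** * Taylor remainders *)

Section taylor.
Context {R : realType}.

(** The mean value theorem for phi o f, with phi norming f 1 - f 0. *)
Lemma mean_value_norm (W : normedModType R) (f d : R -> W) M :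
  (forall t : R, 0 <= t <= 1 -> forall e, 0 < e ->
     \forall h \near (0 : R), `|f (t + h) - f t - h *: d t| <= e * `|h|) ->
  (forall t : R, 0 <= t <= 1 -> `|d t| <= M) -> `|f 1 - f 0| <= M.
Proof.
move=> fd dM; have [phi [phi1 phiE]] := norming_functional (f 1 - f 0).
have [lphi _] := bopP phi.
have phiB u v : phi (u - v) = phi u - phi v.
  by rewrite addrC -scaleN1r lphi scaleN1r addrC.
have gd (t : R) : 0 <= t <= 1 -> differentiable (phi \o f : R -> R) t /\ is_derive t 1 (phi \o f : R -> R) (phi (d t)).
  move=> t01.
  have [dg dgE] : differentiable (phi \o f) t /\
      'd (phi \o f) t = (fun h => h * phi (d t)) :> (R -> R^o).
    apply: (@is_diff_near _ _ _ _ _ _ `|phi (d t)|).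
    - by move=> a u v; rewrite /GRing.scale /=; ring.
    - by move=> u; rewrite normrM mulrC.
    - move=> e e0; apply: filterS (fd t t01 e e0) => h hh /=.
      have -> : phi (f (t + h)) - phi (f t) - h * phi (d t) =
          phi (f (t + h) - f t - h *: d t).
        by rewrite !phiB bop_linearZ.
      by rewrite (le_trans (phi1 _)).
  split => //; apply: DeriveDef; first exact/derivable1_diffP.
  by rewrite deriveE// dgE mul1r.
rewrite -phiE phiB.
have h1 (x : R) : x \in `]0, 1[%R -> is_derive x (1 : R) (phi \o f : R -> R) ((phi \o d) x).
  rewrite in_itv /= => /andP[x0 x1].
  by have [|] := gd x; rewrite ?ltW.
have h2 : {within `[0, 1], continuous (phi \o f : R -> R)}.
  apply: continuous_in_subspaceT => x /set_mem.
  rewrite /= in_itv /= => x01; apply: differentiable_continuous.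
  by have [] := gd x x01.
have [c c01] := MVT ltr01 h1 h2; rewrite /= => ->.
rewrite subr0 mulr1 /= (le_trans (ler_norm _))// (le_trans (phi1 _))// dM//.
by move: c01; rewrite in_itv /= => /andP[c0 c1]; rewrite !ltW.
Qed.

Context {V W : normedModType R}.

(** Downward induction on the order: the derivative of order k is small by
    continuity and each integration along the segment from a to x gains a factor
    of |x - a|. *)
Lemma taylor_small k (X : set V) (f : V -> W) a : open X ->
  Cp_on (Some k) X f -> X a -> (forall s, (size s <= k)%N -> djet f a s = 0) ->
  forall eta, 0 < eta -> \forall x \near a, forall s, (size s <= k)%N ->
    `|djet f x s| <= eta * `|x - a| ^+ (k - size s) * pnorm s.
Proof.
move=> oX fX Xa fa0 eta eta0.
have jf := Cp_on_isjet oX fX.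
have : \forall u \near (0 : V), bdd k.+1 eta (djet f (a + u)) /\ X (a + u).
  have [_ _ /(_ eta eta0) h1] := jf a Xa.
  have h2 : \forall u \near (0 : V), X (a + u).
    by rewrite -near0E; exact: open_nbhs_nbhs.
  near=> u; split; last by near: u.
  have h : bdd k.+1 eta (fun s => djet f (a + u) s - djet f a s) by near: u.
  by move=> s sk; have := h s sk; rewrite (fa0 s)// subr0.
move=> /nbhs_norm0P[r /= r0 hr].
rewrite near0E; apply/nbhs_norm0P; exists r => // u /= ur.
have hu (t : R) : 0 <= t <= 1 -> bdd k.+1 eta (djet f (a + t *: u)) /\ X (a + t *: u).
  move=> /andP[t0 t1]; apply: hr => /=; rewrite normrZ ger0_norm//.
  by rewrite (le_lt_trans _ ur)// ler_piMl.
have -> : a + u - a = u by rewrite addrC addKr.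
move=> s sk.
suff H j : forall s, (size s + j)%N = k -> forall t : R, 0 <= t <= 1 ->
    `|djet f (a + t *: u) s| <= eta * `|u| ^+ j * pnorm s.
  have := H (k - size s)%N s (subnKC sk) 1; rewrite scale1r.
  by apply; rewrite ler01 lexx.
elim: j => {s sk}[|j IH] s sk t t01.
  rewrite expr0 mulr1; apply (hu t t01).1.
  by rewrite -sk addn0.
have sk' : (size s < k)%N by rewrite -sk -addn1 leq_add2l.
have := @mean_value_norm W (fun c => djet f (a + (c * t) *: u) s)
  (fun c => djet f (a + (c * t) *: u) (t *: u :: s)) (eta * `|u| ^+ j.+1 * pnorm s).
rewrite mul1r mul0r scale0r addr0 (fa0 s (ltnW sk')) subr0; apply.
- move=> c /andP[c0 c1] e e0; set x := a + (c * t) *: u.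
  have ct01 : 0 <= c * t <= 1.
    by case/andP: t01 => t0 t1; rewrite mulr_ge0//= mulr_ile1.
  have [[_ lJ _] dJ _] := jf x (hu _ ct01).2.
  pose C := `|t *: u| * pnorm s + 1.
  have C0 : 0 < C by rewrite ltr_wpDl// mulr_ge0// pnorm_ge0.
  have /nbhs_norm0P[d /= d0 hd] := dJ (e / C) (divr_gt0 e0 C0).
  apply/nbhs_norm0P; exists (d / (`|t *: u| + 1)).
    by rewrite /= divr_gt0// ltr_wpDl.
  move=> h /=; rewrite ltr_pdivlMr ?ltr_wpDl// => hh.
  have := hd (h *: (t *: u)); rewrite /= normrZ (le_lt_trans _ hh); last first.
    by rewrite ler_wpM2l// lerDl.
  move=> /(_ isT s sk') /=.
  have -> : a + ((c + h) * t) *: u = x + h *: (t *: u).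
    by rewrite mulrDl scalerDl addrA scalerA.
  have -> : djet f x (h *: (t *: u) :: s) = h *: djet f x (t *: u :: s).
    have := lJ h (t *: u) 0 s; have := lJ (-1) 0 0 s.
    by rewrite scaler0 addr0 scaleN1r addNr => ->; rewrite !addr0.
  move=> h1; apply: (le_trans h1).
  have -> : e / C * (`|h| * `|t *: u|) * pnorm s =
    e * `|h| * (`|t *: u| * pnorm s / C) by ring.
  rewrite ler_piMr ?mulr_ge0 ?(ltW e0)// ler_pdivrMr// mul1r /C lerDl//.
- move=> c /andP[c0 c1]; case/andP: t01 => t0 t1.
  have ct01 : 0 <= c * t <= 1 by rewrite mulr_ge0//= mulr_ile1.
  have := IH (t *: u :: s) _ _ ct01.
  rewrite /= addSnnS => /(_ sk) h; apply: (le_trans h).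
  rewrite pnorm_cons normrZ ger0_norm//.
  have -> : eta * `|u| ^+ j * (t * `|u| * pnorm s) = eta * `|u| ^+ j.+1 * pnorm s * t.
    by rewrite exprS; ring.
  by rewrite ler_piMr// !mulr_ge0 ?(ltW eta0) ?exprn_ge0 ?pnorm_ge0.
Unshelve. all: by end_near. Qed.

End taylor.

(** * Weak topologies *)

Section weak_topology.
Context {R : realType}.
Implicit Types W : preTopologicalLmodType R.

Lemma weak_functional_continuous W (phi : {linear W -> R^o}) :
  continuous phi -> continuous (phi : weak_space W -> R^o).
Proof.
move=> cphi w; pose ix := exist (fun psi : {linear W -> R^o} => continuous psi) phi cphi.
have c1 := @initial_continuous W _ (@weak_eval R W) w.
refine (@continuous_comp (weak_space W) _ R^o (@weak_eval R W) (fun g => g ix) w c1 _).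
pose I : eqType := HB.pack {psi : {linear W -> R^o} | continuous psi}
  (gen_eqMixin {psi : {linear W -> R^o} | continuous psi}).
exact: (@proj_continuous I (fun=> R^o) ix (weak_eval w)).
Qed.

Lemma ptws_cvg (I : Type) (T : topologicalType) (F : set_system {ptws I -> T})
    (f : {ptws I -> T}) : Filter F ->
  (forall i, (fun g : {ptws I -> T} => g i) @ F --> f i) -> F --> f.
Proof.
move=> FF H; apply/cvg_sup => i A /= [_ [[B Bop <-] Bf sBA]].
have : F ((fun g : {ptws I -> T} => g i) @^-1` B).
  by apply: H; exact: open_nbhs_nbhs.
by apply: filterS.
Qed.

(** Universal property of the initial topology. *)
Lemma weak_continuous (T : topologicalType) W (g : T -> weak_space W) x :
  (forall phi : {linear W -> R^o}, continuous phi ->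
     {for x, continuous (fun t => phi (g t : W) : R^o)}) ->
  {for x, continuous g}.
Proof.
move=> H A /= [_ [[B Bop <-] Bx sBA]].
have : {for x, continuous (fun t => weak_eval (g t : W))}.
  by apply: ptws_cvg => -[phi cphi]; exact: (H phi cphi).
move=> /(_ B) /= gB.
have : nbhs x (g @^-1` (@weak_eval R W @^-1` B)) by apply: gB; exact: open_nbhs_nbhs.
by apply: filterS => t; exact: sBA.
Qed.

Lemma weak_compact_bounded W (A : set W) (phi : {linear W -> R^o}) :
  compact (A : set (weak_space W)) -> continuous phi ->
  exists M, forall w, A w -> `|phi w| <= M.
Proof.
move=> cA cphi.
have : compact (phi @` A).
  apply: (@continuous_compact (weak_space W) R^o phi A) => //.
  by apply: continuous_subspaceT => w; exact: (weak_functional_continuous cphi).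
move=> /compact_bounded [M [_ MA]]; exists (M + 1) => w Aw.
by apply: (MA (M + 1)); [rewrite ltrDl|exists w].
Qed.

Lemma weak_compact_image W W' (g : {linear W -> W'}) w0 (A : set W) :
  continuous g -> compact (A : set (weak_space W)) ->
  compact ([set g w + w0 | w in A] : set (weak_space W')).
Proof.
move=> cg cA; apply: (@continuous_compact (weak_space W) (weak_space W')
  (fun w => g w + w0)) => //.
apply: continuous_subspaceT => w; apply: weak_continuous => phi cphi.
pose phig : {linear W -> R^o} := (phi \o g)%FUN.
have cphig : continuous phig by move=> z; apply: continuous_comp; [exact: cg|exact: cphi].
rewrite /prop_for /continuous_at /=.
have -> : (fun t => phi (g t + w0) : R^o) = (fun t => phig t + phi w0).
  by apply/funext => t; rewrite (raddfD phi) /phig; exact: erefl.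
rewrite (raddfD phi).
exact: (cvgD (@weak_functional_continuous W phig cphig w) (cvg_cst (phi w0 : R^o))).
Qed.

Lemma weak_compactD W (A B : set W) :
  compact (A : set (weak_space W)) -> compact (B : set (weak_space W)) ->
  compact ([set w.1 + w.2 | w in A `*` B] : set (weak_space W)).
Proof.
move=> cA cB; apply: (@continuous_compact (weak_space W * weak_space W)%type (weak_space W)
  (fun w => (w.1 : W) + w.2)); last exact: compact_setX.
apply: continuous_subspaceT => w; apply: weak_continuous => phi cphi.
rewrite /prop_for /continuous_at /=.
have -> : (fun t : weak_space W * weak_space W => phi ((t.1 : W) + t.2) : R^o) =
    (fun t => phi t.1 + phi t.2).
  by apply/funext => t; rewrite (raddfD phi).
rewrite (raddfD phi); apply: (@cvgD _ R^o).
  apply: (@continuous_comp _ (weak_space W) R^o fst phi w); first exact: cvg_fst.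
  exact: weak_functional_continuous.
apply: (@continuous_comp _ (weak_space W) R^o snd phi w); first exact: cvg_snd.
exact: weak_functional_continuous.
Qed.

Lemma weak_compact_sum W I (r : seq I) (A : I -> set W) :
  (forall i, compact (A i : set (weak_space W))) ->
  exists2 B : set W, compact (B : set (weak_space W)) &
  forall z : I -> W, (forall i, A i (z i)) -> B (\sum_(i <- r) z i).
Proof.
move=> cA; elim: r => [|i r [B cB BP]].
  exists [set 0]; first exact: (@compact_set1 (weak_space W)).
  by move=> z _; rewrite big_nil.
exists [set w.1 + w.2 | w in A i `*` B]; first exact: weak_compactD.
by move=> z Az; rewrite big_cons; exists (z i, \sum_(j <- r) z j) => //; split => //; exact: BP.
Qed.

End weak_topology.

Section weak_topology_normed.
Context {R : realType}.

Lemma dual_functional (W : normedModType R) (phi : dual W) :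
  exists psi : {linear W -> R^o}, continuous psi /\ psi = phi :> (W -> R).
Proof.
have [lphi [M Mphi]] := bopP phi.
pose psi : {linear W -> R^o} := HB.pack (bop_fun phi) (GRing.isLinear.Build _ _ _ _ _ lphi).
exists psi; split => //; apply: bounded_linear_continuous; apply/linear_boundedP.
exists M; split; first exact: num_real.
by move=> r Mr u; rewrite (le_trans (Mphi u))// ler_wpM2r// ltW.
Qed.

Lemma weak_hausdorff (W : normedModType R) : hausdorff_space (weak_space W).
Proof.
move=> u v uv; apply/eqP; rewrite -subr_eq0 -normr_eq0; apply/eqP.
have [phi [phi1 <-]] := norming_functional ((u : W) - v).
have [psi [cpsi psiE]] := dual_functional phi; rewrite -psiE raddfB.
apply/eqP; rewrite subr_eq0; apply/eqP.
have cp := weak_functional_continuous cpsi.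
apply: (@norm_hausdorff _ R^o) => A B /cp Au /cp Bv.
by have [z [Az Bz]] := uv _ _ Au Bv; exists (psi z).
Qed.

Lemma weakly_compact_norm_bounded (W : normedModType R) (A : set W) :
  compact (A : set (weak_space W)) -> exists M, forall w, A w -> `|w| <= M.
Proof.
move=> cA; apply: weakly_bounded => phi.
have [psi [cpsi <-]] := dual_functional phi.
exact: weak_compact_bounded.
Qed.

End weak_topology_normed.

(** * The topology of C^p(X, W) *)

Section Cp_space_facts.
Context {R : realType} {V W : normedModType R} {p : option nat} {X : set V} {oX : open X}.
Local Notation CpW := (Cp p oX W).
Implicit Types (f g : CpW).

Lemma Cp_fun_on f : Cp_on p X f.
Proof. by have /asboolP[] := valP f. Qed.

Lemma Cp_fun_out f x : ~ X x -> f x = 0.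
Proof. by have /asboolP[_] := valP f; apply. Qed.

Lemma Cp_fun_ext f g : (forall x, X x -> f x = g x) -> f = g.
Proof.
move=> fg; apply/val_inj/funext => x; have [/fg//|nXx] := pselect (X x).
by rewrite -[LHS]/(f x) -[RHS]/(g x) !Cp_fun_out.
Qed.

Lemma Cp_funL a f g x : (a *: f + g : CpW) x = a *: f x + g x.
Proof. by []. Qed.

Lemma Cp_funD f g x : (f + g : CpW) x = f x + g x.
Proof. by []. Qed.

Lemma Cp_of_fun (h : V -> W) : Cp_on p X h -> exists F : CpW, forall x, X x -> F x = h x.
Proof.
move=> hX; have /asboolP hP : Cp_on p X (fun x => if x \in X then h x else 0) /\
    (forall x, ~ X x -> (if x \in X then h x else 0) = 0).
  split; first by apply: Cp_on_eq hX _ => // x /mem_set ->.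
  by move=> x nXx; rewrite memNset.
by exists (MkCp oX hP) => x /mem_set /= ->.
Qed.

Lemma Cp_fun_on_le f m : Np p m -> Cp_on (Some m) X f.
Proof. by move=> pm; move: (Cp_fun_on f) => /Cp_onP; apply. Qed.

Lemma djet_CpL a f g x s : Np p (size s) -> X x ->
  djet (a *: f + g : CpW) x s = a *: djet f x s + djet g x s.
Proof.
by move=> ps Xx; apply: (djet_linear a oX (Cp_fun_on_le f ps) (Cp_fun_on_le g ps)).
Qed.

Lemma djet_CpD f g x s : Np p (size s) -> X x ->
  djet (f + g : CpW) x s = djet f x s + djet g x s.
Proof. by move=> ps Xx; rewrite -[f + g]/(f + g) -{1}[f]scale1r djet_CpL// scale1r. Qed.

Lemma djet_CpB f g x s : Np p (size s) -> X x ->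
  djet (f - g : CpW) x s = djet f x s - djet g x s.
Proof. by move=> ps Xx; rewrite addrC -scaleN1r djet_CpL// scaleN1r addrC. Qed.

Lemma djet_norm_le (h : V -> W) x s : `|djet h x s| <= `|frechetD h (size s) x| * pnorm s.
Proof. by rewrite (le_trans (symml_norm_ub _ _))// prod_nth_pnorm. Qed.

Lemma frechetD_norm_le (h : V -> W) k x c : 0 <= c ->
  (forall s, size s = k -> `|djet h x s| <= c * pnorm s) -> `|frechetD h k x| <= c.
Proof.
move=> c0 hc; apply: symml_norm_le => // v.
have key s : size s = k -> (forall j : 'I_k, nth 0 s j = v j) ->
    djet h x s = frechetD h k x v.
  move=> sk; case: k / sk v {hc} => v vE.
  by rewrite /djet; congr (frechetD h _ x _); apply/funext => j; exact: vE.
have sz : size [seq v i | i <- enum 'I_k] = k by rewrite size_map size_enum_ord.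
rewrite -(key [seq v i | i <- enum 'I_k])//; first by rewrite -pnorm_enum hc.
by move=> j; rewrite (nth_map j) ?size_enum_ord// nth_ord_enum.
Qed.

Lemma Np_le k m : (k <= m)%N -> Np p m -> Np p k.
Proof. by case: p => //= r km; exact: leq_trans. Qed.

Lemma Cp_seminorm_le K k f c : 0 <= c ->
  (forall x, K x -> bdd k.+1 c (djet f x)) -> Cp_seminorm (K, k) f <= c.
Proof.
move=> c0 fc; rewrite /Cp_seminorm /=; set A := [set _ | _ in _].
have [->|/set0P A0] := eqVneq A set0; first by rewrite sup0.
apply: ge_sup => // _ [x Kx <-]; apply/bigmax_leP; split => // j _.
apply: frechetD_norm_le => // s sj; apply: fc => //.
by rewrite sj.
Qed.

Lemma Cp_seminorm_ub K k f x s : compact K -> K `<=` X -> Np p k -> K x ->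
  (size s <= k)%N -> `|djet f x s| <= Cp_seminorm (K, k) f * pnorm s.
Proof.
move=> cK KX pk Kx sk; rewrite (le_trans (djet_norm_le _ _ _))// ler_wpM2r ?pnorm_ge0//.
have [C C0 bC] := djet_bounded_compact oX cK KX (Cp_fun_on_le f pk).
rewrite /Cp_seminorm /=; set A := [set _ | _ in _].
have ubA : has_ubound A.
  exists C => _ [z Kz <-]; apply/bigmax_leP; split => // j _.
  by apply: frechetD_norm_le => // r rj; apply: bC => //; rewrite rj.
apply: le_trans (ub_le_sup ubA _); last by exists x.
have sk' : (size s < k.+1)%N by rewrite ltnS.
exact: (le_bigmax _ (fun j : 'I_k.+1 => `|frechetD f j x|) (Ordinal sk')).
Qed.

Lemma Cp_seminorm_ge0 K k f : 0 <= Cp_seminorm (K, k) f.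
Proof.
rewrite /Cp_seminorm /=; set A := [set _ | _ in _].
have [[[_ [x Kx _]] ubA]|nsA] := pselect (has_sup A); last by rewrite sup_out.
apply: le_trans (ub_le_sup ubA _); last by exists x.
exact: bigmax_ge_id.
Qed.

Let index := (@seminorm_ball_index R (set V * nat)%type CpW).

(** A finite intersection of balls contains a single one: take the union of the
    compact sets and the largest order. *)
Lemma Cp_open_ball (O : set CpW) c : open O -> O c -> exists K k e,
  [/\ compact K, K `<=` X, Np p k, 0 < e &
      forall v : CpW, (forall x, K x -> bdd k.+1 e (djet v x)) -> O (c + v)].
Proof.
move=> [D' sD' <-] [B BD' Bc]; have [DB sDB BE] := sD' _ BD'.
have {}Bc : B c by [].
pose good (b : index) := [/\ [/\ compact b.1.2.1, b.1.2.1 `<=` X & Np p b.1.2.2],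
  0 < b.2 & Cp_seminorm b.1.2 (c - b.1.1) < b.2].
have gDB b : b \in finmap.enum_fset DB -> good b.
  move=> bDB; have [Db b0] : [set b : index | [/\ compact b.1.2.1, b.1.2.1 `<=` X &
      Np p b.1.2.2] /\ 0 < b.2] b by apply/set_mem/sDB.
  by split => //; move: Bc; rewrite -BE; apply.
suff [K [k [e [cK KX pk e0 H]]]] : exists K k e,
    [/\ compact K, K `<=` X, Np p k, 0 < e &
      forall v : CpW, (forall x, K x -> bdd k.+1 e (djet v x)) ->
      forall b : index, b \in finmap.enum_fset DB -> Cp_seminorm b.1.2 (c + v - b.1.1) < b.2].
  exists K, k, e; split => // v hv; exists B => //.
  by suff : B (c + v) by []; rewrite -BE => b bDB; exact: H.
elim: (finmap.enum_fset DB) gDB => [_|b l IH gl].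
  by exists set0, 0%N, 1; split => //; [exact: compact0|case: p].
have [|K [k [e [cK KX pk e0 H]]]] := IH.
  by move=> b' b'l; apply: gl; rewrite in_cons b'l orbT.
case: b gl => [[u [K' k']] r] gl.
have [/= [cb bX pb] b0 clt] := gl _ (mem_head _ _).
have [d d0 dlt] : exists2 d, 0 < d & Cp_seminorm (K', k') (c - u) + d < r.
  exists ((r - Cp_seminorm (K', k') (c - u)) / 2); first by rewrite divr_gt0// subr_gt0.
  by move: clt; lra.
exists (K `|` K'), (maxn k k'), (Num.min e d); split.
- exact: compactU.
- by rewrite subUset.
- by rewrite /maxn; case: ifP.
- by rewrite lt_min e0.
- move=> v hv b'; rewrite in_cons => /predU1P[->|b'l]; last first.
    apply: H => // x Kx; apply: bdd_le (hv x (or_introl Kx)).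
      by rewrite ltnS leq_maxl.
    by rewrite ge_min lexx.
  apply: le_lt_trans dlt.
  apply: Cp_seminorm_le.
    by rewrite addr_ge0 ?(ltW d0)// Cp_seminorm_ge0.
  move=> x Kx s sk; have ps : Np p (size s) by exact: Np_le pb.
  rewrite addrAC djet_CpD//; last exact: bX.
  rewrite (le_trans (ler_normD _ _))// mulrDl lerD//.
    by apply: Cp_seminorm_ub.
  apply: le_trans (hv x (or_intror Kx) s _) _.
    by rewrite ltnS (leq_trans _ (leq_maxr _ _)).
  by rewrite ler_wpM2r ?pnorm_ge0// ge_min lexx orbT.
Qed.

(** A linear map controlled by the derivatives at a single point is continuous,
    because points are compact. *)
Lemma Cp_continuous_at_point (U : normedModType R) (M : {linear CpW -> U}) y m C :
  Np p m -> X y ->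
  (forall f e, 0 <= e -> bdd m.+1 e (djet f y) -> `|M f| <= C * e) -> continuous M.
Proof.
move=> pm Xy MC f; have FF : Filter (nbhs f) := @nbhs_filter CpW f.
apply/cvgrPdist_le => e e0.
have d0 : 0 < e / (`|C| + 1) by rewrite divr_gt0// ltr_wpDl.
have cy : compact [set y] by exact: compact_set1.
have yX : [set y] `<=` X by move=> _ ->.
pose b : index := (f, ([set y], m), e / (`|C| + 1)).
pose ball_of (b : index) := [set g : CpW | Cp_seminorm b.1.2 (g - b.1.1) < b.2].
have oB : open (ball_of b).
  exists [set ball_of b]; last by rewrite bigcup_set1.
  move=> _ ->; apply: (@finI_from1 index CpW [set b : index |
    [/\ compact b.1.2.1, b.1.2.1 `<=` X & Np p b.1.2.2] /\ 0 < b.2] ball_of b).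
  by split.
have Bf : ball_of b f.
  rewrite /ball_of /= subrr (le_lt_trans _ d0)//.
  apply: Cp_seminorm_le => // x _ s sm.
  have -> : djet (0 : CpW) x s = 0 by rewrite /djet -[Cp_fun 0]/(0 : V -> W) frechetD0.
  by rewrite normr0 mul0r.
suff : nbhs f [set g : CpW | `|M f - M g| <= e] by [].
rewrite nbhsE; exists (ball_of b) => //= g; rewrite /ball_of /= => gb.
rewrite -raddfB -normrN -raddfN opprB.
have h : `|M (g - f)| <= C * Cp_seminorm ([set y], m) (g - f).
  apply: MC; first exact: Cp_seminorm_ge0.
  by move=> s sm; apply: Cp_seminorm_ub.
rewrite (le_trans h)// (@le_trans _ _ ((`|C| + 1) * (e / (`|C| + 1))))//.
  rewrite (@le_trans _ _ ((`|C| + 1) * Cp_seminorm ([set y], m) (g - f)))//.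
    by rewrite ler_wpM2r ?Cp_seminorm_ge0// (le_trans (ler_norm C))// lerDl.
  apply: ler_wpM2l; [exact: addr_ge0|exact: ltW gb].
by rewrite mulrC divfK// gt_eqF// ltr_wpDl.
Qed.

End Cp_space_facts.

(** * Second adjoints of weakly compact operators *)

Section helly.
Context {R : realType} {N : nat}.
Implicit Types (Q : set ('I_N -> R)) (a c q : 'I_N -> R).

Definition dotp a c : R := \sum_i a i * c i.

Lemma dotpC a c : dotp a c = dotp c a.
Proof. by apply: eq_bigr => i _; rewrite mulrC. Qed.

Lemma dotp_ge0 a : 0 <= dotp a a.
Proof. by apply: sumr_ge0 => i _; rewrite -expr2 sqr_ge0. Qed.

Lemma dotpBl a b c : dotp (fun i => a i - b i) c = dotp a c - dotp b c.
Proof. by rewrite -sumrB; apply: eq_bigr => i _; rewrite mulrBl. Qed.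

Lemma dotpBr a b c : dotp c (fun i => a i - b i) = dotp c a - dotp c b.
Proof. by rewrite dotpC dotpBl !(dotpC c). Qed.

(** An almost nearest point q of Q to c almost separates: the hyperplane through
    q orthogonal to c - q would have Q on one side and c strictly on the other. *)
Lemma not_separated_approx Q c B : Q !=set0 ->
  (forall q q' t, Q q -> Q q' -> 0 <= t <= 1 -> Q (fun i => q i + t * (q' i - q i))) ->
  (forall q q', Q q -> Q q' -> dotp (fun i => q' i - q i) (fun i => q' i - q i) <= B) ->
  (forall a M, (forall q, Q q -> dotp a q <= M) -> dotp a c <= M) ->
  forall e, 0 < e -> exists2 q, Q q & dotp (fun i => q i - c i) (fun i => q i - c i) < e.
Proof.
move=> [q0 Qq0] convQ bQ sepQ.
pose dist q := dotp (fun i => q i - c i) (fun i => q i - c i).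
pose D := [set dist q | q in Q].
have D0 : D !=set0 by exists (dist q0), q0.
have lbD : has_lbound D by exists 0 => _ [q _ <-]; exact: dotp_ge0.
have infD : has_inf D by split.
suff d0 : inf D <= 0.
  move=> e e0; have [_ [q Qq <-] qe] := inf_adherent e0 infD.
  by exists q => //; rewrite (lt_le_trans qe)// gerDr.
rewrite leNgt; apply/negP => d0; set d := inf D in d0.
have B0 : 0 <= B by rewrite (le_trans _ (bQ q0 q0 Qq0 Qq0))// dotp_ge0.
have B1 : 0 < 2 * B + d by rewrite ltr_wpDl// mulr_ge0.
(* Moving from q towards q' by t changes the squared distance to c by
   - 2 t <c - q, q' - q> + t^2 |q' - q|^2; this t makes the last term
   at most t d / 2. *)
have [t [t0 t1 tB]] : exists t, [/\ 0 < t, t <= 1 & t * B <= d / 2].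
  exists (d / (2 * B + d)); split.
  - by rewrite divr_gt0.
  - by rewrite ler_pdivrMr// mul1r lerDr mulr_ge0.
  - rewrite mulrAC ler_pdivrMr//.
    have : 0 <= d * d by rewrite mulr_ge0// ltW.
    by lra.
have eta0 : 0 < t * d / 2 by rewrite divr_gt0// mulr_gt0.
have [_ [q Qq <-] qd] := inf_adherent eta0 infD; rewrite -/d in qd.
pose a i := c i - q i.
have aE : dotp a a = dist q.
  by rewrite /dist /dotp; apply: eq_bigr => i _; rewrite /a; ring.
have dq : d <= dist q by apply: ge_inf => //; exists q.
have := sepQ a (dotp a q + d / 2) _; rewrite -lerBlDl -dotpBr => H.
have : dotp a a <= d / 2.
  apply: H => q' Qq'; rewrite -lerBlDl -dotpBr.
  set w := fun i => q' i - q i.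
  have Qt := convQ q q' t Qq Qq'; rewrite (ltW t0) t1 in Qt.
  have := ge_inf lbD (ex_intro2 _ _ _ (Qt isT) erefl); rewrite -/d => h.
  have E : dist (fun i => q i + t * (q' i - q i)) = dist q - 2 * t * dotp a w + t ^+ 2 * dotp w w.
    rewrite /dist /dotp mulr_sumr mulr_sumr -sumrB -big_split /=.
    by apply: eq_bigr => i _; rewrite /a /w; ring.
  rewrite E in h; have wB := bQ q q' Qq Qq'; rewrite -/w in wB.
  have : 2 * t * dotp a w <= t * d / 2 + t ^+ 2 * B.
    have : t ^+ 2 * dotp w w <= t ^+ 2 * B by rewrite ler_wpM2l// sqr_ge0.
    by lra.
  rewrite expr2 -mulrA [2 * _]mulrCA -!mulrA -mulrDr ler_pM2l//.
  by lra.
rewrite aE; lra.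
Qed.

End helly.

Section gantmacher.
Context {R : realType} {V : normedModType R} {Z : preTopologicalLmodType R}.
Variables (P : {linear V -> Z}) (C : set Z) (t0 : Z) (delta : R).
Hypothesis delta0 : 0 < delta.
Hypothesis cC : compact (C : set (weak_space Z)).
Hypothesis PC : forall v, `|v| <= delta -> C (P v + t0).

Lemma weakly_compact_functional (psi : {linear Z -> R^o}) : continuous psi ->
  exists phi : dual V, forall v, phi v = psi (P v).
Proof.
move=> cpsi; have [M MC] := weak_compact_bounded cC cpsi.
have bl : bounded_linear ((fun v => psi (P v)) : V -> R^o).
  split; first by move=> a u v; rewrite !linearP.
  exists ((M + `|psi t0|) / delta) => v.
  have [->|v0] := eqVneq v 0; first by rewrite !linear0 !normr0 mulr0.
  have nv : 0 < `|v| by rewrite normr_gt0.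
  have := MC _ (PC (v := (delta / `|v|) *: v) _).
  rewrite normrZ gtr0_norm ?divr_gt0// divfK ?gt_eqF// lexx => /(_ isT).
  rewrite raddfD /= !linearZ /= => h.
  have : `|delta / `|v| * psi (P v)| <= M + `|psi t0|.
    rewrite -[X in `|X|](addrK (psi t0)) (le_trans (ler_normB _ _))// lerD2r//.
  rewrite normrM gtr0_norm ?divr_gt0// mulrAC ler_pdivrMr// => h1.
  by rewrite mulrAC ler_pdivlMr// mulrC.
have [A AE] := bounded_linear_bop bl.
by exists A => v; rewrite AE.
Qed.

Lemma bop_sumE (V' W' : normedModType R) I (r : seq I) (a : I -> R)
    (A : I -> bop V' W') x :
  (\sum_(i <- r) a i *: A i) x = \sum_(i <- r) a i *: A i x.
Proof.
elim: r => [|i r IH]; first by rewrite !big_nil.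
by rewrite !big_cons -IH.
Qed.

(** On finitely many functionals xi, scaled down to the bidual ball, is
    approximated by a vector of the ball, since no hyperplane can separate them.
    The images of these vectors lie in the weakly compact set C, where they
    accumulate at the required point. *)
Lemma bidual_point (xi : bidual V) : exists w : Z,
  forall (psi : {linear Z -> R^o}) (phi : dual V), continuous psi ->
    (forall v, phi v = psi (P v)) -> xi phi = psi w.
Proof.
pose pairs := [set pp : {linear Z -> R^o} * dual V |
  continuous pp.1 /\ forall v, pp.2 v = pp.1 (P v)].
have [[pp0 pairs0]|np] := pselect (pairs !=set0); last first.
  by exists 0 => psi phi cpsi phiE; exfalso; apply: np; exists (psi, phi).
have N1 : 0 < bop_norm xi + 1 by rewrite ltr_wpDl// bop_norm_ge0.
(* lam xi lies in the bidual ball of radius delta. *)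
have [lam [lam0 lamN]] : exists lam, 0 < lam /\ lam * (bop_norm xi + 1) = delta.
  exists (delta / (bop_norm xi + 1)); split; first by rewrite divr_gt0.
  by rewrite divfK// gt_eqF.
have [lxi _] := bopP xi.
have xi_sum I (r : seq I) (a : I -> R) (A : I -> dual V) :
    xi (\sum_(i <- r) a i *: A i) = \sum_(i <- r) a i * xi (A i).
  elim: r => [|i r IH]; last by rewrite !big_cons -IH lxi.
  rewrite !big_nil; have := lxi (-1) 0 0.
  by rewrite scaler0 addr0 scaleN1r addNr.
pose small (l : seq ({linear Z -> R^o} * dual V)) (e : R) := [set z : Z | exists v,
  [/\ `|v| <= delta, z = P v + t0 &
   forall i, (i < size l)%N -> `|(nth pp0 l i).1 (P v) - lam * xi (nth pp0 l i).2| <= e]].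
have small0 l e : (forall i, (i < size l)%N -> pairs (nth pp0 l i)) -> 0 < e ->
    small l e !=set0.
  move=> lP e0; pose phi (i : 'I_(size l)) : dual V := (nth pp0 l i).2.
  have lphi i a u v : phi i (a *: u + v) = a * phi i u + phi i v.
    by have [H _] := bopP (phi i); exact: H.
  have phiB i u v : phi i (u - v) = phi i u - phi i v.
    by rewrite [u - v]addrC -scaleN1r lphi mulN1r addrC.
  pose Q := [set (fun i => phi i v : R) | v in [set v : V | `|v| <= delta]].
  pose B := \sum_i (bop_norm (phi i) * (delta + delta)) ^+ 2.
  have [_ [v vd <-] vc] : exists2 q, Q q &
      dotp (fun i => q i - lam * xi (phi i)) (fun i => q i - lam * xi (phi i)) < e ^+ 2.
    apply: (@not_separated_approx R (size l) Q _ B); last by rewrite exprn_gt0.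
    - by exists (fun i => phi i 0), 0 => //=; rewrite normr0 ltW.
    - move=> _ _ t [v /= vd <-] [v' /= vd' <-] /andP[t0' t1].
      exists (t *: (v' - v) + v).
        rewrite /= scalerBr -addrA addrC -{2}[v]scale1r -scaleNr -scalerDl addrC.
        rewrite (le_trans (ler_normD _ _))// !normrZ ger0_norm//.
        rewrite (@ger0_norm _ (- t + 1)); last by rewrite addrC subr_ge0.
        have := ler_wpM2l t0' vd'.
        have : 0 <= - t + 1 by rewrite addrC subr_ge0.
        by move=> /ler_wpM2l/(_ _ _ vd); lra.
      apply/funext => i /=; rewrite lphi addrC; congr (_ + _ * _).
      exact: phiB.
    - move=> _ _ [v /= vd <-] [v' /= vd' <-]; apply: ler_sum => i _.
      rewrite -expr2 -[X in X ^+ 2]/(phi i v' - phi i v).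
      rewrite -phiB.
      rewrite -[leLHS]ger0_norm ?sqr_ge0// normrX.
      apply: lerXn2r; rewrite ?nnegrE ?mulr_ge0 ?addr_ge0 ?(ltW delta0) ?bop_norm_ge0//.
      rewrite (le_trans (bop_norm_le _ _))// ler_wpM2l ?bop_norm_ge0//.
      by rewrite (le_trans (ler_normB _ _))// lerD.
    - move=> a M aM; pose Phi : dual V := \sum_i a i *: phi i.
      have PhiE v : Phi v = dotp a (fun i => phi i v) by exact: bop_sumE.
      have PhiM : bop_norm Phi <= M / delta.
        apply: sup_norm_le; first exact: unit_ball_neq0.
        move=> x x1; rewrite ler_pdivlMr// -[X in _ * X]gtr0_norm// -normrM.
        have h (s : R) : `|s| <= delta -> s * Phi x <= M.
          move=> sd; rewrite -[s * _]/(s *: (Phi x : R^o)) -bop_linearZ PhiE; apply: aM.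
          by exists (s *: x) => //=; rewrite normrZ -[leRHS]mulr1 ler_pM.
        rewrite ler_norml mulrC h ?gtr0_norm// andbT lerNl -mulNr h//.
        by rewrite normrN gtr0_norm.
      have -> : dotp a (fun i => lam * xi (phi i)) = lam * xi Phi.
        rewrite /Phi xi_sum /dotp mulr_sumr; apply: eq_bigr => i _; exact: mulrCA.
      rewrite (le_trans (ler_norm _))// normrM gtr0_norm//.
      apply: le_trans (_ : lam * (bop_norm xi * bop_norm Phi) <= _).
        by rewrite ler_wpM2l ?(ltW lam0)//; exact: (bop_norm_le xi Phi).
      move: PhiM; rewrite ler_pdivlMr// => PhiM; apply: le_trans PhiM.
      rewrite mulrA [leRHS]mulrC -lamN ler_wpM2r ?bop_norm_ge0//.
      by rewrite ler_wpM2l ?(ltW lam0)// lerDl.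
  exists (P v + t0), v; split => // i il; have [_ E] := lP i il.
  rewrite -E -(@ler_pXn2r _ 2)// ?nnegrE ?(ltW e0)//.
  apply: le_trans (ltW vc); rewrite real_normK ?num_real//.
  rewrite /dotp (bigD1 (Ordinal il))//= expr2 lerDl sumr_ge0// => j _.
  by rewrite -expr2 sqr_ge0.
pose dom := [set le : seq ({linear Z -> R^o} * dual V) * R |
  (forall i, (i < size le.1)%N -> pairs (nth pp0 le.1 i)) /\ 0 < le.2].
pose F : set_system (weak_space Z) := filter_from dom (fun le => small le.1 le.2).
have FF : ProperFilter F.
  apply: filter_from_proper; last by move=> [l e] [lP e0]; exact: small0.
  apply: filter_from_filter; first by exists ([::], 1); split.
  move=> [l e] [l' e'] [lP e0] [lP' e0']; exists (l ++ l', Num.min e e').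
    split; last by rewrite /= lt_min; apply/andP.
    move=> i; rewrite /= size_cat nth_cat => il; case: ltnP => h; first exact: lP.
    by apply: lP'; rewrite ltn_subLR.
  move=> z [v [vd zE H]]; split; exists v; split => // i il.
    have := H i; rewrite size_cat nth_cat il => /(_ (ltn_addr _ il)) /le_trans; apply.
    by rewrite ge_min lexx.
  have := H (size l + i)%N; rewrite size_cat nth_cat ltn_add2l [(size l + i < size l)%N]ltnNge
    leq_addr addKn /=.
  by move=> /(_ il) /le_trans; apply; rewrite ge_min lexx orbT.
have FC : F C.
  exists ([::], 1); first by split.
  by move=> z [v [vd -> _]]; exact: PC.
have [w [Cw clw]] := cC FF FC.
exists (lam^-1 *: (w - t0)) => psi phi cpsi phiE.
rewrite linearZ /= raddfB /= -[LHS](mulKf (lt0r_neq0 lam0)); congr (_ * _).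
apply/eqP; rewrite -subr_eq0 -normr_le0; apply/ler_addgt0Pr => e e0.
have e20 : 0 < e / 2 by rewrite divr_gt0.
have Fs : F (small [:: (psi, phi)] (e / 2)).
  exists ([:: (psi, phi)], e / 2) => //; split => //.
  by case=> // _; split.
have cw : \forall z \near (w : weak_space Z), `|psi w - psi z| <= e / 2.
  have /cvgr_dist_le/(_ _ e20) h := @weak_functional_continuous _ Z psi cpsi w.
  exact: h.
have [z [[v [vd zE /(_ 0%N isT)]]]] := clw _ _ Fs cw.
rewrite /= zE raddfD /= => h1 h2.
rewrite add0r (splitr e) distrC.
have -> : psi w - psi t0 - lam * xi phi =
  (psi w - (psi (P v) + psi t0)) + (psi (P v) - lam * xi phi) by ring.
by rewrite (le_trans (ler_normD _ _))// lerD.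
Qed.

End gantmacher.

(** * Support points of separating maps *)

Lemma dist_continuous {R : realType} {V : normedModType R} (a : V) :
  continuous (fun z : V => `|z - a|).
Proof.
move=> z; apply/cvgrPdist_le => e e0.
have /cvgrPdist_le/(_ e e0) h : (fun w : V => w) @ z --> z by exact: cvg_id.
apply: filterS h => w; apply: le_trans.
by rewrite (le_trans (ler_dist_dist _ _))// opprB addrA subrK.
Qed.

Section separating_functional.
Context {R : realType} {n : nat} {E F : normedModType R} {p : option nat}.
Context {X : set 'rV[R]_n} {oX : open X}.
Local Notation V := 'rV[R]_n.
Local Notation CpX := (Cp p oX E).
Implicit Types (f g : CpX).

Definition Cp_mul (chi : V -> R^o) f : CpX :=
  xget 0 [set g : CpX | forall x, g x = chi x *: f x].

Lemma Cp_mulE chi f x : Cp_on p setT chi -> Cp_mul chi f x = chi x *: f x.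
Proof.
move=> chiC; have [g gE] : exists g : CpX, forall x, g x = chi x *: f x.
  have [g gE] := @Cp_of_fun _ _ _ _ _ oX _ (Cp_on_mul oX (Cp_on_sub openT oX (@subsetT _ _) chiC) (Cp_fun_on f)).
  exists g => z; have [/gE//|nXz] := pselect (X z).
  by rewrite !Cp_fun_out// scaler0.
exact: (@xgetI _ 0 [set g : CpX | forall x, g x = chi x *: f x] g gE x).
Qed.

Variables (A : {linear CpX -> F}) (K : set V) (k : nat) (e0 C : R).
Hypotheses (cK : compact K) (KX : K `<=` X) (pk : Np p k) (e0_gt0 : 0 < e0).
Hypothesis AC : forall v : CpX, (forall x, K x -> bdd k.+1 e0 (djet v x)) -> `|A v| <= C.
Hypothesis sepA : forall f g,
  (forall x, X x -> f x = 0 \/ g x = 0) -> A f = 0 \/ A g = 0.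
Hypothesis A0 : exists f, A f != 0.

(** Scaling: what is bounded on a ball of jets vanishes on what can be made
    arbitrarily small. *)
Lemma small_jets_eq0 f : (forall d, 0 < d -> exists g : CpX, A g = A f /\
  forall x, K x -> bdd k.+1 d (djet g x)) -> A f = 0.
Proof.
move=> H; apply/eqP; rewrite -normr_le0; apply: (@le_eps _ _ _ `|C|) => // e e_gt0.
have d0 : 0 < e * e0 by rewrite mulr_gt0.
have [g [<- bg]] := H _ d0.
have h : `|A (e^-1 *: g)| <= C.
  apply: AC => x Kx s sk; have ps : Np p (size s) by exact: Np_le pk.
  have -> : djet (e^-1 *: g) x s = e^-1 *: djet g x s.
    have := djet_CpL e^-1 g 0 ps (KX Kx); rewrite !addr0 => ->.
    by rewrite [djet (Cp_fun 0)]/djet -[Cp_fun 0]/(0 : V -> E) frechetD0 addr0.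
  rewrite normrZ gtr0_norm ?invr_gt0// ler_pdivrMl// mulrA.
  exact: bg.
move: h; rewrite linearZ /= normrZ gtr0_norm ?invr_gt0// ler_pdivrMl// add0r => h.
by rewrite (le_trans h)// ler_pM2l// ler_norm.
Qed.

Lemma zero_jets_eq0 f : (forall x s, K x -> (size s <= k)%N -> djet f x s = 0) ->
  A f = 0.
Proof.
move=> f0; apply: small_jets_eq0 => d d0; exists f; split => // x Kx s sk.
by rewrite f0// normr0 mulr_ge0 ?pnorm_ge0// ltW.
Qed.

Lemma vanishing_djet f (O : set V) x s : open O -> O x -> X x ->
  (forall z, O z -> f z = 0) -> djet f x s = 0.
Proof.
move=> oO Ox Xx f0; rewrite (@djet_eq _ _ _ (size s) O (fun=> 0))//.
  by rewrite djet_cst; case: s.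
exact: Cp_on_cst.
Qed.

(** The sets near which some chi vanishes with A (chi f) = A f for all f form an
    ideal; if every point of the compact set K had a neighbourhood in it, then so
    would K have, and A would be zero. *)
Lemma support_point_exists : exists2 a, K a & forall N, nbhs a N ->
  exists2 f : CpX, (forall x, ~ N x -> f x = 0) & A f != 0.
Proof.
apply: contrapT => noa.
have {}noa a : K a -> exists2 N, nbhs a N &
    forall f : CpX, (forall x, ~ N x -> f x = 0) -> A f = 0.
  move=> Ka; apply: contrapT => H; apply: noa; exists a => // N aN.
  apply: contrapT => H2; apply: H; exists N => // f fN.
  by apply/eqP; apply: contrapT => /negP Af; apply: H2; exists f.
pose ideal (S : set V) := exists2 chi : V -> R^o, Cp_on p setT chi &
  (forall f : CpX, A (Cp_mul chi f) = A f) /\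
  exists O, [/\ open O, S `<=` O & forall x, O x -> chi x = 0].
have idealS S S' : S `<=` S' -> ideal S' -> ideal S.
  move=> SS' [chi chiC [Achi [ O [ oO SO chi0]]]]; exists chi => //; split => //.
  by exists O; split => //; exact: subset_trans SO.
have idealU S S' : ideal S -> ideal S' -> ideal (S `|` S').
  move=> [chi chiC [Achi [ O [ oO SO chi0]]]] [chi' chiC' [Achi' [ O' [ oO' SO' chi0']]]].
  have mC := Cp_on_mul openT chiC chiC'.
  exists (fun x => chi x *: chi' x) => //; split.
    move=> f; rewrite -[RHS]Achi' -[RHS]Achi; congr (A _).
    apply: Cp_fun_ext => x _; rewrite !Cp_mulE//.
    by rewrite scalerA.
  exists (O `|` O'); split; [exact: openU|exact: setUSS|].
  move=> x [/chi0 ->|/chi0' ->]; first by rewrite scale0r.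
  by rewrite scaler0.
have ideal0 : ideal set0.
  exists (fun=> 1); first exact: Cp_on_cst openT.
  split; last by exists set0; split => //; exact: open0.
  move=> f; congr (A _); apply: Cp_fun_ext => x _; rewrite Cp_mulE ?scale1r//.
  exact: Cp_on_cst openT.
have nidealK : ~ ideal K.
  move=> [chi chiC [Achi [ O [ oO KO chi0]]]]; have [f /eqP[]] := A0.
  rewrite -Achi; apply: zero_jets_eq0 => x s Kx sk.
  apply: (@vanishing_djet _ O) => //; [exact: KO|exact: KX|].
  by move=> z /chi0 z0; rewrite Cp_mulE// z0 scale0r.
(* If K is not in the ideal, the complements in K of members of the ideal form
   a filter, whose cluster point in K contradicts noa. *)
pose G : set_system V := [set S | ideal (K `\` S)].
have GG : ProperFilter G.
  apply: Build_ProperFilter_ex.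
    move=> S GS; apply: contrapT => nS; apply: nidealK; apply: idealS GS.
    by move=> x Kx; split => // Sx; apply: nS; exists x.
  split.
  - by rewrite /G /= setDT.
  - by move=> S S' GS GS'; rewrite /G /= setDIr; exact: idealU.
  - move=> S S' SS'; rewrite /G /=; apply: idealS => x [Kx nS'x]; split => // Sx.
    by apply: nS'x; exact: SS'.
have GK : G K by rewrite /G /= setDv.
have [a [Ka cla]] := cK GG GK.
have [N aN AN] := noa a Ka.
have [C0 _ cut] := @cutoff R n 0.
have [r r0 rN] : exists2 r : R, 0 < r & forall x, `|x - a| < r -> N x.
  have /nbhs_norm0P[r /= r0 hr] : \forall u \near (0 : V), N (a + u) by rewrite -near0E.
  by exists r => // x xa; rewrite -(subrKC a x); exact: hr.
have [phi [phiC phi1 phi0 _]] := cut a (r / 2) (divr_gt0 r0 (ltr0Sn _ 1)).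
have : nbhs a [set x | phi x = 1] by exact: phi1.
rewrite nbhsE => -[ O [ oO Oa] O1 ].
have chiC : Cp_on p setT (fun x => 1 - phi x).
  apply: Cp_on_eq (Cp_onD openT (Cp_on_cst p (1 : R^o) openT)
    (Cp_on_mul openT (Cp_on_cst p (- 1 : R^o) openT) (phiC p))) _; first exact: openT.
  by move=> x _; rewrite scaleN1r.
have idO : ideal O.
  exists (fun x => 1 - phi x) => //; split; last first.
    by exists O; split => // x /O1 /= ->; rewrite subrr.
  move=> f; have -> : Cp_mul (fun x => 1 - phi x) f = (-1) *: Cp_mul phi f + f.
    apply: Cp_fun_ext => x _; rewrite Cp_funL !Cp_mulE//.
    by rewrite scalerBl scale1r scaleN1r addrC.
  rewrite linearP /= AN ?scaler0 ?add0r// => x nNx; rewrite Cp_mulE// phi0 ?scale0r//.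
  by rewrite mulrC divfK// leNgt; apply/negP => /rN.
have [] := cla (~` O) O _ (open_nbhs_nbhs (conj oO Oa)).
  by rewrite /G /=; apply: idealS idO => x [_]; rewrite /setC /= notK.
by move=> x [].
Qed.

Variable a : V.
Hypothesis Ka : K a.
Hypothesis aA : forall N, nbhs a N ->
  exists2 f : CpX, (forall x, ~ N x -> f x = 0) & A f != 0.

Lemma vanishing_near_eq0 f : (\forall x \near a, f x = 0) -> A f = 0.
Proof.
move=> f0; have [g g0 Ag] := aA f0.
have [//|Ag0] : A f = 0 \/ A g = 0.
  apply: sepA => x _; have [fx|fx] := pselect (f x = 0); [by left|right].
  by apply: g0.
by rewrite Ag0 eqxx in Ag.
Qed.

(** Cutting f off at radius e does not change A f and makes its derivatives up
    to order k small everywhere: those of order i of the cutoff are O(e^-i), while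
    those of f are o(e^(k-i)) on its support. *)
Lemma flat_eq0 f : (forall s, (size s <= k)%N -> djet f a s = 0) -> A f = 0.
Proof.
move=> fa0; apply: small_jets_eq0 => d d0.
have [D D0 cut] := @cutoff R n k.
have fk := Cp_fun_on_le f pk.
pose M := 4 ^+ k * (D + 1); have M0 : 0 < M by rewrite mulr_gt0 ?exprn_gt0// ltr_wpDl.
have eta0 : 0 < d / M by rewrite divr_gt0.
have := taylor_small oX fk (KX Ka) fa0 eta0; set eta := d / M in eta0 *.
rewrite near0E => /nbhs_norm0P[r /= r0 hr].
(* The support of the cutoff, of radius 2 e, stays where the remainder estimate holds. *)
pose e := Num.min 1 (r / 4).
have e_gt0 : 0 < e by rewrite lt_min ltr01 divr_gt0.
have e1 : e <= 1 by rewrite ge_min lexx.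
have er : 2 * e < r.
  have : e <= r / 4 by rewrite ge_min lexx orbT.
  by lra.
have [phi [phiC phi1 phi0 phib]] := cut a e e_gt0.
exists (Cp_mul phi f); split.
  apply/eqP; rewrite eq_sym -subr_eq0 -raddfB /=; apply/eqP/vanishing_near_eq0.
  apply: filterS phi1 => x phix; rewrite -[LHS]/(f x - Cp_mul phi f x) Cp_mulE//.
  by rewrite phix scale1r subrr.
move=> x Kx s sk; rewrite ltnS in sk.
have [xe|xe] := ltP (2 * e) `|x - a|.
  have oO : open [set z : V | 2 * e < `|z - a|].
    by apply: open_comp (@open_gt _ (2 * e)) => z _; exact: dist_continuous.
  rewrite (@vanishing_djet _ [set z : V | 2 * e < `|z - a|])//.
  - by rewrite normr0 mulr_ge0 ?pnorm_ge0// ltW.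
  - exact: KX.
  - by move=> z /= /ltW ze; rewrite Cp_mulE// phi0// scale0r.
have phik : Cp_on (Some k) X phi by apply: Cp_on_sub openT oX (@subsetT _ _) _.
have -> : djet (Cp_mul phi f) x s = leib (djet phi x) (djet f x) s.
  rewrite -(djet_mul oX phik fk (KX Kx) sk).
  apply: (@djet_eq _ _ _ k X) => //; [exact: Cp_on_mul|by move=> z _; rewrite Cp_mulE|exact: KX].
have e0' : 0 <= e^-1 by rewrite invr_ge0 ltW.
have bD : 0 <= D + 1 by rewrite addr_ge0.
have be : 0 <= eta * (2 * e) ^+ k.
  by rewrite mulr_ge0 ?(ltW eta0)// exprn_ge0// mulr_ge0// ltW.
apply: le_trans (@leib_norm_graded _ _ _ k.+1 (D + 1) (eta * (2 * e) ^+ k) e^-1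
  (djet phi x) (djet f x) s bD be e0' _ _ _) _ => //.
- move=> t tk; rewrite (le_trans (phib x t _))// ler_wpM2r ?pnorm_ge0//.
  by rewrite ler_wpM2r ?exprn_ge0// lerDl.
- move=> t tk; rewrite ltnS in tk.
  have := hr (x - a); rewrite /= (le_lt_trans xe er) => /(_ isT).
  rewrite addrCA subrr addr0 => /(_ t tk) h; apply: (le_trans h).
  rewrite ler_wpM2r ?pnorm_ge0// -mulrA ler_wpM2l ?(ltW eta0)//.
  apply: le_trans (_ : (2 * e) ^+ (k - size t) <= _).
    by apply: lerXn2r; rewrite ?nnegrE ?mulr_ge0 ?(ltW e_gt0).
  rewrite -[in leRHS](subnK tk) exprD -mulrA ler_peMr ?exprn_ge0 ?mulr_ge0 ?(ltW e_gt0)//.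
  by rewrite -exprMn mulfK ?gt_eqF// exprn_ege1// ler1n.
rewrite ler_wpM2r ?pnorm_ge0//.
have -> : d = eta * M by rewrite /eta divfK// gt_eqF.
have -> : (2 / e) ^+ size s * ((D + 1) * (eta * (2 * e) ^+ k)) =
  eta * ((2 * e) ^+ k * (2 / e) ^+ size s * (D + 1)) by ring.
rewrite /M ler_wpM2l ?(ltW eta0)// ler_wpM2r//.
rewrite -(subnK sk) exprD -mulrA -exprMn.
have -> : 2 * e * (2 / e) = 4 by field; rewrite gt_eqF.
rewrite exprD ler_wpM2r ?exprn_ge0//.
apply: lerXn2r; rewrite ?nnegrE ?mulr_ge0 ?(ltW e_gt0)//.
by move: e1; lra.
Qed.

Lemma eq_jets_eq f g : (forall s, (size s <= k)%N -> djet f a s = djet g a s) ->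
  A f = A g.
Proof.
move=> fg; apply/eqP; rewrite -subr_eq0 -raddfB /=; apply/eqP/flat_eq0 => s sk.
rewrite djet_CpB ?fg ?subrr//; last exact: KX.
exact: Np_le pk.
Qed.

End separating_functional.

(** * Identification of the support map *)

Section support_map_identification.
Context {R : realType} {n : nat} {E F H : normedModType R} {p q : option nat}.
Context {X : set 'rV[R]_n} {Y : set H} {oX : open X} {oY : open Y}.
Local Notation V := 'rV[R]_n.
Variables (T : Cp p oX E -> Cp q oY F) (y : H) (a : V).
Hypotheses (Xa : X a) (T0 : forall f : Cp p oX E, (\forall x \near a, f x = 0) -> T f y = 0).
Hypothesis TN : forall N, nbhs a N ->
  exists2 f : Cp p oX E, (forall x, ~ N x -> f x = 0) & T f y != 0.

Local Notation embed := (@opc_embed R V p X oX).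

Lemma opc_hausdorff : hausdorff_space (one_point_compactification R^o).
Proof.
apply: one_point_compactification_hausdorff.
  exact: locally_compactR.
exact: norm_hausdorff.
Qed.

Lemma opc_embed_continuous : {for a, continuous (embed : V -> _)}.
Proof.
have FF : Filter (embed x @[x --> a]) by apply: fmap_filter; exact: nbhs_filter.
apply: ptws_cvg => psi.
have c1 : {for a, continuous (Cp_fun psi)} := Cp_on_continuous oX (Cp_fun_on psi) Xa.
have c2 := @one_point_compactification_some_continuous R^o (psi a).
exact: (continuous_comp c1 c2).
Qed.

Lemma opc_embed_inj x : X x -> embed x = embed a -> x = a.
Proof.
move=> Xx xa; apply/rowP => i.
have [psi psiE] := @Cp_of_fun _ _ _ p X oX _ (Cp_on_coord p i oX).
have /Some_inj : embed x psi = embed a psi by rewrite xa.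
by rewrite !psiE// !ord1.
Qed.

Lemma opc_closure_embed : (@opc_closure R V p X oX) (embed a).
Proof. by apply: subset_closure; exists a. Qed.

(** A point w other than a of the closure is separated from a by some psi; a
    closed neighbourhood of psi(a) gives a neighbourhood of a and, by hypothesis, a
    function supported there on which T does not vanish at y, so that w is
    excluded from the support set. *)
Lemma support_set_eq : support_set T y = [set embed a].
Proof.
apply/seteqP; split; last first.
  move=> _ -> U [[ O oO ->] [f Tf sfU]]; split; first exact: opc_closure_embed.
  apply/subset_closure/sfU; split; first exact: opc_closure_embed.
  move=> B aB; apply: contrapT => nB.
  have : T f y = 0.
    have h : nbhs a [set x | B (embed x)] by exact: opc_embed_continuous.
    apply: T0; apply: filterS h => x Bx.
    apply: contrapT => fx; apply: nB; exists (embed x); split => //.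
    exists x => //; split; last exact/eqP.
    by apply: contrapT => nX; apply: fx; rewrite Cp_fun_out.
  by move/eqP; rewrite (negbTE Tf).
move=> w wT; apply: contrapT => wa.
have [psi /eqP psiw] : exists psi, w psi <> embed a psi.
  by apply: contrapT => H0; apply: wa; apply/funext => psi; apply: contrapT => H1; apply: H0; exists psi.
have := opc_hausdorff; rewrite open_hausdorff => /(_ _ _ psiw).
move=> [[N2 N1] /= [/set_mem wN2 /set_mem aN1] [oN2 oN1 N12]].
have : nbhs (psi a : R^o) (Some @^-1` N1).
  exact: (@one_point_compactification_some_continuous R^o (psi a) N1
    (open_nbhs_nbhs (conj oN1 aN1))).
move=> /nbhs_normP[e /= e0 eN1].
have e20 : 0 < e / 2 by rewrite divr_gt0.
(* A closed ball inside N1, so that closures of sets of values stay in N1. *)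
pose Ke : set R^o := [set t | `|psi a - t| <= e / 2].
have KeN1 : Some @` Ke `<=` N1.
  move=> _ [t tK <-]; apply: eN1 => /=; apply: le_lt_trans tK _.
  by rewrite ltr_pdivrMr// mulr2n mulrDr mulr1 ltrDl.
have cKe : closed (Some @` Ke : set (one_point_compactification R^o)).
  apply: compact_closed; first exact: opc_hausdorff.
  apply: continuous_compact.
    apply: continuous_subspaceT => t.
    exact: (@one_point_compactification_some_continuous R^o t).
  have -> : Ke = `[psi a - e / 2, psi a + e / 2]%classic.
    by apply/seteqP; split => t; rewrite /Ke /= in_itv /= ler_distlC.
  exact: segment_compact.
have aN : nbhs a [set x | Ke (psi x)].
  have := Cp_on_continuous oX (Cp_fun_on psi) Xa.
  by move=> /cvgr_dist_le/(_ _ e20); exact.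
have [f fN Tf] := TN aN.
have proj_cont B : closed B -> closed [set w' : @opc_product R V p X oX | B (w' psi)].
  move=> cB; apply: (@closed_comp _ _ (fun w' : @opc_product R V p X oX => w' psi)) => //.
  by move=> w' _; exact: (@proj_continuous _ (fun=> one_point_compactification R^o) psi w').
have proj_open B : open B -> open [set w' : @opc_product R V p X oX | B (w' psi)].
  move=> oB; apply: (@open_comp _ _ (fun w' : @opc_product R V p X oX => w' psi)) => //.
  by move=> w' _; exact: (@proj_continuous _ (fun=> one_point_compactification R^o) psi w').
pose U := (@opc_closure R V p X oX) `&` [set w' : @opc_product R V p X oX | N1 (w' psi)].
have UT : support_family T y U.
  split; first by exists [set w' : @opc_product R V p X oX | N1 (w' psi)] => //; exact: proj_open.
  exists f => // w' [w'A w'f]; split => //; apply: KeN1.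
  have := proj_cont _ cKe; apply=> B /w'f [_ [[x [Xx fx] <-] Bx]].
  exists (embed x); split => //; exists (psi x) => //.
  apply: contrapT => nK; move/eqP: fx; apply; exact: fN.
have [_ /(_ [set w' : @opc_product R V p X oX | N2 (w' psi)])[]] := wT _ UT.
  by apply: open_nbhs_nbhs; split => //; exact: proj_open.
move=> w' [[_ w'1] w'2].
have : (N2 `&` N1) (w' psi) by split.
by rewrite (eqP N12).
Qed.

Lemma support_map_eq : support_map T y = a.
Proof.
have P : [set x | X x /\ support_set T y = [set embed x]] a.
  by split => //; exact: support_set_eq.
have [Xx] := @xgetI _ 0 [set x | X x /\ support_set T y = [set embed x]] a P.
rewrite -/(support_map T y) support_set_eq => e.
have : [set embed (support_map T y)] (embed a) by rewrite -e.
by move=> /esym; exact: opc_embed_inj.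
Qed.

End support_map_identification.

(** * Homogeneous polynomials *)

Section homogeneous_polynomials.
Context {R : realType} {n : nat}.
Local Notation V := 'rV[R]_n.

(** Indices of the terms in the expansion of a product of j factors x_l - a_l:
    for each factor a coordinate l, and true for the term x_l or false for - a_l. *)
Fixpoint expansion j : finType :=
  if j is j'.+1 then ('I_n * expansion j' * bool)%type else unit.

Fixpoint coef_at j : expansion j -> V -> R^o :=
  match j with
  | 0 => fun _ _ => 1
  | j'.+1 => fun b a =>
      (if b.2 then 1 else - a 0 b.1.1 : R) * (coef_at b.1.2 a : R)
  end.

Fixpoint monomial_at j : expansion j -> V -> R^o :=
  match j with
  | 0 => fun _ _ => 1
  | j'.+1 => fun b x =>
      (if b.2 then x 0 b.1.1 else 1 : R) * (monomial_at b.1.2 x : R)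
  end.

Fixpoint directions j : expansion j -> seq V :=
  match j with
  | 0 => fun _ => [::]
  | j'.+1 => fun b => delta_mx 0 b.1.1 :: directions b.1.2
  end.

Lemma size_directions j (b : expansion j) : size (directions b) = j.
Proof. by elim: j b => //= j IH b; rewrite IH. Qed.

Lemma Cp_on_coef_at {H : normedModType R} p (U : set H) (h : H -> V) j (b : expansion j) :
  open U -> (forall l, Cp_on p U (fun y => h y 0 l : R^o)) ->
  Cp_on p U (fun y => coef_at b (h y)).
Proof.
move=> oU hU; elim: j b => [b|j IH b] /=; first exact: Cp_on_cst oU.
apply: (Cp_on_mul oU _ (IH _)); case: (b.2); first exact: Cp_on_cst oU.
apply: (Cp_on_eq oU (Cp_on_mul oU (Cp_on_cst p (-1 : R^o) oU) (hU b.1.1))).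
by move=> x _; rewrite scaleN1r.
Qed.

Lemma Cp_on_monomial_at p j (b : expansion j) : Cp_on p setT (monomial_at b).
Proof.
elim: j b => [b|j IH b] /=; first exact: Cp_on_cst openT.
apply: Cp_on_mul openT _ (IH _); case: (b.2); last exact: Cp_on_cst openT.
exact: Cp_on_coord openT.
Qed.

Context {E : normedModType R}.
Implicit Types (B : seq V -> E).

Lemma head_linear_sum B s (x : V) : head_linear B ->
  B (x :: s) = \sum_l x 0 l *: B (delta_mx 0 l :: s).
Proof.
move=> lB; have B0 : B (0 :: s) = 0.
  by have := lB (-1) 0 0 s; rewrite scaler0 addr0 scaleN1r addNr.
have sumB I (r : seq I) (c : I -> R) (v : I -> V) :
    B (\sum_(i <- r) c i *: v i :: s) = \sum_(i <- r) c i *: B (v i :: s).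
  elim: r => [|i r IH]; first by rewrite !big_nil.
  by rewrite !big_cons lB IH.
by rewrite {1}(row_sum_delta x) sumB.
Qed.

(** Separates the variable x from the base point a in the polynomial
    x |-> B (x - a, ..., x - a). *)
Lemma power_expansion j B x a : symjet B -> B (nseq j (x - a)) =
  \sum_(b : expansion j) (coef_at b a * monomial_at b x) *: B (directions b).
Proof.
elim: j B => [|j IH] B sB.
  by rewrite (big_pred1 tt) /= ?mulr1 ?scale1r// => -[].
have [_ lB _] := sB; rewrite /= head_linear_sum//.
rewrite -(pair_bigA _ (fun lb c => (coef_at ((lb, c) : expansion j.+1) a *
  monomial_at ((lb, c) : expansion j.+1) x) *: B (directions ((lb, c) : expansion j.+1)))) /=.
rewrite -(pair_bigA _ (fun l b => \sum_c (coef_at ((l, b, c) : expansion j.+1) a *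
  monomial_at ((l, b, c) : expansion j.+1) x) *: B (directions ((l, b, c) : expansion j.+1)))) /=.
apply: eq_bigr => l _; rewrite (IH (fun s => B (delta_mx 0 l :: s)) (symjet_cons _ sB)).
rewrite scaler_sumr; apply: eq_bigr => b _.
rewrite big_bool /= scalerA -scalerDl; congr (_ *: _).
by rewrite !mxE; ring.
Qed.

Lemma Cp_on_power p j B a : symjet B -> Cp_on p setT (fun x => B (nseq j (x - a))).
Proof.
move=> sB; apply: Cp_on_eq (_ : Cp_on p setT (fun x => \sum_(b : expansion j)
    (coef_at b a * monomial_at b x : R^o) *: B (directions b))) _.
- exact: openT.
- apply: Cp_on_sum openT _ => b _.
  apply: Cp_on_mul openT _ (Cp_on_cst _ _ openT).
  exact: Cp_on_mul openT (Cp_on_cst _ (coef_at b a) openT) (Cp_on_monomial_at p b).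
- by move=> x _; exact: power_expansion.
Qed.

Definition linear_jet (l : 'I_n) (s : seq V) : R^o :=
  if s is [:: v] then v 0 l else 0.

Lemma djet_coord_sub l (a : V) s :
  djet ((fun x : V => x 0 l - a 0 l) : V -> R^o) a s = linear_jet l s.
Proof.
have E1 : Cp_on (Some (size s)) setT (fun x : V => x 0 l : R^o) by exact: Cp_on_coord openT.
have E2 := Cp_on_cst (Some (size s)) (- a 0 l : R^o) (@openT V).
rewrite (@djet_eq _ _ _ (size s) setT (1 *: (fun x : V => x 0 l : R^o) + (fun=> - a 0 l))) //.
- rewrite (djet_linear 1 openT E1 E2)// djet_bounded_linear ?djet_cst; last exact: coord_bounded_linear.
  by case: s {E1 E2} => [|v [|]]; rewrite scale1r ?addr0//= subrr.
- exact: (@openT V).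
- exact: Cp_on_linear (@openT V) E1 E2.
- by move=> x _; rewrite -[RHS]/(1 *: (x 0 l : R^o) + - a 0 l) scale1r.
Qed.

Lemma leib_const (c : R) (D : seq V -> E) s :
  leib (fun t => if t is [::] then c else 0) D s = c *: D s.
Proof.
have leib0 (D' : seq V -> E) t : leib (fun=> 0) D' t = 0.
  by elim: t D' => [|v t IH] D' /=; rewrite ?scale0r// !IH addr0.
by elim: s D => [//|v s IH] D /=; rewrite leib0 add0r IH.
Qed.

(** Euler's identity for homogeneous polynomials, at the level of jets. *)
Lemma euler_leib (G : seq V -> E) s : symjet G ->
  \sum_l leib (linear_jet l) (fun t => G (delta_mx 0 l :: t)) s = (size s)%:R *: G s.
Proof.
elim: s G => [|v s IH] G sG.
  by rewrite scale0r big1// => l _; rewrite /= scale0r.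
rewrite /= big_split /= mulrS scalerDl scale1r; congr (_ + _).
  have [_ lG _] := sG; rewrite [RHS]head_linear_sum//; apply: eq_bigr => l _.
  rewrite -(leib_const (v 0 l) (fun t => G (delta_mx 0 l :: t))).
  by apply: leib_ext => // -[].
rewrite -(IH (fun t => G (v :: t)) (symjet_cons v sG)); apply: eq_bigr => l _.
have [dG _ _] := sG; apply: leib_ext => // t _; apply: dG (leqnn _) _.
by move: (delta_mx 0 l) => w; exact/permPl/(perm_catCA [:: w] [:: v]).
Qed.

Lemma symjet_graded j (c : R) B : symjet B ->
  symjet (fun s => if size s == j then c *: B s else 0).
Proof.
move=> [dB lB bB]; split.
- by move=> m s t sm st; rewrite (perm_size st) (dB m s t sm st).
- by move=> b u v s /=; case: eqP => _; rewrite ?scaler0 ?addr0// lB scalerDr !scalerA mulrC.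
- move=> m; have [M MB] := bB m; exists (`|c| * `|M|) => s sm.
  case: eqP => _; last by rewrite normr0 !mulr_ge0// pnorm_ge0.
  rewrite normrZ -mulrA ler_wpM2l// (le_trans (MB s sm))// ler_wpM2r ?pnorm_ge0//.
  exact: ler_norm.
Qed.

(** By induction on j, from x |-> sum_l (x_l - a_l) B (e_l, x - a, ..., x - a)
    and Euler's identity. *)
Lemma djet_power j B a s : symjet B ->
  djet (fun x : V => B (nseq j (x - a))) a s =
  if size s == j then j`!%:R *: B s else 0.
Proof.
elim: j B s => [|j IH] B s sB.
  by rewrite /= djet_cst; case: s => [|//]; rewrite scale1r.
have CB l : Cp_on (Some (size s)) setT (fun x : V => B (delta_mx 0 l :: nseq j (x - a))).
  exact: (Cp_on_power _ _ _ (symjet_cons (delta_mx 0 l) sB)).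
have CL l : Cp_on (Some (size s)) setT ((fun x : V => x 0 l - a 0 l) : V -> R^o).
  apply: Cp_onD openT (Cp_on_coord _ _ openT) _; exact: Cp_on_cst openT.
have CP l : Cp_on (Some (size s)) setT (fun x : V => (x 0 l - a 0 l : R^o) *:
    B (delta_mx 0 l :: nseq j (x - a))) by exact: Cp_on_mul openT (CL l) (CB l).
rewrite (@djet_eq _ _ _ (size s) setT (fun x : V => \sum_l 1 *: ((x 0 l - a 0 l : R^o) *:
    B (delta_mx 0 l :: nseq j (x - a)))))//; last 3 first.
- exact: openT.
- by apply: Cp_on_sum => [|l _]; rewrite ?scale1r; [exact: openT|exact: Cp_on_mul openT (Cp_on_cst _ (1 : R^o) openT) (CP l)].
- move=> x _; have [_ lB _] := sB; rewrite /= head_linear_sum//.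
  by apply: eq_bigr => l _; rewrite !mxE scale1r.
rewrite (@djet_sum _ _ _ _ _ _ (fun l (x : V) => (x 0 l - a 0 l : R^o) *:
  B (delta_mx 0 l :: nseq j (x - a))) (size s) setT)//; last exact: openT.
have -> : (if size s == j.+1 then (j.+1)`!%:R *: B s else 0) =
    (size s)%:R *: (if size s == j.+1 then j`!%:R *: B s else 0).
  by case: eqP => [->|_]; rewrite ?scaler0// scalerA -natrM.
rewrite -(euler_leib s (symjet_graded j.+1 j`!%:R sB)); apply: eq_bigr => l _.
rewrite scale1r (djet_mul openT (CL l) (CB l))//; apply: leib_ext => t ts.
  exact: djet_coord_sub.
exact: (IH (fun s => B (delta_mx 0 l :: s)) t (symjet_cons _ sB)).
Qed.

End homogeneous_polynomials.

(** * The representation of T *)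

Section evaluation.
Context {R : realType} {V W : normedModType R} {p : option nat} {X : set V} {oX : open X}.

Definition Cp_eval (x : V) (f : Cp p oX W) : W := f x.

Lemma Cp_eval_linear x : linear (Cp_eval x).
Proof. by move=> a f g; exact: Cp_funL. Qed.

HB.instance Definition _ x :=
  GRing.isLinear.Build R (Cp p oX W) W _ (Cp_eval x) (Cp_eval_linear x).

Lemma Cp_eval_continuous x : X x -> continuous (Cp_eval x).
Proof.
move=> Xx; apply: (@Cp_continuous_at_point _ _ _ _ _ _ _ (Cp_eval x) x 0 1) => //.
  by case: p.
move=> f e e0 /(_ [::] isT); rewrite djet_nil mul1r pnorm_nil mulr1.
exact.
Qed.

End evaluation.
Arguments Cp_eval {R V W p X oX} x f : simpl never.

Section separating_operator.
Context {R : realType} {n : nat} {E F H : normedModType R} {p q : option nat}.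
Context {X : set 'rV[R]_n} {Y : set H} {oX : open X} {oY : open Y}.
Local Notation V := 'rV[R]_n.
Local Notation CpX := (Cp p oX E).
Local Notation CqY := (Cp q oY F).
Variable T : {linear CpX -> CqY}.
Implicit Types (f g : CpX).

Lemma weakly_compact_jet_ball : weakly_compact T -> exists K k (e : R) (C : set CqY) t0,
  [/\ compact K, K `<=` X, Np p k, 0 < e & compact (C : set (weak_space CqY)) /\
      forall v : CpX, (forall x, K x -> bdd k.+1 e (djet v x)) -> C (T v + t0)].
Proof.
move=> [ O [ oO [c Oc] [C TC [cC _]]]].
have [K [k [e [cK KX pk e0 h]]]] := Cp_open_ball oO Oc.
exists K, k, e, C, (T c); split => //; split => // v /h Ov.
by apply: TC; exists (c + v) => //; rewrite raddfD addrC.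
Qed.

Variables (K : set V) (k : nat) (e0 : R) (C : set CqY) (t0 : CqY).
Hypotheses (cK : compact K) (KX : K `<=` X) (pk : Np p k) (e0_gt0 : 0 < e0).
Hypothesis cC : compact (C : set (weak_space CqY)).
Hypothesis TC : forall v : CpX, (forall x, K x -> bdd k.+1 e0 (djet v x)) -> C (T v + t0).

(** Evaluation at y maps a weakly compact set of functions to a weakly compact,
    hence norm bounded, set. *)
Lemma point_bound y : Y y -> exists M, forall v : CpX,
  (forall x, K x -> bdd k.+1 e0 (djet v x)) -> `|T v y| <= M.
Proof.
move=> Yy.
have := @weak_compact_image R CqY F (Cp_eval y) 0 C (@Cp_eval_continuous _ _ _ _ _ oY y Yy) cC.
move=> /weakly_compact_norm_bounded[M hM].
exists (M + `|t0 y|) => v /TC Cv.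
have hv : `|T v y + t0 y| <= M.
  by apply: hM; exists (T v + t0) => //; rewrite addr0; exact: Cp_funD.
by rewrite -[T v y](addrK (t0 y)) (le_trans (ler_normB _ _))// lerD2r.
Qed.

Hypotheses (sepT : separating T) (ntT : nowhere_trivial T).
Local Notation h := (support_map T).

Lemma support_pointP y : Y y -> [/\ K (h y),
  forall N, nbhs (h y) N -> exists2 f : CpX, (forall x, ~ N x -> f x = 0) & T f y != 0,
  forall f : CpX, (\forall x \near h y, f x = 0) -> T f y = 0 &
  forall f g : CpX, (forall s, (size s <= k)%N -> djet f (h y) s = djet g (h y) s) ->
    T f y = T g y].
Proof.
move=> Yy; have [M TM] := point_bound Yy.
pose A : {linear CpX -> F} := Cp_eval y \o T.
have sepA (f g : CpX) : (forall x, X x -> f x = 0 \/ g x = 0) -> A f = 0 \/ A g = 0.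
  by move=> fg; exact: sepT fg y Yy.
have A0 : exists f : CpX, A f != 0 by exact: ntT.
have AM : forall v : CpX, (forall x, K x -> bdd k.+1 e0 (djet v x)) -> `|A v| <= M.
  exact: TM.
have [a Ka aA] := support_point_exists cK KX pk e0_gt0 AM A0.
have P3 := vanishing_near_eq0 sepA aA.
have ha : h y = a by apply: support_map_eq P3 aA; exact: KX.
rewrite ha; split => //.
exact: (eq_jets_eq KX pk e0_gt0 AM sepA Ka aA).
Qed.

Lemma support_map_relatively_compact : relatively_compact_in X (h @` Y).
Proof.
have hK : h @` Y `<=` K by move=> _ [y Yy <-]; have [] := support_pointP Yy.
have hcK : closure (h @` Y) `<=` K.
  have clK : closed K := compact_closed (@norm_hausdorff _ _) cK.
  by rewrite [X in _ `<=` X]((closure_id K).1 clK); exact: closureS.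
split; first exact: subset_trans hK KX.
rewrite setIidr; last exact: (subset_trans hcK KX).
by apply: subclosed_compact cK hcK; exact: closed_closure.
Qed.

End separating_operator.

Section representation.
Context {R : realType} {n : nat} {E F H : normedModType R} {p q : option nat}.
Context {X : set 'rV[R]_n} {Y : set H} {oX : open X} {oY : open Y}.
Local Notation V := 'rV[R]_n.
Local Notation CpX := (Cp p oX E).
Local Notation CqY := (Cp q oY F).
Variables (T : {linear CpX -> CqY}) (h : H -> V).
Implicit Types (f g : CpX).

Definition monomial_fun j (b : @expansion n j) (e : E) : CpX :=
  xget 0 [set f : CpX | forall x, X x -> f x = monomial_at b x *: e].

Lemma monomial_funE j (b : @expansion n j) e x : X x ->
  monomial_fun b e x = (monomial_at b x : R) *: e.
Proof.
have [f fE] := @Cp_of_fun _ _ _ _ _ oX _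
  (Cp_on_mul oX (Cp_on_sub openT oX (@subsetT _ _) (Cp_on_monomial_at p b)) (Cp_on_cst p e oX)).
exact: (@xgetI _ 0 [set f : CpX | forall x, X x -> f x = (monomial_at b x : R) *: e] f fE x).
Qed.

Lemma monomial_fun_linear j (b : @expansion n j) : linear (monomial_fun b).
Proof.
move=> a u v; apply: Cp_fun_ext => x Xx; rewrite Cp_funL !monomial_funE//.
by rewrite scalerDr !scalerA mulrC.
Qed.

(** The value of T at y on the polynomial x |-> S (x - h y, ..., x - h y) / j!,
    expanded in monomials in x so that its dependence on y becomes visible. *)
Definition representing j (y : H) (S : symml j V E) : F :=
  (j`!%:R)^-1 *: \sum_(b : @expansion n j) (coef_at b (h y) : R) *:
    T (monomial_fun b (S (fun i => nth 0 (directions b) i))) y.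

Variables (K : set V) (k : nat) (e0 : R) (C : set CqY) (t0 : CqY).
Hypotheses (cK : compact K) (KX : K `<=` X) (pk : Np p k) (e0_gt0 : 0 < e0).
Hypothesis TC : forall v : CpX, (forall x, K x -> bdd k.+1 e0 (djet v x)) -> C (T v + t0).
Hypothesis hK : forall y, Y y -> K (h y).
Hypothesis hT : forall y, Y y -> forall f g : CpX,
  (forall s, (size s <= k)%N -> djet f (h y) s = djet g (h y) s) -> T f y = T g y.

(** f and its Taylor polynomial of order k at h y have the same derivatives up
    to order k there. *)
Lemma representingE f y : Y y ->
  T f y = \sum_(j < k.+1) representing y (frechetD f j (h y)).
Proof.
move=> Yy; set a := h y; have Xa : X a by apply/KX/hK.
pose B := djet f a; have sB : symjet B := symjet_djet _ _.
pose term j : CpX := (j`!%:R)^-1 *: \sum_(b : @expansion n j) (coef_at b a : R) *: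
   monomial_fun b (B (directions b)).
pose g : CpX := \sum_(j < k.+1) term j.
have gE x : X x -> g x = \sum_(j < k.+1) (j`!%:R)^-1 *: B (nseq j (x - a)).
  move=> Xx; rewrite -[g x]/(Cp_eval x g) linear_sum; apply: eq_bigr => j _ /=.
  rewrite power_expansion// /term linearZ /= linear_sum; congr (_ *: _).
  by apply: eq_bigr => b _; rewrite linearZ /= /Cp_eval monomial_funE// scalerA.
have oT := @openT V.
rewrite (hT Yy (f := f) (g := g)); last first.
  move=> s sk; rewrite (@djet_eq _ _ _ k X (fun x => \sum_(j < k.+1)
    (j`!%:R)^-1 *: B (nseq j (x - a))) g)//; last first.
    apply: Cp_on_sum oX _ => j _.
    apply: (@Cp_on_mul _ _ _ _ _ (fun=> (j`!%:R)^-1)) oX _ _; first exact: Cp_on_cst.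
    exact: Cp_on_sub oT oX (@subsetT _ _) (Cp_on_power _ j a sB).
  rewrite (@djet_sum _ _ _ _ _ _ (fun (j : 'I_k.+1) (x : V) => B (nseq j (x - a))) k setT)//.
    rewrite (bigD1 (Ordinal (sk : (size s < k.+1)%N)))//= djet_power// eqxx.
    rewrite scalerA mulVf ?pnatr_eq0 -?lt0n ?fact_gt0// scale1r big1 ?addr0//.
    move=> j /eqP js; rewrite djet_power// ifN ?scaler0//.
    by apply/eqP => sj; apply: js; exact: val_inj.
  by move=> j; exact: Cp_on_power.
rewrite -[LHS]/(Cp_eval y (T g)) /g !linear_sum; apply: eq_bigr => j _ /=.
rewrite /term linearZ /= linearZ /= /representing; congr (_ *: _).
rewrite !linear_sum; apply: eq_bigr => b _; rewrite linearZ /= linearZ /= /Cp_eval.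
by rewrite /B (djet_size _ _ (size_directions b)).
Qed.

Lemma monomial_fun_small j (b : @expansion n j) : exists2 D, 0 <= D &
  forall e x, K x -> bdd k.+1 (D * `|e|) (djet (monomial_fun b e) x).
Proof.
have mX : Cp_on (Some k) X (monomial_at b).
  exact: Cp_on_sub openT oX (@subsetT _ _) (Cp_on_monomial_at _ b).
have [D D0 mD] := djet_bounded_compact oX cK KX mX.
exists D => // e x Kx s sk; have Xx := KX Kx.
rewrite (@djet_eq _ _ _ k X (fun z => (monomial_at b z : R) *: e))//; last 2 first.
- exact: Cp_on_mul oX mX (Cp_on_cst _ _ oX).
- by move=> z Xz; exact: monomial_funE.
rewrite (djet_scale_vector e oX mX Xx sk) normrZ -mulrA (mulrC `|e|) mulrA.
by rewrite ler_wpM2r//; exact: mD.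
Qed.

Definition monomial_term j (b : @expansion n j) (S : symml j V E) : CqY :=
  T (monomial_fun b (S (fun i => nth 0 (directions b) i))).

Lemma monomial_term_linear j (b : @expansion n j) : linear (monomial_term b).
Proof.
by move=> a S S'; rewrite /monomial_term symml_linearE monomial_fun_linear linearP.
Qed.

HB.instance Definition _ j b :=
  GRing.isLinear.Build R (symml j V E) CqY _ (monomial_term b) (@monomial_term_linear j b).

Lemma monomial_term_small j (b : @expansion n j) : exists2 d, 0 < d &
  forall S : symml j V E, `|S| <= d -> C (monomial_term b S + t0).
Proof.
have [D D0 mD] := monomial_fun_small b.
pose N := \prod_(i < j) `|nth 0 (directions b) i : V|.
have N0 : 0 <= N by exact: prodr_ge0.
have M0 : 0 < D * N + 1 by rewrite ltr_wpDl// mulr_ge0.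
exists (e0 / (D * N + 1)); first by rewrite divr_gt0.
move=> S; rewrite ler_pdivlMr// => Sd; apply: TC => x Kx s sk.
rewrite (le_trans (mD _ x Kx s sk))// ler_wpM2r ?pnorm_ge0//.
rewrite (le_trans _ Sd)// (le_trans (ler_wpM2l D0 (symml_norm_ub S _)))//.
by rewrite mulrCA ler_wpM2l// lerDl.
Qed.

End representation.

(** * Hankel matrices and the regularity of the support map *)

Section hankel.
Context {R : realType}.
Implicit Types (L : {linear {poly R} -> R^o}) (s : R).

Definition hankel (L : {poly R} -> R) r : 'M[R]_r.+1 := \matrix_(a, b) L 'X^(a + b).

(** The bilinear form (u, w) |-> L (u w) is nondegenerate on polynomials of
    degree at most r: u has some order m <= r at s, and (X - s)^(r - m) u then has
    order exactly r, where L does not vanish. *)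
Lemma hankel_det_neq0 L s r :
  (forall u, L (u * ('X - s%:P) ^+ r.+1) = 0) -> L (('X - s%:P) ^+ r) != 0 ->
  \det (hankel L r) != 0.
Proof.
move=> L0 Lr; apply/negP => /det0P[v v0 vH].
pose u : {poly R} := rVpoly v.
have u0 : u != 0 by apply: contraNneq v0 => u0; rewrite -(rVpolyK v) -/u u0 linear0.
have Lu (w : {poly R}) : (size w <= r.+1)%N -> L (u * w) = 0.
  move=> wr; have e m : (m < r.+1)%N -> L (u * 'X^m) = 0.
    move=> mr; have := congr1 (fun A : 'rV_ _ => A 0 (Ordinal mr)) vH; rewrite !mxE => vm.
    rewrite -[RHS]vm /u [rVpoly v]poly_def mulr_suml linear_sum; apply: eq_bigr => a _.
    rewrite -scalerAl linearZ /= mxE -exprD; congr (_ * _).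
    by rewrite insubT //= => ar; congr (v 0 _); exact: val_inj.
  have -> : w = \sum_(b < r.+1) w`_b *: 'X^b.
    rewrite -poly_def; apply/polyP => b; rewrite coef_poly; case: ltnP => // rb.
    by rewrite nth_default// (leq_trans wr).
  rewrite mulr_sumr linear_sum big1// => b _.
  by rewrite -scalerAr linearZ /= e// scaler0.
have [m [w wroot uE]] := multiplicity_XsubC u s.
rewrite u0 /= in wroot.
have mr : (m <= r)%N.
  have su : (size u <= r.+1)%N by exact: size_poly.
  have w0 : w != 0 by apply: contraNneq wroot => ->; rewrite root0.
  move: su; rewrite uE size_Mmonic ?monic_exp ?monicXsubC// size_exp_XsubC.
  rewrite addnS /= -[(m <= r)%N]ltnS => /(leq_trans _); apply.
  by rewrite -[X in (X < _)%N]add0n ltn_add2r size_poly_gt0.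
have := Lu (('X - s%:P) ^+ (r - m)).
rewrite size_exp_XsubC ltnS leq_subr => /(_ isT).
rewrite uE -mulrA -exprD subnKC//.
have [q qE] : exists q, w = q * ('X - s%:P) + w.[s]%:P.
  have /factor_theorem[q qE] : root (w - w.[s]%:P) s by rewrite rootE !hornerE subrr.
  by exists q; rewrite -qE subrK.
rewrite qE mulrDl -mulrA -exprS linearD /= L0 add0r mul_polyC linearZ /=.
by move/eqP; rewrite mulf_eq0 (negbTE Lr) orbF -rootE (negbTE wroot).
Qed.

(** The coefficients of (X - s)^(r+1) below the leading one solve a linear
    system with Hankel matrix, and the last of them is -(r+1) s: Cramer's rule
    expresses s through the moments L (X^m). *)
Lemma hankel_root L s r :
  (forall u, L (u * ('X - s%:P) ^+ r.+1) = 0) ->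
  (r.+1)%:R * \det (hankel L r) * s =
  \sum_a (\adj (hankel L r)) ord_max a * L 'X^(a + r.+1).
Proof.
move=> L0; pose c := ('X - s%:P) ^+ r.+1.
have sc : size c = r.+2 by rewrite size_exp_XsubC.
have cr : c`_r.+1 = 1.
  have /monicP : c \is monic by rewrite monic_exp// monicXsubC.
  by rewrite lead_coefE sc.
have cr' : c`_r = - ((r.+1)%:R * s).
  have := @coefPn_prod_XsubC R (nseq r.+1 s); rewrite size_nseq => /(_ isT).
  by rewrite !big_nseq iter_mulr_1 iter_addr_0 -/c mulr_natl.
have sys : hankel L r *m (\col_b c`_b) = - \col_a L 'X^(a + r.+1).
  apply/matrixP => a z; rewrite !mxE; apply/eqP; rewrite -addr_eq0; apply/eqP.
  rewrite -[RHS](L0 'X^a) -/c -[c in RHS]coefK poly_def sc mulr_sumr linear_sum [RHS]big_ord_recr /=.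
  congr (_ + _); last by rewrite cr scale1r exprD.
  by apply: eq_bigr => b _; rewrite !mxE -scalerAr linearZ /= exprD mulrC.
have := congr1 (fun A => (\adj (hankel L r) *m A) ord_max 0) sys.
rewrite mulmxA mul_adj_mx mul_scalar_mx !mxE cr' => e.
have -> : (r.+1)%:R * \det (hankel L r) * s = - (\det (hankel L r) * - ((r.+1)%:R * s)) by ring.
rewrite e -sumrN; apply: eq_bigr => a _.
by rewrite !mxE mulrN opprK.
Qed.

End hankel.

Lemma leib_vanish {R : realType} {V W : normedModType R} (A : seq V -> R^o)
    (B : seq V -> W) s : A [::] = 0 -> (forall t, (size t < size s)%N -> B t = 0) ->
  leib A B s = 0.
Proof.
have leib0 (A' : seq V -> R^o) t : leib A' (fun=> 0 : W) t = 0.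
  by elim: t A' => [|v t IH] A' /=; rewrite ?scaler0// !IH addr0.
move=> A0; elim: s B => [|v s IH] B Bs /=; first by rewrite A0 scale0r.
rewrite (@leib_ext _ _ _ _ (fun t => A (v :: t)) B (fun=> 0))// leib0 IH ?addr0// => t ts.
exact: Bs.
Qed.

Section smooth_determinants.
Context {R : realType} {V : normedModType R} {p : option nat} {X : set V}.

Lemma Cp_on_det m (A : V -> 'M[R]_m) : open X ->
  (forall i j, Cp_on p X (fun x => A x i j : R^o)) -> Cp_on p X (fun x => \det (A x) : R^o).
Proof.
move=> oX AX; apply: (@Cp_on_eq _ _ _ p X (fun x =>
  \sum_(s : 'S_m) ((-1) ^+ s : R^o) *: (\prod_i (A x i (s i) : R) : R^o))) => //.
apply: Cp_on_sum => // s _.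
apply: (@Cp_on_mul _ _ _ p X (fun=> (-1) ^+ s) _ oX (Cp_on_cst _ _ oX)).
by apply: (@Cp_on_prod _ _ _ _ (fun i x => A x i (s i)) p X oX) => i.
Qed.

Lemma Cp_on_adj m (A : V -> 'M[R]_m) i j : open X ->
  (forall i j, Cp_on p X (fun x => A x i j : R^o)) ->
  Cp_on p X (fun x => \adj (A x) i j : R^o).
Proof.
move=> oX AX.
apply: (@Cp_on_eq _ _ _ p X (fun x => ((-1) ^+ (j + i) : R^o) *:
  (\det (row' j (col' i (A x))) : R^o))) => //; last by move=> x _; rewrite mxE.
apply: (@Cp_on_mul _ _ _ p X (fun=> (-1) ^+ (j + i)) _ oX (Cp_on_cst _ _ oX)).
apply: (Cp_on_det oX) => a b; apply: (Cp_on_eq oX (AX (lift j a) (lift i b))).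
by move=> x _; rewrite !mxE.
Qed.

Lemma Cp_on_inv (g : V -> R^o) : open X -> (forall x, X x -> g x != 0) ->
  Cp_on p X g -> Cp_on p X (fun x => (g x : R)^-1 : R^o).
Proof.
move=> oX g0 gX; apply: (Cp_on_eq oX (@Cp_on_chain _ _ p X inv_derivs g oX _ gX)).
  by move=> x Xx; apply: smooth_at_inv; exact: g0.
by move=> x _; rewrite /inv_derivs fact0 expr0 !mul1r expr1.
Qed.

End smooth_determinants.

Section coordinate_regularity.
Context {R : realType} {n : nat} {E F H : normedModType R} {p q : option nat}.
Context {X : set 'rV[R]_n} {Y : set H} {oX : open X} {oY : open Y}.
Local Notation V := 'rV[R]_n.
Local Notation CpX := (Cp p oX E).
Local Notation CqY := (Cp q oY F).
Variables (T : {linear CpX -> CqY}) (h : H -> V) (k : nat) (i : 'I_n).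
Implicit Types (f g : CpX) (u v : {poly R}).

Lemma Cp_on_poly u : Cp_on p setT (fun x : V => u.[x 0 i] : R^o).
Proof.
elim/poly_ind: u => [|u c IH].
  by apply: (Cp_on_eq openT (Cp_on_cst _ 0 openT)) => x _; rewrite horner0.
apply: (Cp_on_eq openT (Cp_onD openT (Cp_on_mul openT IH (Cp_on_coord p i openT))
  (Cp_on_cst _ (c : R^o) openT))) => x _.
by rewrite hornerMXaddC.
Qed.

Definition poly_mul u g : CpX := Cp_mul (fun x => u.[x 0 i]) g.

Lemma poly_mulE u g x : poly_mul u g x = u.[x 0 i] *: g x.
Proof. exact: Cp_mulE (Cp_on_poly u). Qed.

Lemma poly_mulM u v g : poly_mul (u * v) g = poly_mul u (poly_mul v g).
Proof. by apply: Cp_fun_ext => x _; rewrite !poly_mulE hornerM scalerA. Qed.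

Hypotheses (pk : Np p k) (hX : forall y, Y y -> X (h y)).
Hypothesis hT : forall y, Y y -> forall f g : CpX,
  (forall s, (size s <= k)%N -> djet f (h y) s = djet g (h y) s) -> T f y = T g y.

Lemma djet_power_mul a m g s : X a -> (size s < m)%N -> (size s <= k)%N ->
  djet (poly_mul (('X - (a 0 i)%:P) ^+ m) g) a s = 0.
Proof.
move=> Xa; elim: m s => [//|m IH] s sm sk.
have l1 : Cp_on (Some k) X (fun x : V => ('X - (a 0 i)%:P).[x 0 i] : R^o).
  apply: (Cp_on_sub openT oX (@subsetT _ _)); have /Cp_onP := Cp_on_poly ('X - (a 0 i)%:P).
  exact.
have l2 := Cp_fun_on_le (poly_mul (('X - (a 0 i)%:P) ^+ m) g) pk.
rewrite (@djet_eq _ _ _ k X (fun x => (('X - (a 0 i)%:P).[x 0 i] : R^o) *: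
  poly_mul (('X - (a 0 i)%:P) ^+ m) g x))//; last 2 first.
- exact: Cp_on_mul.
- by move=> x _; rewrite exprS poly_mulM poly_mulE.
rewrite (djet_mul oX l1 l2)//; apply: leib_vanish.
  by rewrite djet_nil hornerXsubC subrr.
by move=> t ts; apply: IH; [exact: leq_trans ts _|exact: leq_trans (ltnW ts) sk].
Qed.

(** The k-jet at h y of a function with a factor (x_i - h_i(y))^(k+1) is zero. *)
Lemma poly_mul_nilpotent y m g : Y y -> (k < m)%N ->
  T (poly_mul (('X - (h y 0 i)%:P) ^+ m) g) y = 0.
Proof.
move=> Yy km; rewrite (hT Yy (g := 0)) ?linear0// => s sk.
rewrite (djet_power_mul _ (hX Yy) (leq_ltn_trans sk km) sk).
by rewrite /djet -[Cp_fun 0]/(0 : V -> E) frechetD0.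
Qed.

Definition moment (phi : dual F) g y u : R^o := phi (T (poly_mul u g) y).

Lemma moment_linear phi g y : linear (moment phi g y).
Proof.
move=> c u v; rewrite /moment.
have -> : poly_mul (c *: u + v) g = c *: poly_mul u g + poly_mul v g.
  apply: Cp_fun_ext => x _; rewrite Cp_funL !poly_mulE hornerD hornerZ.
  by rewrite scalerDl scalerA.
by rewrite linearP Cp_funL; have [-> _] := bopP phi.
Qed.

HB.instance Definition _ phi g y :=
  GRing.isLinear.Build R {poly R} R^o _ (moment phi g y) (moment_linear phi g y).

Hypothesis ntT : nowhere_trivial T.

(** The exponent r is maximal over the whole of W, so that T_y kills the multiples
    of (x_i - h_i(y))^(r+1) at every y in W, not only at the point where some
    multiple of the power r survives.  W0 is the part of W where the Hankel
    determinant, which is nonzero at that point, does not vanish. *)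
Lemma coordinate_Cp_on (W : set H) : open W -> W `<=` Y -> W !=set0 ->
  exists W0, [/\ open W0, W0 `<=` W, W0 !=set0 &
    Cp_on q W0 (fun y => h y 0 i : R^o)].
Proof.
move=> oW WY [w Ww].
pose Q r := exists2 y, W y & exists g, T (poly_mul (('X - (h y 0 i)%:P) ^+ r) g) y != 0.
have Q0 : exists r, `[< Q r >].
  exists 0%N; apply/asboolP; exists w => //; have [g Tg] := ntT (WY _ Ww).
  exists g; suff -> : poly_mul (('X - (h w 0 i)%:P) ^+ 0) g = g by [].
  by apply: Cp_fun_ext => x _; rewrite poly_mulE expr0 hornerC scale1r.
have Qk r : `[< Q r >] -> (r <= k)%N.
  move=> /asboolP[y Wy [g Tg]]; rewrite leqNgt; apply/negP => kr.
  by move/eqP: Tg; apply; apply: poly_mul_nilpotent => //; exact: WY.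
have [r /asboolP[y0 Wy0 [g Tg]] rmax] := ex_maxnP Q0 Qk.
have Tr y : W y -> forall u, T (poly_mul (u * ('X - (h y 0 i)%:P) ^+ r.+1) g) y = 0.
  move=> Wy u; apply/eqP; apply: contrapT => /negP Tu.
  have : (r < r)%N.
    apply: rmax; apply/asboolP; exists y => //; exists (poly_mul u g).
    by rewrite -poly_mulM mulrC.
  by rewrite ltnn.
have [phi [_ phiT]] := norming_functional (T (poly_mul (('X - (h y0 0 i)%:P) ^+ r) g) y0).
pose L y : {linear {poly R} -> R^o} := moment phi g y.
have L0 y : W y -> forall u, L y (u * ('X - (h y 0 i)%:P) ^+ r.+1) = 0.
  move=> Wy u; rewrite /L /= /moment Tr//.
  by have := bop_linearZ phi 0 0; rewrite !scale0r.
have Lr : L y0 (('X - (h y0 0 i)%:P) ^+ r) != 0.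
  by rewrite /L /= /moment phiT normr_eq0.
have LC m : Cp_on q Y (fun y => L y 'X^m : R^o).
  exact: Cp_on_post oY (Cp_fun_on (T (poly_mul 'X^m g))).
pose d y : R := \det (hankel (L y) r).
have HC a b : Cp_on q Y (fun y => hankel (L y) r a b : R^o).
  by apply: (Cp_on_eq oY (LC (a + b)%N)) => y _; rewrite mxE.
have dC : Cp_on q Y (d : H -> R^o) by exact: Cp_on_det.
have d0 : d y0 != 0 by apply: hankel_det_neq0 Lr; exact: L0.
have d_near : nbhs y0 [set y | d y != 0].
  exact: (@cvgr_neq0 _ _ _ (nbhs y0) _ (d : H -> R^o) (d y0)
    (Cp_on_continuous oY dC (WY _ Wy0)) d0).
move: d_near; rewrite nbhsE => -[ O [ oO Oy0 ] Od].
pose W0 := W `&` O; have oW0 : open W0 by exact: openI.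
have W0Y : W0 `<=` Y by move=> y [/WY].
exists W0; split => //; first exact: subIsetl.
  by exists y0.
pose num y : R := \sum_a (\adj (hankel (L y) r)) ord_max a * L y 'X^(a + r.+1).
apply: (@Cp_on_eq _ _ _ q W0 (fun y => (((r.+1)%:R * d y)^-1 : R^o) *: (num y : R^o))) => //.
  apply: (Cp_on_mul oW0).
    apply: (@Cp_on_inv _ _ q W0 (fun y => ((r.+1)%:R : R^o) *: (d y : R^o)) oW0).
      by move=> y [_ /Od dy]; rewrite mulf_neq0.
    apply: (@Cp_on_mul _ _ _ q W0 (fun=> (r.+1)%:R) _ oW0 (Cp_on_cst _ _ oW0)).
    exact: Cp_on_sub oY oW0 W0Y dC.
  apply: Cp_on_sum => // a _.
  apply: (@Cp_on_mul _ _ _ q W0 (fun y => \adj (hankel (L y) r) ord_max a) _ oW0).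
    by apply: (Cp_on_sub oY oW0 W0Y); exact: Cp_on_adj.
  exact: Cp_on_sub oY oW0 W0Y (LC _).
move=> y [Wy Oy]; have dy : (r.+1)%:R * d y != 0 by rewrite mulf_neq0 ?Od.
by rewrite /num -(hankel_root (L0 y Wy)) -/(d y) /GRing.scale /= mulKf.
Qed.

End coordinate_regularity.

(** * Combinations of weakly compact operators *)

Section strong_operator_topology.
Context {R : realType} {V W : normedModType R}.

Let index := (@seminorm_ball_index R V (bop V W)).

Lemma sot_cvg (F : set_system (sot V W)) (A : bop V W) : Filter F ->
  (forall u e, 0 < e -> F [set B : sot V W | `|(B : bop V W) u - A u| <= e]) -> F --> (A : sot V W).
Proof.
move=> FF FA O; rewrite nbhsE => -[ O' [ [D' sD' <-] [B BD' BA] ] BO ].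
have [DB sDB BE] := sD' _ BD'.
have {}BA : B A by [].
pose ball_of (b : index) := [set g : bop V W | `|(g - b.1.1 : bop V W) b.1.2| < b.2].
have FDB b : b \in finmap.enum_fset DB -> F (ball_of b).
  move=> bDB; have /= Ab : ball_of b A by move: BA; rewrite -BE; apply.
  have e0 : 0 < (b.2 - `|(A - b.1.1 : bop V W) b.1.2|) / 2 by rewrite divr_gt0// subr_gt0.
  apply: filterS (FA b.1.2 _ e0) => g /= gA.
  have key (B1 : bop V W) : `|(B1 - b.1.1 : bop V W) b.1.2| <=
      `|B1 b.1.2 - A b.1.2| + `|(A - b.1.1 : bop V W) b.1.2|.
    by rewrite !bop_linearB -[B1 _ - _](subrKA (A b.1.2)) ler_normD.
  apply: le_lt_trans (key g) _; rewrite -ltrBrDr; apply: le_lt_trans gA _.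
  by move: e0; lra.
suff FB : F B by apply: filterS FB => g Bg; apply: BO; exists B.
suff : F [set g | forall b, b \in finmap.enum_fset DB -> ball_of b g].
  by apply: filterS => g h; rewrite -BE => b bDB; exact: h.
elim: (finmap.enum_fset DB) FDB => [_|b l IH gl].
  by apply: filterS (@filterT _ F _) => g _ b.
have F1 : F (ball_of b) by apply: gl; rewrite mem_head.
have F2' : F [set g | forall b', b' \in l -> ball_of b' g].
  by apply: IH => b' bl; apply: gl; rewrite in_cons bl orbT.
apply: filterS2 F1 F2' => g g1 g2 b'; rewrite in_cons => /orP[/eqP->//|]; exact: g2.
Qed.

End strong_operator_topology.

Section operator_combinations.
Context {R : realType} {V W : normedModType R} {Z : preTopologicalLmodType R} {I : finType}.
Variables (P : I -> {linear V -> Z}) (C : set Z) (t0 : Z) (d : I -> R).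
Hypotheses (d_gt0 : forall i, 0 < d i) (cC : compact (C : set (weak_space Z))).
Hypothesis PC : forall i v, `|v| <= d i -> C (P i v + t0).

Lemma combination_weakly_compact (M : I -> {linear Z -> W}) :
  (forall i, continuous (M i)) ->
  bounded_linear (fun v => \sum_i M i (P i v)) /\
  weakly_compact (fun v => \sum_i M i (P i v)).
Proof.
move=> cM; set D := fun v => _.
have DL : linear D.
  move=> a u v; rewrite /D scaler_sumr -big_split; apply: eq_bigr => i _ /=.
  by rewrite !linearP.
have D0 : D 0 = 0 by have := DL (-1) 0 0; rewrite scaler0 addr0 scaleN1r addNr.
have [e e0 ed] : exists2 e, 0 < e & forall i, e <= d i.
  exists (\big[Num.min/1]_i d i); first by apply: lt_bigmin => // i _.
  by move=> i; exact: bigmin_le_cond.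
have [B cB DB] := weak_compact_sum (index_enum I)
  (fun i => @weak_compact_image R Z W (M i) (- M i t0) C (cM i) cC).
have {}DB v : `|v| <= e -> B (D v).
  move=> ve; apply: DB => i; exists (P i v + t0); first by apply: PC; exact: le_trans ve _.
  by rewrite raddfD addrK.
have [N BN] := weakly_compact_norm_bounded cB.
split; [split => //|].
  exists (N / e) => v; have [->|v0] := eqVneq v 0.
    by rewrite D0 !normr0 mulr0.
  have ve : `|(e / `|v|) *: v| <= e.
    by rewrite normrZ normrM normfV normr_id gtr0_norm// divfK// normr_eq0.
  have := BN _ (DB _ ve).
  have -> : D ((e / `|v|) *: v) = (e / `|v|) *: D v.
    by have := DL (e / `|v|) v 0; rewrite D0 !addr0.
  rewrite normrZ normrM normfV normr_id gtr0_norm//.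
  rewrite mulrAC ler_pdivrMr ?normr_gt0// => h.
  by rewrite mulrAC ler_pdivlMr// mulrC.
exists [set v | `|v| < e]; split.
- by apply: open_comp (@open_lt _ e) => v _; exact: norm_continuous.
- by exists 0; rewrite /= normr0.
- exists B; last by split => //; exact: compact_closed (@weak_hausdorff _ _) cB.
  by move=> _ [v /ltW ve <-]; exact: DB.
Qed.

(** The points w do not depend on the M i, so that the second adjoint of a
    varying combination of the P i is computed by applying that combination to
    fixed points. *)
Lemma combination_biadjoint (xi : bidual V) : exists w : I -> Z,
  forall M : I -> {linear Z -> W}, (forall i, continuous (M i)) ->
  forall phi : dual W,
  biadjoint (to_bop (fun v => \sum_i M i (P i v))) xi phi = phi (\sum_i M i (w i)).
Proof.
have wE i : exists w, forall (psi : {linear Z -> R^o}) (phi : dual V), continuous psi ->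
    (forall v, phi v = psi (P i v)) -> xi phi = psi w.
  exact: (bidual_point (d_gt0 i) cC (@PC i)).
have [w wP] := choice wE.
exists w => M cM phi.
have [bD _] := combination_weakly_compact cM.
set D := fun v => _ in bD *.
have toD : to_bop D = D :> (V -> W).
  have [A AD] := bounded_linear_bop bD.
  exact: (@xgetI _ 0 [set A : bop V W | A = D :> (V -> W)] A AD).
have [psi [cpsi psiE]] := dual_functional phi.
have cpsiM i : continuous ((psi \o M i : {linear Z -> R^o}) : Z -> R^o).
  by move=> z; apply: continuous_comp; [exact: cM|exact: cpsi].
have fE i := weakly_compact_functional (d_gt0 i) cC (@PC i) (cpsiM i).
pose f i : dual V := sval (cid (fE i)).
have fP i v : f i v = psi (M i (P i v)) by rewrite /f; case: cid.
have adjE : adjoint (to_bop D) phi = \sum_i 1 *: f i.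
  apply/val_inj/funext => v; rewrite [RHS]bop_sumE.
  rewrite -[LHS]/(phi (to_bop D v)) toD -psiE /D linear_sum; apply: eq_bigr => i _.
  by rewrite scale1r fP.
rewrite -[LHS]/(xi (adjoint (to_bop D) phi)) adjE.
have [Xi [_ XiE]] := dual_functional xi.
rewrite -XiE -psiE !linear_sum; apply: eq_bigr => i _.
rewrite scale1r XiE (wP i (psi \o M i) (f i) (cpsiM i))// => v; exact: fP.
Qed.

End operator_combinations.

Section regular_points.
Context {R : realType} {H : normedModType R} {n : nat} {q : option nat} {Y : set H}.
Variable h : H -> 'rV[R]_n.
Hypothesis oY : open Y.
Hypothesis hY : forall (W : set H) i, open W -> W `<=` Y -> W !=set0 ->
  exists W0, [/\ open W0, W0 `<=` W, W0 !=set0 &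
    Cp_on q W0 (fun y => h y 0 i : R^o)].

(** The union of all open sets on which h is C^q; shrinking a given open set
    once for each coordinate shows that it is dense. *)
Lemma Cp_on_dense : exists U, [/\ open U, U `<=` Y, Y `<=` closure U & Cp_on q U h].
Proof.
have hs (s : seq 'I_n) (W : set H) : open W -> W `<=` Y -> W !=set0 ->
    exists W0, [/\ open W0, W0 `<=` W, W0 !=set0 &
      forall i, i \in s -> Cp_on q W0 (fun y => h y 0 i : R^o)].
  elim: s W => [|i s IH] W oW WY W0; first by exists W; split.
  have [W1 [oW1 W1W W10 h1]] := hY i oW WY W0.
  have [W2 [oW2 W2W W20 h2]] := IH W1 oW1 (subset_trans W1W WY) W10.
  exists W2; split => //; first exact: subset_trans W2W W1W.
  move=> j; rewrite in_cons => /orP[/eqP->|]; last exact: h2.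
  exact: Cp_on_sub oW1 oW2 W2W h1.
pose good (W : set H) := [/\ open W, W `<=` Y & Cp_on q W h].
exists (\bigcup_(W in good) W); split.
- by apply: bigcup_open => W [].
- by move=> y [W [_ WY _] /WY].
- move=> y Yy B; rewrite nbhsE => -[ O [ oO Oy ] OB ].
  have [||W0 [oW0 W0O [z W0z] h0]] := hs (enum 'I_n) (Y `&` O) (openI oY oO).
  + exact: subIsetl.
  + by exists y.
  exists z; split; last by apply: OB; case: (W0O _ W0z).
  exists W0 => //; split => //; first by move=> x /W0O[].
  apply: (@Cp_on_eq _ _ _ q W0 (fun y => \sum_i (h y 0 i : R^o) *: delta_mx 0 i)) => //.
    apply: Cp_on_sum => // i _; apply: (Cp_on_mul oW0); last exact: Cp_on_cst.
    by apply: h0; rewrite mem_enum.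
  by move=> x _; exact: row_sum_delta.
- apply: Cp_on_local; first by apply: bigcup_open => W [].
  by move=> y [W [oW WY hW] Wy]; exists W.
Qed.

End regular_points.

(** * The coefficients of the representation *)

Section derivatives_of_combinations.
Context {R : realType} {V W : normedModType R}.

Lemma frechetD_continuous_at p (X : set V) (f : V -> W) m x : open X ->
  Cp_on p X f -> Np p m -> X x -> {for x, continuous (frechetD f m)}.
Proof.
move=> oX [_ fc] pm Xx; have := fc m pm x.
rewrite /prop_for /continuous_at -nbhs_subspace_interior//.
by move: (open_nbhs_nbhs (conj oX Xx)).
Qed.

Lemma frechetD_sum p (X : set V) I (r : seq I) (f : I -> V -> W) m x : open X ->
  (forall i, Cp_on p X (f i)) -> Np p m -> X x ->
  frechetD (fun z => \sum_(i <- r) f i z) m x = \sum_(i <- r) frechetD (f i) m x.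
Proof.
move=> oX fX pm Xx; elim: r => [|i r IH].
  rewrite big_nil; have -> : (fun z => \sum_(i <- [::]) f i z) = 0.
    by apply/funext => z; rewrite big_nil.
  by rewrite frechetD0.
have -> : (fun z => \sum_(j <- i :: r) f j z) = 1 *: f i + (fun z => \sum_(j <- r) f j z).
  by apply/funext => z; rewrite big_cons -[RHS]/(1 *: f i z + _) scale1r.
rewrite big_cons (frechetD_linear 1 oX (fX i) _ pm Xx) ?scale1r ?IH//.
by apply: Cp_on_sum => // j _; exact: fX.
Qed.

Context {q : nat} {Y : set V} {oY : open Y}.
Local Notation CqY := (Cp (Some q) oY W).

Lemma scaled_evaluation (c : R) y : Y y -> exists M : {linear CqY -> W},
  continuous M /\ forall f, M f = c *: f y.
Proof.
move=> Yy; have lM : linear (fun f : CqY => c *: f y).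
  by move=> a f g; rewrite Cp_funL scalerDr !scalerA mulrC.
pose M : {linear CqY -> W} :=
  HB.pack (fun f : CqY => c *: f y) (GRing.isLinear.Build _ _ _ _ _ lM).
exists M; split => //; apply: (@Cp_continuous_at_point _ _ _ _ _ _ _ M y 0 `|c|) => //.
move=> f e e0 /(_ [::] isT); rewrite djet_nil pnorm_nil mulr1 => fe.
by rewrite -[M f]/(c *: f y) normrZ ler_wpM2l.
Qed.

(** For fixed g this is a continuous operator on C^q(Y, W), by the Leibniz bound
    at the point y. *)
Lemma product_derivative (U : set V) (g : V -> R^o) m y : open U -> U `<=` Y ->
  Cp_on (Some q) U g -> (m <= q)%N -> U y -> exists M : {linear CqY -> symml m V W},
  continuous M /\ forall f, M f = frechetD (fun z => (g z : R) *: f z) m y.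
Proof.
move=> oU UY gU mq Uy; have fU (f : CqY) := Cp_on_sub oY oU UY (Cp_fun_on f).
have gfU (f : CqY) := Cp_on_mul oU gU (fU f).
pose Mf (f : CqY) := frechetD (fun z => (g z : R) *: f z) m y.
have lM : linear Mf.
  move=> a f1 f2; rewrite /Mf -(frechetD_linear a oU (gfU f1) (gfU f2) mq Uy).
  congr (frechetD _ m y); apply/funext => z.
  by rewrite Cp_funL scalerDr scalerA mulrC -scalerA.
pose M : {linear CqY -> symml m V W} := HB.pack Mf (GRing.isLinear.Build _ _ _ _ _ lM).
exists M; split => //.
have [B B0 gB] := symjet_bdd m.+1 (symjet_djet g y).
apply: (@Cp_continuous_at_point _ _ _ _ _ _ _ M y m (2 ^+ m.+1 * B)) => //.
  exact: UY.
move=> f e e0 fe; apply: frechetD_norm_le => [|s sm]; first by rewrite !mulr_ge0 ?exprn_ge0.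
have sq : (size s <= q)%N by rewrite sm.
rewrite (djet_mul oU gU (fU f) Uy sq) -(mulrA _ B e).
by apply: (leib_bdd B0 e0 gB fe); rewrite sm.
Qed.

End derivatives_of_combinations.

Section regularity_of_coefficients.
Context {R : realType} {n : nat} {E F H : normedModType R} {p : option nat} {q : nat}.
Context {X : set 'rV[R]_n} {Y : set H} {oX : open X} {oY : open Y}.
Local Notation V := 'rV[R]_n.
Local Notation CpX := (Cp p oX E).
Local Notation CqY := (Cp (Some q) oY F).
Variables (T : {linear CpX -> CqY}) (h : H -> V).
Variables (K : set V) (k : nat) (e0 : R) (C : set CqY) (t0 : CqY).
Hypotheses (cK : compact K) (KX : K `<=` X) (e0_gt0 : 0 < e0).
Hypothesis cC : compact (C : set (weak_space CqY)).
Hypothesis TC : forall v : CpX, (forall x, K x -> bdd k.+1 e0 (djet v x)) -> C (T v + t0).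
Variable j : nat.
Local Notation Sj := (symml j V E).
Local Notation term := (@monomial_term R n E F H p (Some q) X Y oX oY T j).
Local Notation terms := (fun b => (term b : {linear Sj -> CqY})).

Definition coefficient (b : @expansion n j) (y : H) : R^o :=
  (j`!%:R)^-1 * (coef_at b (h y) : R).

Lemma representing_terms y (S : Sj) :
  representing T h y S = \sum_b (coefficient b y : R) *: term b S y.
Proof. by rewrite /representing scaler_sumr; apply: eq_bigr => b _; rewrite scalerA. Qed.

Lemma term_radius : exists d : @expansion n j -> R, (forall b, 0 < d b) /\
  forall b (S : Sj), `|S| <= d b -> C (term b S + t0).
Proof.
have dE b : exists d, 0 < d /\ forall S : Sj, `|S| <= d -> C (term b S + t0).
  by have [d d0 dC] := monomial_term_small cK KX e0_gt0 TC b; exists d.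
have [d dP] := choice dE.
by exists d; split=> b; have [] := dP b.
Qed.

Lemma representing_bounded y : Y y -> bounded_linear (representing T h y : Sj -> F).
Proof.
move=> Yy; have [d [d0 dC]] := term_radius.
have ME b : exists M : {linear CqY -> F},
    continuous M /\ forall f, M f = (coefficient b y : R) *: f y.
  exact: scaled_evaluation.
have [M MP] := choice ME.
have [bM _] := combination_weakly_compact (P := terms) d0 cC dC (fun b => (MP b).1).
have -> : (representing T h y : Sj -> F) = fun S => \sum_b M b (term b S).
  apply/funext => S; rewrite representing_terms; apply: eq_bigr => b _.
  by rewrite (MP b).2.
exact: bM.
Qed.

Variable U : set H.
Hypotheses (oU : open U) (UY : U `<=` Y) (hU : Cp_on (Some q) U h).

Lemma Cp_on_coefficient b : Cp_on (Some q) U (coefficient b).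
Proof.
apply: (@Cp_on_mul _ _ _ (Some q) U (fun=> (j`!%:R)^-1) _ oU (Cp_on_cst _ _ oU)).
apply: Cp_on_coef_at => // l; have [A AE] := bounded_linear_bop (@coord_bounded_linear R n l).
by apply: (Cp_on_eq oU (Cp_on_post A oU hU)) => y _; rewrite AE.
Qed.

Lemma Cp_on_coefficient_mul b (f : CqY) :
  Cp_on (Some q) U (fun z => (coefficient b z : R) *: f z).
Proof.
exact: Cp_on_mul oU (Cp_on_coefficient b) (Cp_on_sub oY oU UY (Cp_fun_on f)).
Qed.

Lemma Cp_on_representing (S : Sj) : Cp_on (Some q) U (fun y => representing T h y S).
Proof.
apply: (@Cp_on_eq _ _ _ (Some q) U (fun y => \sum_b (coefficient b y : R) *: term b S y)) => //.
  by apply: Cp_on_sum => // b _; exact: Cp_on_coefficient_mul.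
by move=> y _; exact: representing_terms.
Qed.

Variable m : nat.
Hypothesis mq : (m <= q)%N.
Local Notation D y := (fun S : Sj => frechetD (fun z => representing T h z S) m y).

Lemma derivative_terms y : U y -> exists M : @expansion n j -> {linear CqY -> symml m H F},
  [/\ forall b, continuous (M b),
      forall b f, M b f = frechetD (fun z => (coefficient b z : R) *: f z) m y &
      D y = fun S => \sum_b M b (term b S)].
Proof.
move=> Uy; have ME b : exists M : {linear CqY -> symml m H F}, continuous M /\
    forall f, M f = frechetD (fun z => (coefficient b z : R) *: f z) m y.
  exact: product_derivative oU UY (Cp_on_coefficient b) mq Uy.
have [M MP] := choice ME.
exists M; split; [by move=> b; case: (MP b)|by move=> b; case: (MP b)|].
apply/funext => S; rewrite (_ : (fun z => representing T h z S) =
    fun z => \sum_b (coefficient b z : R) *: term b S z); last first.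
  by apply/funext => z; exact: representing_terms.
rewrite (@frechetD_sum _ _ _ (Some q) U)//; last by move=> b; exact: Cp_on_coefficient_mul.
by apply: eq_bigr => b _; rewrite (MP b).2.
Qed.

Lemma derivative_weakly_compact y : U y -> bounded_linear (D y) /\ weakly_compact (D y).
Proof.
move=> Uy; have [d [d0 dC]] := term_radius.
have [M [cM _ ->]] := derivative_terms Uy.
exact: (combination_weakly_compact (P := terms) d0 cC dC cM).
Qed.

(** Applied to xi, the second adjoint at y is the m-th derivative at y of one
    fixed C^q combination, so that it is even continuous for the norm. *)
Lemma biadjoint_continuous : {within U, continuous (fun y =>
  biadjoint (to_bop (D y)) : sot (bidual Sj) (bidual (symml m H F)))}.
Proof.
have [d [d0 dC]] := term_radius.
apply: continuous_in_subspaceT => y /set_mem Uy.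
apply: sot_cvg => xi e e_gt0.
have [w wP] := combination_biadjoint (W := symml m H F) (P := terms) d0 cC dC xi.
pose G z : symml m H F := frechetD (fun z => \sum_b (coefficient b z : R) *: w b z) m z.
have GP z : U z -> forall phi : dual (symml m H F), biadjoint (to_bop (D z)) xi phi = phi (G z).
  move=> Uz phi; have [M [cM ME ->]] := derivative_terms Uz.
  rewrite wP//; congr (phi _); rewrite /G (@frechetD_sum _ _ _ (Some q) U)//.
    by apply: eq_bigr => b _; rewrite ME.
  by move=> b; exact: Cp_on_coefficient_mul.
have Gc : {for y, continuous G}.
  apply: (@frechetD_continuous_at _ _ _ (Some q) U) => //.
  by apply: Cp_on_sum => // b _; exact: Cp_on_coefficient_mul.
have near_U : \forall z \near y, U z by exact: open_nbhs_nbhs.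
move/cvgrPdist_le : Gc => /(_ e e_gt0) Ge.
suff : \forall z \near y, `|biadjoint (to_bop (D z)) xi - biadjoint (to_bop (D y)) xi| <= e by [].
apply: filterS2 near_U Ge => z Uz Gz.
apply: sup_norm_le => [|phi phi1]; first exact: unit_ball_neq0.
rewrite bop_linearB !GP//.
have [lphi _] := bopP phi.
have -> : phi (G z) - phi (G y) = phi (G z - G y).
  have := lphi (-1) (G y) (G z); rewrite !scaleN1r => e1.
  by rewrite [G z - _]addrC e1 addrC.
rewrite (le_trans (bop_norm_le _ _))// (le_trans _ Gz)// distrC.
by rewrite ler_piMl.
Qed.

End regularity_of_coefficients.

Theorem theorem33 (R : realType) (n : nat) (E F H : completeNormedModType R)
    (X : set 'rV[R]_n) (oX : open X) (Y : set H) (oY : open Y)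
    (p : option nat) (q : nat) (T : {linear Cp p oX E -> Cp (Some q) oY F}) :
  lt_enat q p ->
  weakly_compact T -> separating T -> nowhere_trivial T ->
  exists2 l : nat, Np p l &
  exists Phi : forall k : nat, H -> symml k 'rV[R]_n E -> F,
  [/\ forall (f : Cp p oX E) (y : H), Y y ->
        T f y = \sum_(k < l.+1) Phi k y (frechetD f k (support_map T y)),
      forall (k : nat) (y : H), (k <= l)%N -> Y y -> bounded_linear (Phi k y),
      relatively_compact_in X (support_map T @` Y) &
      exists U : set H,
      [/\ open U, U `<=` Y, Y `<=` closure U,
          Cp_on (Some q) U (support_map T) &
          forall k : nat, (k <= l)%N ->
          [/\ forall S : symml k 'rV[R]_n E,
                Cp_on (Some q) U (fun y => Phi k y S),
              forall (y : H) (m : nat), U y -> Np (Some q) m ->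
                let D := fun S => frechetD (fun z => Phi k z S) m y in
                bounded_linear D /\ weakly_compact D &
              forall m : nat, Np (Some q) m ->
                {within U, continuous (fun y =>
                  biadjoint (to_bop (fun S => frechetD (fun z => Phi k z S) m y))
                  : sot (bidual (symml k 'rV[R]_n E)) (bidual (symml m H F)))}]]].
Proof.
move=> _ wT sT nT.
have [K [k [e0 [C [t0 [cK KX pk e0_gt0 [cC TC]]]]]]] := weakly_compact_jet_ball wT.
have hP := support_pointP cK KX pk e0_gt0 cC TC sT nT.
set h := support_map T in hP *.
have hK y : Y y -> K (h y) by move=> /hP[].
have hX y : Y y -> X (h y) by move=> /hK/KX.
have hT y : Y y -> forall f g : Cp p oX E, (forall s, (size s <= k)%N ->
    djet f (h y) s = djet g (h y) s) -> T f y = T g y by move=> /hP[].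
exists k => //; exists (fun j y S => representing T h y S); split.
- by move=> f y Yy; exact: (representingE KX hK hT).
- by move=> j y _ Yy; exact: (representing_bounded h cK KX e0_gt0 cC TC).
- exact: support_map_relatively_compact cK KX pk e0_gt0 cC TC sT nT.
have [U [oU UY YU hU]] := Cp_on_dense oY (fun W i => @coordinate_Cp_on
  R n E F H p (Some q) X Y oX oY T h k i pk hX hT nT W).
exists U; split => // j jk; split.
- by move=> S; exact: Cp_on_representing.
- by move=> y m Uy mq; exact: (derivative_weakly_compact cK KX e0_gt0 cC TC j oU UY hU mq).
- by move=> m mq; exact: (biadjoint_continuous cK KX e0_gt0 cC TC oU UY hU mq).
Qed.
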